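(* Let $\varphi(z)$ be the nonzero function $az^{n_1}\overline{z}^{m_1}+bz^{n_2}\overline{z}^{m_2}$ on $\mathbb{D}$, where $a,b$ are nonzero complex constants and $n_1,n_2,m_1,m_2$ are positive integers. Then the dual Toeplitz operator $S_\varphi$ is hyponormal (equivalently, normal) on $(L_h^2)^\perp$ if and only if one of the following conditions holds: (1) $n_1=m_1=n_2=m_2$; (2) $n_1=m_1$, $n_2=m_2$, $n_1\neq n_2$ and $\arg(a)=\arg(b)$; (3) $n_1=m_2$, $m_1=n_2$, $n_1\neq m_1$ and $|a|=|b|$.
   Context: $\mathbb{D}$ is the open unit disk in $\mathbb{C}$, $dA=\frac1\pi\,dx\,dy$ is normalized area measure, and $L^2(\mathbb{D})=L^2(\mathbb{D},dA)$ is the space of (complex-valued) square-integrable functions with inner product $\langle f,g\rangle=\int_{\mathbb{D}} f\overline{g}\,dA$. $L_h^2$ is the harmonic Bergman space, i.e. the closed subspace of $L^2(\mathbb{D})$ consisting of all (complex-valued) harmonic functions on $\mathbb{D}$ in $L^2(\mathbb{D})$; $(L_h^2)^\perp$ is its orthogonal complement in $L^2(\mathbb{D})$, and $Q$ is the orthogonal projection of $L^2(\mathbb{D})$ onto $L_h^2$. For $\varphi\in L^\infty(\mathbb{D})$, the dual Toeplitz operator $S_\varphi$ with symbol $\varphi$ is the bounded linear operator on $(L_h^2)^\perp$ given by $S_\varphi u=(I-Q)(\varphi u)$, where $I$ is the identity operator. A bounded operator $T$ on a Hilbert space is hyponormal if $T^*T-TT^*\geqslant 0$, and normal if $T^*T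=TT^*$.
   Formalization: In condition (2), arg(a)=arg(b) is taken modulo π (a/b real); as printed the claim fails, e.g. for the real symbol |z|^2−|z|^4 (a=1, b=−1), whose operator is self-adjoint although arg(a)≠arg(b). *)

(* Defs.v *)
From HB Require Import structures.
From mathcomp Require Import all_boot all_order all_algebra.
From mathcomp Require Import all_classical all_reals all_analysis.
From mathcomp Require Export complex.

Set Implicit Arguments.
Unset Strict Implicit.
Unset Printing Implicit Defensive.

Import Order.TTheory GRing.Theory Num.Theory.
Import numFieldNormedType.Exports.

Local Open Scope classical_set_scope.
Local Open Scope ring_scope.
Local Open Scope complex_scope.

Section Disk.
Context {R : realType}.
Local Notation mR := (measurableTypeR R).

(* Elements of L^2(D) are represented by functions on the whole of R[i]; only
   their values on the disk matter, and equality in L^2(D) is [aeD] below.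
   Measurability, integration and differentiation go through R * R. *)
Definition cplx (p : R * R) : R[i] := p.1 +i* p.2.

Definition disk : set (R * R) := [set p | `|cplx p| < 1].

Definition area : {measure set (mR * mR) -> \bar R} :=
  (@lebesgue_measure R \x @lebesgue_measure R)%E.

Definition rePart (f : R[i] -> R[i]) (p : R * R) : R := complex.Re (f (cplx p)).
Definition imPart (f : R[i] -> R[i]) (p : R * R) : R := complex.Im (f (cplx p)).

(* Integral over D against dA = dx dy / pi; junk value 0 for a part which is not
   integrable, which does not occur for products of two elements of L^2(D). *)
Definition integralD (f : R[i] -> R[i]) : R[i] :=
  (pi^-1 * Rintegral area disk (rePart f)) +i*
  (pi^-1 * Rintegral area disk (imPart f)).

Definition dotD (f g : R[i] -> R[i]) : R[i] :=
  integralD (fun z => f z * (g z)^*).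

Definition L2D : set (R[i] -> R[i]) := [set f |
  [/\ measurable_fun (disk : set (mR * mR)) (rePart f),
      measurable_fun (disk : set (mR * mR)) (imPart f) &
      (\int[area]_(p in disk) ((rePart f p ^+ 2 + imPart f p ^+ 2)%:E) < +oo)%E]].

Definition aeD (f g : R[i] -> R[i]) : Prop :=
  {ae area, forall p, disk p -> f (cplx p) = g (cplx p)}.

Definition e_x : R * R := (1, 0).
Definition e_y : R * R := (0, 1).

Definition C2_at (g : R * R -> R) (p : R * R) : Prop :=
  {for p, continuous g} /\
  forall v, v \in [:: e_x; e_y] ->
    [/\ derivable g p v, {for p, continuous ('D_v g)} &
        forall w, w \in [:: e_x; e_y] ->
          derivable ('D_v g) p w /\ {for p, continuous ('D_w ('D_v g))}].

Definition harmonic_on_disk (g : R * R -> R) : Prop :=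
  forall p, disk p ->
    C2_at g p /\ 'D_e_x ('D_e_x g) p + 'D_e_y ('D_e_y g) p = 0.

(* The harmonic Bergman space L_h^2. *)
Definition L2h : set (R[i] -> R[i]) := [set f |
  [/\ L2D f, harmonic_on_disk (rePart f) & harmonic_on_disk (imPart f)]].

Definition orthD (M : set (R[i] -> R[i])) : set (R[i] -> R[i]) :=
  [set f | L2D f /\ forall g, M g -> dotD f g = 0].

(* Orthogonal projection onto L_h^2: the element h of L_h^2 such that f - h is
   orthogonal to L_h^2.  It exists for f in L^2(D) because L_h^2 is closed, and
   its restriction to D is unique because harmonic functions are continuous. *)
Definition projQ (f : R[i] -> R[i]) : R[i] -> R[i] :=
  xget (fun=> 0) [set h | L2h h /\ orthD L2h (fun z => f z - h z)].

Definition dualToeplitz (phi u : R[i] -> R[i]) : R[i] -> R[i] :=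
  fun z => phi z * u z - projQ (fun w => phi w * u w) z.

Definition is_adjoint (H : set (R[i] -> R[i]))
    (T T' : (R[i] -> R[i]) -> (R[i] -> R[i])) : Prop :=
  (forall v, H v -> H (T' v)) /\
  forall u v, H u -> H v -> dotD (T u) v = dotD u (T' v).

(* In R[i], [0 <= z] means that z is real and nonnegative. *)
Definition hyponormal (H : set (R[i] -> R[i]))
    (T : (R[i] -> R[i]) -> (R[i] -> R[i])) : Prop :=
  exists T', is_adjoint H T T' /\
    forall u, H u -> 0 <= dotD (fun z => T' (T u) z - T (T' u) z) u.

Definition normal_op (H : set (R[i] -> R[i]))
    (T : (R[i] -> R[i]) -> (R[i] -> R[i])) : Prop :=
  exists T', is_adjoint H T T' /\
    forall u, H u -> aeD (T' (T u)) (T (T' u)).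

(* Principal argument, in ]-pi, pi], of a nonzero complex number. *)
Definition carg (z : R[i]) : R :=
  let t := acos (complex.Re z / complex.Re `|z|) in
  if 0 <= complex.Im z then t else - t.

(* Equality of arguments modulo pi, i.e. the two numbers lie on one real line
   through 0.  Modulo 2 pi would be too strong for the normality of dual
   Toeplitz operators: the symbol |z|^2 - |z|^4 is real, so its operator is
   self-adjoint, although arg 1 and arg (-1) differ by pi. *)
Definition eq_arg_mod_pi (a b : R[i]) : Prop :=
  exists k : int, carg a - carg b = k%:~R * pi.

Definition symbol (a b : R[i]) (n1 m1 n2 m2 : nat) (z : R[i]) : R[i] :=
  a * z ^+ n1 * z^* ^+ m1 + b * z ^+ n2 * z^* ^+ m2.

End Disk.

(* Main.v *)
(* For a bounded symbol phi and u orthogonal to L_h^2, hyponormality of S_phi reads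
   |Q (phi u)| <= |Q (phi^* u)|.  Since L_h^2 is stable under conjugation, the same
   inequality for u^* is the reverse one, so that |Q (phi u)| = |Q (phi^* u)| for
   all u: hyponormality is already a two-sided condition.  Test it on
   u = sum_i alpha_i z^(d+i) (z^* )^i with d large.  Such a u, times a monomial
   z^n (z^* )^m, is projected to a multiple of z^(d+n-m), with coefficient
   proportional to L (d+n) where L k = sum_i alpha_i / (k+i+1); and u is orthogonal
   to L_h^2 as soon as L d = 0.  Cauchy matrices being invertible, the values of L
   at d+n1, d+n2, d+m1, d+m2 are arbitrary, and the resulting quadratic identities
   force one of the three conditions.  Conversely each condition makes phi^* a
   constant multiple of phi, which makes S_phi normal.

   The projection Q has to be constructed.  The monomials z^k and (z^* )^k are
   orthogonal, the Fourier series of a function of L^2 along them converges to a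
   harmonic function, and completeness of this system in L_h^2 follows by dilation,
   from the uniform approximation of harmonic functions on smaller disks by real
   parts of polynomials (Bernstein polynomials on a circle, and the maximum
   principle). *)

Require Import Defs.
From mathcomp Require Import all_boot all_order all_algebra.
From mathcomp Require Import all_classical all_reals all_analysis.
From mathcomp Require Import measurable_realfun ring lra zify.

Set Implicit Arguments.
Unset Strict Implicit.
Unset Printing Implicit Defensive.

Import Order.TTheory GRing.Theory Num.Theory.
Import numFieldNormedType.Exports.

Local Open Scope classical_set_scope.
Local Open Scope ring_scope.
Local Open Scope complex_scope.

Local Notation integralD := Defs.integralD.
Local Notation Re := complex.Re.
Local Notation Im := complex.Im.
Local Notation normc := Normc.normc.

(** * Square-integrable functions on the disk *)

(** Polar coordinates are avoided: moments come from Fubini along chords of the disk and the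
    fundamental theorem of calculus, and the area of the disk stays an unevaluated positive constant
    [area0] that cancels in every ratio. Completeness of L^2 is not invoked either: the projection
    is defined pointwise by power series, and Fatou's lemma turns Bessel's inequality into
    convergence in norm. Since [projQ] is obtained by choice, its linearity and its commutation with
    conjugation are only used up to functions of norm zero.

    For the necessity, the frequencies n1 - m1 and n2 - m2 of the two monomials decide what the test
    functions see. If they differ, the projected pieces are orthogonal and squared amplitudes add;
    letting L vanish at all exponents but one then forces {n1, n2} = {m1, m2} and |a| = |b|. If they
    agree, amplitudes add before being squared, so that relative phases become visible and arguments
    are compared. Positivity of the exponents keeps the points d + n and d + m away from d, where L
    has to vanish. *)

Section ComplexParts.
Context {R : realType}.
Implicit Types z w : R[i].

Lemma ReD z w : Re (z + w) = Re z + Re w. Proof. by case: z w => a b []. Qed.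
Lemma ImD z w : Im (z + w) = Im z + Im w. Proof. by case: z w => a b []. Qed.
Lemma ReN z : Re (- z) = - Re z. Proof. by case: z. Qed.
Lemma ImN z : Im (- z) = - Im z. Proof. by case: z. Qed.
Lemma ReM z w : Re (z * w) = Re z * Re w - Im z * Im w.
Proof. by case: z w => a b []. Qed.
Lemma ImM z w : Im (z * w) = Re z * Im w + Im z * Re w.
Proof. by case: z w => a b []. Qed.
Lemma ReJ z : Re z^* = Re z. Proof. by case: z. Qed.
Lemma ImJ z : Im z^* = - Im z. Proof. by case: z. Qed.

Lemma Re_sum (I : Type) (r : seq I) (P : pred I) (F : I -> R[i]) :
  Re (\sum_(i <- r | P i) F i) = \sum_(i <- r | P i) Re (F i).
Proof. by elim/big_rec2: _ => //= i x y _ <-; rewrite ReD. Qed.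
Lemma Im_sum (I : Type) (r : seq I) (P : pred I) (F : I -> R[i]) :
  Im (\sum_(i <- r | P i) F i) = \sum_(i <- r | P i) Im (F i).
Proof. by elim/big_rec2: _ => //= i x y _ <-; rewrite ImD. Qed.

Lemma complex_ext z w : Re z = Re w -> Im z = Im w -> z = w.
Proof. by case: z w => a b [c d] /= -> ->. Qed.

Lemma normc_normE z : `|z| = (normc z)%:C.
Proof. by case: z. Qed.

Lemma sqr_normc_parts z : normc z ^+ 2 = Re z ^+ 2 + Im z ^+ 2.
Proof. by case: z => a b /=; rewrite sqr_sqrtr // addr_ge0 // sqr_ge0. Qed.

Lemma normc_ge0 z : 0 <= normc z.
Proof. by case: z => a b /=; rewrite sqrtr_ge0. Qed.

Lemma normcX z n : normc (z ^+ n) = normc z ^+ n.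
Proof.
elim: n => [|n IH]; first by rewrite !expr0 Normc.normc1.
by rewrite !exprS Normc.normcM IH.
Qed.

Lemma normcJ_real z : normc z^* = normc z.
Proof. by case: z => a b /=; rewrite sqrrN. Qed.

Lemma norm_Re_le z : `|Re z| <= normc z.
Proof. by rewrite -lecR -normc_normE normc_ge_Re. Qed.

Lemma norm_Im_le z : `|Im z| <= normc z.
Proof.
rewrite -(@ler_pXn2r _ 2) ?nnegrE ?normc_ge0 ?normr_ge0 //.
by rewrite sqr_normc_parts real_normK ?num_real // lerDr sqr_ge0.
Qed.

Lemma normc_real (x : R) : normc x%:C = `|x|.
Proof. by rewrite /= expr0n /= addr0 sqrtr_sqr. Qed.

Lemma mulcJ z : z * z^* = (normc z ^+ 2)%:C.
Proof.
rewrite sqr_normc_parts; apply: complex_ext; rewrite ?ReM ?ImM ReJ ImJ /=; ring.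
Qed.

Lemma normc_eq0 z : (normc z == 0) = (z == 0).
Proof.
by apply/eqP/eqP => [/Normc.eq0_normc|->] //; rewrite Normc.normc0.
Qed.

Lemma diskE (p : R * R) : disk p = (p.1 ^+ 2 + p.2 ^+ 2 < 1) :> Prop.
Proof.
rewrite /disk /= normc_normE (_ : 1 = 1%:C) // ltcR.
by rewrite -[X in _ < X](@sqrtr1 R) /= ltr_sqrt.
Qed.

Lemma disk_normc (p : R * R) : disk p = (normc (cplx p) < 1) :> Prop.
Proof. by rewrite /disk /= normc_normE (_ : 1 = 1%:C) // ltcR. Qed.

End ComplexParts.

Section DiskIntegral.
Context {R : realType}.
Local Notation mR := (measurableTypeR R).
Local Notation mD := (@disk R : set (mR * mR)).
Local Notation mu := (@area R).
Implicit Types (c : R[i]) (f g : mR * mR -> R) (F G : R[i] -> R[i]).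

Definition integrable_disk f : Prop := mu.-integrable mD (EFin \o f).

Lemma measurable_disk : measurable mD.
Proof.
have -> : mD = (fun p : mR * mR => (p.1 ^+ 2 + p.2 ^+ 2 : R)) @^-1` `]-oo, (1 : R)[%classic.
  by apply/seteqP; split=> p; rewrite diskE /= in_itv.
rewrite -[X in measurable X]setTI.
have h : measurable_fun [set: mR * mR] (fun p : mR * mR => (p.1 ^+ 2 + p.2 ^+ 2 : R)).
  by apply: measurable_funD; apply: measurable_funX;
    [exact: measurable_fst|exact: measurable_snd].
exact: h.
Qed.

Lemma disk_box (p : R * R) : disk p -> `|p.1| < 1 /\ `|p.2| < 1.
Proof.
rewrite diskE => h; split; rewrite -[X in _ < X]normr1 -ltr_sqr
  ?nnegrE ?normr_ge0 // !real_normK ?num_real // expr1n.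
- by apply: le_lt_trans h; rewrite lerDl sqr_ge0.
- by apply: le_lt_trans h; rewrite lerDr sqr_ge0.
Qed.

Lemma area_rect (a b c d : R) : a <= b -> c <= d ->
  mu (`[a, b]%classic `*` `[c, d]%classic) = ((b - a) * (d - c))%:E.
Proof.
move=> ab cd.
transitivity (@lebesgue_measure R `[a, b]%classic * @lebesgue_measure R `[c, d]%classic)%E.
  by rewrite -[LHS]/((@lebesgue_measure R \x @lebesgue_measure R)%E _) product_measure1E.
rewrite !lebesgue_measure_itv /=.
rewrite !lte_fin; move: ab cd; rewrite !le_eqVlt => /predU1P[->|ab].
  by rewrite ltxx mul0e subrr mul0r.
move=> /predU1P[->|cd]; first by rewrite ltxx mule0 subrr mulr0.
by rewrite ab cd -!EFinB -EFinM.
Qed.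

(** Finiteness and positivity of the area are all that is used of it, so a square around the disk
    and a square inside it suffice. *)
Lemma area_disk_lty : (mu mD < +oo)%E.
Proof.
apply: (@le_lt_trans _ _ (mu (`[-1, 1]%classic `*` `[-1, 1]%classic))); last first.
  by rewrite area_rect ?ltry // -subr_ge0 opprK addr_ge0.
apply: le_measure; rewrite ?inE; first exact: measurable_disk.
  exact: measurableX.
move=> p /disk_box; rewrite !ltr_norml => -[/andP[a b] /andP[c d]].
by split; rewrite /= in_itv /= !ltW.
Qed.

Lemma area_disk_gt0 : (0 < mu mD)%E.
Proof.
apply: (@lt_le_trans _ _ (mu (`[0, 2^-1]%classic `*` `[0, 2^-1]%classic))).
  by rewrite area_rect ?lte_fin ?invr_ge0 // subr0 mulr_gt0.
apply: le_measure; rewrite ?inE; [exact: measurableX|exact: measurable_disk|].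
move=> [x y] /= [] /=; rewrite !in_itv /= => /andP[x0 x1] /andP[y0 y1].
by rewrite diskE /=; nra.
Qed.

Lemma integrable_diskD f g : integrable_disk f -> integrable_disk g ->
  integrable_disk (f \+ g).
Proof. by move=> hf hg; exact: (lebesgue_integrable.integrableD measurable_disk hf hg). Qed.

Lemma integrable_diskZ (c : R) f : integrable_disk f -> integrable_disk (fun p => c * f p).
Proof. by move=> hf; exact: (integrableZl measurable_disk c hf). Qed.

Lemma integrable_disk_le f g : measurable_fun mD f -> integrable_disk g ->
  (forall p, disk p -> `|f p| <= g p) -> integrable_disk f.
Proof.
move=> mf ig h; apply: (le_integrable measurable_disk _ _ ig).
  exact/measurable_EFinP.
by move=> p dp; rewrite /= lee_fin (le_trans (h _ dp)) ?ler_norm.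
Qed.

Lemma integrable_disk_cst (c : R) : integrable_disk (cst c).
Proof.
apply: measurable_bounded_integrable; [exact: measurable_disk|exact: area_disk_lty| |].
  exact: measurable_cst.
by exists `|c|; split; [rewrite num_real|move=> x /ltW cx p _].
Qed.

Definition integrable_diskC F : Prop :=
  integrable_disk (rePart F) /\ integrable_disk (imPart F).

Lemma integrable_diskCZ c F : integrable_diskC F -> integrable_diskC (fun z => c * F z).
Proof.
move=> [f1 f2]; split.
- have -> : rePart (fun z => c * F z) =
      (fun p => Re c * rePart F p) \+ (fun p => - Im c * imPart F p).
    by apply/funext => p /=; rewrite /rePart ReM mulNr.
  by apply: integrable_diskD; apply: integrable_diskZ.
- have -> : imPart (fun z => c * F z) =
      (fun p => Re c * imPart F p) \+ (fun p => Im c * rePart F p).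
    by apply/funext => p /=; rewrite /imPart ImM.
  by apply: integrable_diskD; apply: integrable_diskZ.
Qed.

Lemma integralDD F G : integrable_diskC F -> integrable_diskC G ->
  integralD (fun z => F z + G z) = integralD F + integralD G.
Proof.
move=> [f1 f2] [g1 g2]; apply: complex_ext; rewrite ?ReD ?ImD /= -mulrDr; congr (_ * _).
- rewrite -RintegralD //; last exact: measurable_disk.
  by apply: eq_Rintegral => p _; rewrite /rePart ReD.
- rewrite -RintegralD //; last exact: measurable_disk.
  by apply: eq_Rintegral => p _; rewrite /imPart ImD.
Qed.

Lemma integralDZ c F : integrable_diskC F ->
  integralD (fun z => c * F z) = c * integralD F.
Proof.
move=> [f1 f2]; have md := measurable_disk.
apply: complex_ext; rewrite ?ReM ?ImM /= ![_ * (pi^-1 * _)]mulrCA -?mulrBr -?mulrDr;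
  congr (_ * _).
- rewrite -!RintegralZl // -mulN1r -RintegralZl //; last exact: integrable_diskZ.
  rewrite -RintegralD //; try by do ?apply: integrable_diskZ.
  by apply: eq_Rintegral => p _; rewrite /rePart ReM mulN1r.
- rewrite -!RintegralZl //.
  rewrite -RintegralD //; try by do ?apply: integrable_diskZ.
  by apply: eq_Rintegral => p _; rewrite /imPart ImM.
Qed.

Lemma eq_integralD F G : (forall p, disk p -> F (cplx p) = G (cplx p)) ->
  integralD F = integralD G.
Proof.
move=> h; rewrite /integralD; congr (_ * _ +i* (_ * _));
 by apply: eq_Rintegral => p; rewrite inE => dp; rewrite /rePart /imPart h.
Qed.

Lemma integralDJ F : integrable_diskC F ->
  integralD (fun z => (F z)^*) = (integralD F)^*.
Proof.
move=> [f1 f2]; apply: complex_ext; rewrite ?ReJ ?ImJ /=.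
  by congr (_ * _); apply: eq_Rintegral => p _; rewrite /rePart ReJ.
rewrite -mulrN -mulN1r; congr (_ * _).
rewrite -RintegralZl //; last exact: measurable_disk.
by apply: eq_Rintegral => p _; rewrite /imPart ImJ mulN1r.
Qed.

End DiskIntegral.

Section SquareIntegrable.
Context {R : realType}.
Local Notation mR := (measurableTypeR R).
Local Notation mD := (@disk R : set (mR * mR)).
Local Notation mu := (@area R).
Implicit Types (c : R[i]) (f g h : R[i] -> R[i]).

Definition sqPart f (p : mR * mR) : R := rePart f p ^+ 2 + imPart f p ^+ 2.

Definition measurable_diskC f : Prop :=
  measurable_fun mD (rePart f) /\ measurable_fun mD (imPart f).

Lemma sqPart_ge0 f p : 0 <= sqPart f p.
Proof. by rewrite addr_ge0 // sqr_ge0. Qed.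

Lemma measurable_sqPart f : measurable_diskC f -> measurable_fun mD (sqPart f).
Proof. by move=> [m1 m2]; apply: measurable_funD; exact: measurable_funX. Qed.

Lemma L2DP f : L2D f <-> measurable_diskC f /\ integrable_disk (sqPart f).
Proof.
split=> [[m1 m2 i]|[[m1 m2] i]].
  have m : measurable_diskC f by [].
  split=> //; apply/integrableP; split; first by apply/measurable_EFinP; exact: measurable_sqPart.
  apply: le_lt_trans i; apply: ge0_le_integral => //.
  - exact: measurable_disk.
  - apply: measurableT_comp; first exact: abse_measurable.
    by apply/measurable_EFinP; exact: measurable_sqPart.
  - by apply/measurable_EFinP; exact: measurable_sqPart.
  - by move=> p _ /=; rewrite lee_fin ger0_norm // sqPart_ge0.
split=> //; move/(integrable_lty measurable_disk): i.
by [].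
Qed.

Lemma measurable_diskCM f g : measurable_diskC f -> measurable_diskC g ->
  measurable_diskC (fun z => f z * g z).
Proof.
move=> [f1 f2] [g1 g2]; split.
- rewrite (_ : rePart _ = (rePart f \* rePart g) \- (imPart f \* imPart g)); last first.
    by apply/funext => p; rewrite /rePart ReM.
  by apply: measurable_funB; exact: measurable_funM.
- rewrite (_ : imPart _ = (rePart f \* imPart g) \+ (imPart f \* rePart g)); last first.
    by apply/funext => p; rewrite /imPart ImM.
  by apply: measurable_funD; exact: measurable_funM.
Qed.

Lemma measurable_diskCD f g : measurable_diskC f -> measurable_diskC g ->
  measurable_diskC (fun z => f z + g z).
Proof.
move=> [f1 f2] [g1 g2]; split.
- rewrite (_ : rePart _ = rePart f \+ rePart g); last first.
    by apply/funext => p; rewrite /rePart ReD.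
  exact: measurable_funD.
- rewrite (_ : imPart _ = imPart f \+ imPart g); last first.
    by apply/funext => p; rewrite /imPart ImD.
  exact: measurable_funD.
Qed.

Lemma measurable_diskC_cst c : measurable_diskC (cst c).
Proof. by split; exact: measurable_cst. Qed.

Lemma measurable_diskC_id : measurable_diskC id.
Proof.
by split; apply: (measurable_funS measurableT (subsetT _));
  [exact: measurable_fst|exact: measurable_snd].
Qed.

Lemma measurable_diskCJ f : measurable_diskC f -> measurable_diskC (fun z => (f z)^*).
Proof.
move=> [m1 m2]; split.
- rewrite (_ : rePart _ = rePart f) //.
  by apply/funext => p; rewrite /rePart ReJ.
- rewrite (_ : imPart _ = \- imPart f); first exact: measurable_funN.
  by apply/funext => p; rewrite /imPart ImJ.
Qed.

Lemma measurable_diskCX f n : measurable_diskC f -> measurable_diskC (fun z => f z ^+ n).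
Proof.
move=> mf; elim: n => [|n IH].
  rewrite (_ : (fun z => _) = cst 1); first exact: measurable_diskC_cst.
  by apply/funext => z; rewrite expr0.
rewrite (_ : (fun z => _) = (fun z => f z * f z ^+ n)); first exact: measurable_diskCM.
by apply/funext => z; rewrite exprS.
Qed.

Lemma sqPartE f p : sqPart f p = normc (f (cplx p)) ^+ 2.
Proof. by rewrite sqr_normc_parts. Qed.

Lemma L2D_dominated f g (M : R) : measurable_diskC f -> L2D g ->
  (forall p, disk p -> normc (f (cplx p)) <= M * normc (g (cplx p))) -> L2D f.
Proof.
move=> mf /L2DP[mg ig] h; apply/L2DP; split => //.
apply: (@integrable_disk_le _ _ (fun p => M ^+ 2 * sqPart g p)).
- exact: measurable_sqPart.
- exact: integrable_diskZ.
- move=> p dp; rewrite !sqPartE -exprMn ger0_norm ?sqr_ge0 //.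
  by rewrite ler_sqr ?nnegrE ?normc_ge0 ?h // (le_trans (normc_ge0 _) (h _ dp)).
Qed.

Lemma L2D_cst c : L2D (cst c).
Proof.
apply/L2DP; split; first exact: measurable_diskC_cst.
exact: (integrable_disk_cst (Re c ^+ 2 + Im c ^+ 2)).
Qed.

Lemma L2D_bounded f (M : R) : measurable_diskC f ->
  (forall p, disk p -> normc (f (cplx p)) <= M) -> L2D f.
Proof.
move=> mf h; apply: (L2D_dominated (M := M) mf (L2D_cst 1)) => p dp.
by rewrite Normc.normc1 mulr1 h.
Qed.

Lemma L2DM f g (M : R) : measurable_diskC f ->
  (forall p, disk p -> normc (f (cplx p)) <= M) -> L2D g -> L2D (fun z => f z * g z).
Proof.
move=> mf h Lg; have [mg _] := (L2DP g).1 Lg.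
apply: (L2D_dominated (M := M) _ Lg); first exact: measurable_diskCM.
by move=> p dp; rewrite Normc.normcM ler_wpM2r ?normc_ge0 // h.
Qed.

Lemma L2DZ c f : L2D f -> L2D (fun z => c * f z).
Proof. by apply: (@L2DM (cst c) _ (normc c)) => //; exact: measurable_diskC_cst. Qed.

Lemma L2DD f g : L2D f -> L2D g -> L2D (fun z => f z + g z).
Proof.
move=> /L2DP[mf If] /L2DP[mg Ig]; apply/L2DP; split; first exact: measurable_diskCD.
apply: (@integrable_disk_le _ _ (fun p => 2 * (sqPart f p + sqPart g p))).
- by apply: measurable_sqPart; exact: measurable_diskCD.
- by apply: integrable_diskZ; exact: integrable_diskD.
- move=> p dp; rewrite ger0_norm ?sqPart_ge0 // /sqPart /rePart /imPart ReD ImD.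
  have := sqr_ge0 (Re (f (cplx p)) - Re (g (cplx p))).
  have := sqr_ge0 (Im (f (cplx p)) - Im (g (cplx p))).
  by rewrite !sqrrB; lra.
Qed.

Lemma L2DJ f : L2D f -> L2D (fun z => (f z)^*).
Proof.
move=> Lf; have [mf _] := (L2DP f).1 Lf.
apply: (L2D_dominated (M := 1) _ Lf); first exact: measurable_diskCJ.
by move=> p dp; rewrite normcJ_real mul1r.
Qed.

Lemma L2DB f g : L2D f -> L2D g -> L2D (fun z => f z - g z).
Proof.
move=> Lf /(@L2DZ (-1)) Lg; have := L2DD Lf Lg.
by under [X in L2D X]funext do rewrite mulN1r.
Qed.

Lemma L2D_sum (I : Type) (r : seq I) (F : I -> R[i] -> R[i]) :
  (forall i, L2D (F i)) -> L2D (fun z => \sum_(i <- r) F i z).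
Proof.
move=> LF; elim: r => [|i r IH].
  by under [X in L2D X]funext do rewrite big_nil; exact: L2D_cst.
by under [X in L2D X]funext do rewrite big_cons; exact: L2DD.
Qed.

Lemma eqD_L2D f g : (forall p, disk p -> f (cplx p) = g (cplx p)) -> L2D f -> L2D g.
Proof.
move=> e /L2DP[[m1 m2] i]; apply/L2DP.
have m : measurable_diskC g.
  split.
  - apply: eq_measurable_fun m1 => p; rewrite inE => dp; by rewrite /rePart e.
  - apply: eq_measurable_fun m2 => p; rewrite inE => dp; by rewrite /imPart e.
split => //; apply: (@integrable_disk_le _ _ (sqPart f)) => //.
  exact: measurable_sqPart.
by move=> p dp; rewrite ger0_norm ?sqPart_ge0 // !sqPartE e.
Qed.

Lemma integrable_dot f g : L2D f -> L2D g -> integrable_diskC (fun z => f z * (g z)^*).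
Proof.
move=> /L2DP[mf If] /L2DP[mg Ig].
have [m1 m2] := measurable_diskCM mf (measurable_diskCJ mg).
have ib : integrable_disk (fun p => sqPart f p + sqPart g p) by exact: integrable_diskD.
have bd p : normc (f (cplx p) * (g (cplx p))^*) <= sqPart f p + sqPart g p.
  rewrite Normc.normcM normcJ_real !sqPartE.
  set x := normc _; set y := normc _.
  by have := sqr_ge0 (x - y); have := sqr_ge0 (x + y); rewrite sqrrB sqrrD; lra.
by split; apply: (integrable_disk_le _ ib) => // p _; apply: le_trans (bd p);
  [exact: norm_Re_le|exact: norm_Im_le].
Qed.

Lemma eq_dotD f f' g g' : (forall p, disk p -> f (cplx p) = f' (cplx p)) ->
  (forall p, disk p -> g (cplx p) = g' (cplx p)) -> dotD f g = dotD f' g'.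
Proof. by move=> e e'; apply: eq_integralD => p dp; rewrite e ?e'. Qed.

Lemma dotDDl f g h : L2D f -> L2D g -> L2D h ->
  dotD (fun z => f z + g z) h = dotD f h + dotD g h.
Proof.
move=> Lf Lg Lh; rewrite /dotD -integralDD; try exact: integrable_dot.
by apply: eq_integralD => p _; rewrite mulrDl.
Qed.

Lemma dotDZl c f g : L2D f -> L2D g -> dotD (fun z => c * f z) g = c * dotD f g.
Proof.
move=> Lf Lg; rewrite /dotD -integralDZ; last exact: integrable_dot.
by apply: eq_integralD => p _; rewrite mulrA.
Qed.

Lemma dotDC f g : L2D f -> L2D g -> dotD g f = (dotD f g)^*.
Proof.
move=> Lf Lg; rewrite /dotD -integralDJ; last exact: integrable_dot.
by apply: eq_integralD => p _; rewrite rmorphM /= conjcK mulrC.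
Qed.

Lemma dotDDr f g h : L2D f -> L2D g -> L2D h ->
  dotD f (fun z => g z + h z) = dotD f g + dotD f h.
Proof.
move=> Lf Lg Lh; rewrite dotDC; [|exact: L2DD|by []].
by rewrite dotDDl // rmorphD /= (dotDC Lg Lf) (dotDC Lh Lf).
Qed.

Lemma dotDZr c f g : L2D f -> L2D g -> dotD f (fun z => c * g z) = c^* * dotD f g.
Proof.
move=> Lf Lg; rewrite dotDC; [|exact: L2DZ|by []].
by rewrite dotDZl // rmorphM /= (dotDC Lg Lf).
Qed.

Lemma dotDBl f g h : L2D f -> L2D g -> L2D h ->
  dotD (fun z => f z - g z) h = dotD f h - dotD g h.
Proof.
move=> Lf Lg Lh; rewrite -[in RHS]mulN1r -dotDZl // -dotDDl //; last exact: L2DZ.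
by apply: eq_dotD => // p _; rewrite mulN1r.
Qed.

Lemma dotDBr f g h : L2D f -> L2D g -> L2D h ->
  dotD f (fun z => g z - h z) = dotD f g - dotD f h.
Proof.
move=> Lf Lg Lh; rewrite dotDC; [|exact: L2DB|by []].
by rewrite dotDBl // rmorphB /= (dotDC Lg Lf) (dotDC Lh Lf).
Qed.

Lemma dotD_suml (I : Type) (r : seq I) (F : I -> R[i] -> R[i]) g :
  (forall i, L2D (F i)) -> L2D g ->
  dotD (fun z => \sum_(i <- r) F i z) g = \sum_(i <- r) dotD (F i) g.
Proof.
move=> LF Lg; elim: r => [|i r IH].
  rewrite big_nil -[RHS](mul0r (dotD g g)) -dotDZl //.
  by apply: eq_dotD => // p _; rewrite big_nil mul0r.
rewrite big_cons -IH -dotDDl //; last exact: L2D_sum.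
by apply: eq_dotD => // p _; rewrite big_cons.
Qed.

Lemma dotD0r f g : L2D f -> (forall p, disk p -> g (cplx p) = 0) -> dotD f g = 0.
Proof.
move=> Lf g0; transitivity (dotD f (fun z => 0 * f z)).
  by apply: eq_dotD => // p dp; rewrite g0 // mul0r.
by rewrite dotDZr // rmorph0 mul0r.
Qed.

(** The squared norm, as a real number; by [dotDff] the real part loses nothing. *)
Definition nsq f : R := Re (dotD f f).

Lemma nsqE f : nsq f = pi^-1 * Rintegral mu mD (sqPart f).
Proof.
congr (_ * _); apply: eq_Rintegral => p _.
by rewrite [RHS]sqPartE mulcJ.
Qed.

Lemma nsq_ge0 f : 0 <= nsq f.
Proof.
rewrite nsqE mulr_ge0 ?invr_ge0 ?pi_ge0 //.
by apply: Rintegral_ge0 => p _; exact: sqPart_ge0.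
Qed.

Lemma dotDff f : dotD f f = (nsq f)%:C.
Proof.
apply: complex_ext => //=.
rewrite (@eq_Rintegral _ _ _ _ _ (cst 0)) ?Rintegral_cst ?mul0r ?mulr0 //.
  exact: measurable_disk.
by move=> p _; rewrite mulcJ.
Qed.

Lemma nsq_integral f : L2D f ->
  (\int[mu]_(p in mD) (sqPart f p)%:E = (pi * nsq f)%:E)%E.
Proof.
move=> /L2DP[_ i]; rewrite nsqE mulrA divff ?gt_eqF ?pi_gt0 // mul1r /Rintegral.
by rewrite fineK //; apply: integrable_fin_num => //; exact: measurable_disk.
Qed.

Lemma nsqZ c f : L2D f -> nsq (fun z => c * f z) = normc c ^+ 2 * nsq f.
Proof.
move=> Lf; rewrite /nsq dotDZl ?dotDZr //; last exact: L2DZ.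
by rewrite mulrA mulcJ ReM /= mul0r subr0.
Qed.

Lemma nsqD f g : L2D f -> L2D g ->
  nsq (fun z => f z + g z) = nsq f + nsq g + 2 * Re (dotD f g).
Proof.
move=> Lf Lg; rewrite /nsq dotDDl ?dotDDr //; last exact: L2DD.
by rewrite (dotDC Lf Lg) !ReD ReJ; ring.
Qed.

Lemma nsqB f g : L2D f -> L2D g ->
  nsq (fun z => f z - g z) = nsq f + nsq g - 2 * Re (dotD f g).
Proof.
move=> Lf Lg; rewrite /nsq dotDBl ?dotDBr //; last exact: L2DB.
by rewrite (dotDC Lf Lg) !ReD !ReN ReD ReN ReJ; ring.
Qed.

(** The squared norm of f - t <f,g> g is a nonnegative quadratic polynomial in the real t; it is
    evaluated at its minimum t = 1 / |g|^2 when g has nonzero norm. *)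
Lemma dotD_CauchySchwarz f g : L2D f -> L2D g ->
  normc (dotD f g) ^+ 2 <= nsq f * nsq g.
Proof.
move=> Lf Lg; pose d := dotD f g; pose n := normc d ^+ 2.
have key (t : R) : 0 <= nsq f + t ^+ 2 * n * nsq g - 2 * t * n.
  have := nsq_ge0 (fun z => f z - (t%:C * d) * g z).
  rewrite nsqB ?nsqZ //; last exact: L2DZ.
  rewrite dotDZr // Normc.normcM normc_real exprMn real_normK ?num_real //.
  have -> : (t%:C * d)^* * dotD f g = (t * n)%:C.
    rewrite -/d /n; case: (d) => x y; rewrite sqr_normc_parts.
    by apply: complex_ext => /=; ring.
  by rewrite /= mulrA.
have n0 : 0 <= n by rewrite sqr_ge0.
have g0 := nsq_ge0 g; have f0 := nsq_ge0 f.
have [gz|gn] := eqVneq (nsq g) 0.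
  rewrite -/n gz mulr0; have [//|np] := lerP n 0.
  (* With [nsq g = 0], [key] reads 0 <= nsq f - 2 t n; this t makes the right side equal to - nsq f
     - 2. *)
  have := key ((nsq f + 1) / n); rewrite gz mulr0 addr0 -mulrA divfK ?gt_eqF //.
  by lra.
have gp : 0 < nsq g by rewrite lt_neqAle eq_sym gn.
rewrite -[normc _ ^+ 2]/n -ler_pdivrMr // -subr_ge0; apply: le_trans (key (nsq g)^-1) _.
by rewrite le_eqVlt; apply/orP; left; apply/eqP; field; rewrite gt_eqF.
Qed.

Lemma nsq0_ae f : L2D f -> nsq f = 0 -> aeD f (fun=> 0).
Proof.
move=> Lf n0; have := nsq_integral Lf; rewrite n0 mulr0.
have [mf _] := (L2DP f).1 Lf.
rewrite (_ : integral _ _ _ = \int[mu]_(p in mD) `|(sqPart f p)%:E|)%E; last first.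
  by apply: eq_integral => p _; rewrite gee0_abs // lee_fin sqPart_ge0.
have ms : measurable_fun mD (fun p => (sqPart f p)%:E).
  by apply/measurable_EFinP; exact: measurable_sqPart.
move/(ae_eq_integral_abs mu measurable_disk ms).
apply: filterS => p h dp; have [] := h dp.
rewrite sqPartE => /eqP; rewrite sqrf_eq0 => /eqP; exact: Normc.eq0_normc.
Qed.

Lemma aeD_dot f f' g : L2D f -> L2D f' -> L2D g -> aeD f f' -> dotD f g = dotD f' g.
Proof.
move=> Lf Lf' Lg e; apply/eqP; rewrite -subr_eq0 -dotDBl //; apply/eqP.
have Lh : L2D (fun z => f z - f' z) by exact: L2DB.
have n0 : nsq (fun z => f z - f' z) = 0.
  rewrite nsqE /Rintegral (@ae_eq_integral _ _ _ _ _ (cst 0%E)) ?integral0 ?mulr0 //.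
  - exact: measurable_disk.
  - by apply/measurable_EFinP; apply: measurable_sqPart; have [] := (L2DP _).1 Lh.
  - move: e; rewrite /aeD => -[N [mN N0 sN]]; exists N; split=> // p h; apply: sN => h'.
    by apply: h => dp; rewrite sqPartE h' // subrr Normc.normc0 expr0n.
have := dotD_CauchySchwarz Lh Lg; rewrite n0 mul0r => h.
apply: Normc.eq0_normc; apply/eqP; rewrite -sqrf_eq0 eq_le h sqr_ge0 //.
Qed.

Lemma nsq_eqD f g : (forall p, disk p -> f (cplx p) = g (cplx p)) -> nsq f = nsq g.
Proof. by move=> h; rewrite /nsq (eq_dotD h h). Qed.

Lemma nsq_sup f (M : R) : (forall p, disk p -> normc (f (cplx p)) <= M) -> L2D f ->
  nsq f <= M ^+ 2 * nsq (fun=> 1).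
Proof.
move=> h Lf.
have h0 : 0 <= M by apply: le_trans (h (0, 0) _); rewrite ?normc_ge0 // diskE /= expr0n addr0.
have -> : M ^+ 2 * nsq (fun=> 1) = nsq (fun=> M%:C * 1).
  by rewrite nsqZ ?normc_real ?real_normK ?num_real //; exact: L2D_cst.
rewrite !nsqE ler_wpM2l ?invr_ge0 ?pi_ge0 //.
apply: le_Rintegral; first exact: measurable_disk.
- by have [] := (L2DP _).1 Lf.
- by have [] := (L2DP _).1 (L2D_cst (M%:C * 1)).
- move=> p dp; rewrite -[leLHS]/(sqPart f p) -[leRHS]/(sqPart (fun=> M%:C * 1) p).
  rewrite !sqPartE mulr1 normc_real (ger0_norm h0).
  by rewrite ler_sqr ?nnegrE ?normc_ge0 // h.
Qed.

Lemma nsq1_gt0 : 0 < nsq (fun=> 1).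
Proof.
rewrite nsqE mulr_gt0 ?invr_gt0 ?pi_gt0 //.
rewrite (@eq_Rintegral _ _ _ _ _ (cst 1)).
  rewrite Rintegral_cst; last exact: measurable_disk.
  by rewrite mul1r fine_gt0 // area_disk_gt0 area_disk_lty.
by move=> p _; rewrite -[LHS]/(sqPart (fun=> 1) p) sqPartE Normc.normc1 expr1n.
Qed.

End SquareIntegrable.

(** * Moments of monomials *)

Section Moments.
Context {R : realType}.
Local Notation mR := (measurableTypeR R).
Local Notation mD := (@disk R : set (mR * mR)).
Local Notation mu := (@area R).
Implicit Types (c l : R[i]) (F G : R -> R[i]).

Definition is_cderive (t : R) F l : Prop :=
  is_derive t 1 (fun x => Re (F x)) (Re l) /\ is_derive t 1 (fun x => Im (F x)) (Im l).

Lemma is_cderive_eq t F l l' : is_cderive t F l -> l = l' -> is_cderive t F l'.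
Proof. by move=> h <-. Qed.

Lemma is_cderive_cst t c : is_cderive t (cst c) 0.
Proof. by split; exact: is_derive_cst. Qed.

Lemma is_cderiveD t F G l l' : is_cderive t F l -> is_cderive t G l' ->
  is_cderive t (fun x => F x + G x) (l + l').
Proof.
move=> [f1 f2] [g1 g2]; split.
- rewrite (_ : (fun x => _) = (fun x => Re (F x)) + (fun x => Re (G x))); last first.
    by apply/funext => x; rewrite ReD.
  by rewrite ReD; exact: is_deriveD.
- rewrite (_ : (fun x => _) = (fun x => Im (F x)) + (fun x => Im (G x))); last first.
    by apply/funext => x; rewrite ImD.
  by rewrite ImD; exact: is_deriveD.
Qed.

Lemma is_cderiveM t F G l l' : is_cderive t F l -> is_cderive t G l' ->
  is_cderive t (fun x => F x * G x) (l * G t + F t * l').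
Proof.
move=> [f1 f2] [g1 g2]; split.
- rewrite (_ : (fun x => _) = (fun x => Re (F x)) * (fun x => Re (G x)) -
     (fun x => Im (F x)) * (fun x => Im (G x))); last first.
    by apply/funext => x; rewrite ReM.
  apply: (is_derive_eq (is_deriveB (is_deriveM f1 g1) (is_deriveM f2 g2))).
  by rewrite ReD !ReM -![_ *: _]/(_ * _); ring.
- rewrite (_ : (fun x => _) = (fun x => Re (F x)) * (fun x => Im (G x)) +
     (fun x => Im (F x)) * (fun x => Re (G x))); last first.
    by apply/funext => x; rewrite ImM.
  apply: (is_derive_eq (is_deriveD (is_deriveM f1 g2) (is_deriveM f2 g1))).
  by rewrite ImD !ImM -![_ *: _]/(_ * _); ring.
Qed.

Lemma is_cderiveX t F l n : is_cderive t F l ->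
  is_cderive t (fun x => F x ^+ n) (n%:R * F t ^+ n.-1 * l).
Proof.
move=> h; elim: n => [|n IH].
  rewrite mulr0n !mul0r (_ : (fun x => _) = cst 1); first exact: is_cderive_cst.
  by apply/funext => x; rewrite expr0.
rewrite (_ : (fun x => _) = (fun x => F x * F x ^+ n)); last first.
  by apply/funext => x; rewrite exprS.
apply: is_cderive_eq (is_cderiveM h IH) _ => /=.
rewrite -natr1; case: n {IH} => [|n] /=; last by rewrite exprS; ring.
by rewrite !mul0r mulr0; ring.
Qed.

Lemma is_cderive_continuous t F l : is_cderive t F l ->
  {for t, continuous (fun x => Re (F x))} /\ {for t, continuous (fun x => Im (F x))}.
Proof.
by move=> [[h1 _] [h2 _]]; split; apply: differentiable_continuous;
  apply/derivable1_diffP.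
Qed.

(** For s = 1 - y^2 the set is the chord of the disk at height y. It is empty for s <= 0; otherwise
    f vanishes at both endpoints. *)
Lemma chord_integral0 (f f' : R -> R) (s : R) :
  (forall t : R, is_derive t 1 f (f' t)) -> continuous f' ->
  (forall t, t ^+ 2 = s -> f t = 0) ->
  (\int[lebesgue_measure]_(t in [set t | (t ^+ 2 < s)%R]) (f' t)%:E = 0)%E.
Proof.
move=> df cf f0; have [s0|s0] := lerP s 0.
  rewrite (_ : [set t | _] = set0) ?integral_set0 //.
  by apply/seteqP; split => t //= /lt_le_trans /(_ s0); rewrite ltNge sqr_ge0.
pose r := Num.sqrt s.
have r0 : 0 < r by rewrite sqrtr_gt0.
have rs : r ^+ 2 = s by rewrite sqr_sqrtr // ltW.
have -> : [set t | (t ^+ 2 < s)%R] = `](- r), r[%classic.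
  have e (t : R) : (t ^+ 2 < s) = (- r < t < r).
    by rewrite -ltr_norml -rs -[t ^+ 2]real_normK ?num_real // ltr_sqr ?nnegrE ?normr_ge0 // ltW.
  by apply/seteqP; split=> t /=; rewrite in_itv /= e.
have mf A : measurable_fun A (EFin \o f').
  apply/measurable_EFinP; apply: (measurable_funS measurableT (subsetT _)).
  exact: continuous_measurable_fun.
rewrite integral_itv_obnd_cbnd // integral_itv_bndo_bndc //.
have cf0 : continuous f.
  by move=> t; apply: differentiable_continuous; apply/derivable1_diffP; have [] := df t.
rewrite (@continuous_FTC2 _ f' f) //.
- by rewrite !f0 ?subee // sqrrN.
- by rewrite gtrN.
- exact: continuous_subspaceT.
- split.
  + by move=> t _; have [] := df t.
  + exact/cvg_at_right_filter/cf0.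
  + exact/cvg_at_left_filter/cf0.
- by move=> t _; rewrite derive1E; have [_ ->] := df t.
Qed.

(** Fubini cuts the disk into chords, and each contributes 0: the divergence theorem for a field
    vanishing on the boundary. *)
Lemma disk_integral_dx (w w' : R * R -> R) :
  integrable_disk w' ->
  (forall x y : R, is_derive x 1 (fun t => w (t, y)) (w' (x, y))) ->
  (forall y, continuous (fun t => w' (t, y))) ->
  (forall p, p.1 ^+ 2 + p.2 ^+ 2 = 1 -> w p = 0) ->
  Rintegral mu mD w' = 0.
Proof.
move=> iw dw cw w0; rewrite /Rintegral integral_mkcond.
have iw2 : mu.-integrable [set: mR * mR] ((EFin \o w') \_ mD).
  by apply/(integrable_restrict _ measurable_disk) => //; rewrite setTI.
rewrite -(@integral21_prod_meas1 _ _ _ _ _ lebesgue_measure lebesgue_measure _ iw2).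
rewrite (eq_integral (cst 0%E)) ?integral0 // => y _.
rewrite /fubini_G.
rewrite -[RHS](@chord_integral0 (fun t => w (t, y)) (fun t => w' (t, y)) (1 - y ^+ 2)) //.
  rewrite [RHS]integral_mkcond; apply: eq_integral => x _.
  rewrite !patchE; congr (if _ then _ else _).
  by apply/idP/idP; rewrite !inE diskE /= ltrBrDr.
by move=> t ht; apply: w0; rewrite /= ht subrK.
Qed.

Lemma disk_integral_dy (w w' : R * R -> R) :
  integrable_disk w' ->
  (forall x y : R, is_derive y 1 (fun t => w (x, t)) (w' (x, y))) ->
  (forall x, continuous (fun t => w' (x, t))) ->
  (forall p, p.1 ^+ 2 + p.2 ^+ 2 = 1 -> w p = 0) ->
  Rintegral mu mD w' = 0.
Proof.
move=> iw dw cw w0; rewrite /Rintegral integral_mkcond.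
have iw2 : mu.-integrable [set: mR * mR] ((EFin \o w') \_ mD).
  by apply/(integrable_restrict _ measurable_disk) => //; rewrite setTI.
rewrite -(@integral12_prod_meas1 _ _ _ _ _ lebesgue_measure lebesgue_measure _ iw2).
rewrite (eq_integral (cst 0%E)) ?integral0 // => x _.
rewrite /fubini_F.
rewrite -[RHS](@chord_integral0 (fun t => w (x, t)) (fun t => w' (x, t)) (1 - x ^+ 2)) //.
  rewrite [RHS]integral_mkcond; apply: eq_integral => y _.
  rewrite !patchE; congr (if _ then _ else _).
  by apply/idP/idP; rewrite !inE diskE /= ltrBrDl.
by move=> t ht; apply: w0; rewrite /= ht addrC subrK.
Qed.

Definition mono (i j : nat) (z : R[i]) : R[i] := z ^+ i * z^* ^+ j.

Lemma monoJ i j z : (mono i j z)^* = mono j i z.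
Proof. by rewrite /mono rmorphM !rmorphXn /= conjcK mulrC. Qed.

Lemma monoM i j k m z : mono i j z * mono k m z = mono (i + k) (j + m) z.
Proof. by rewrite /mono !exprD; ring. Qed.

Lemma normc_mono i j z : normc (mono i j z) = normc z ^+ (i + j).
Proof. by rewrite /mono Normc.normcM !normcX normcJ_real exprD. Qed.

Lemma measurable_mono i j : measurable_diskC (mono i j).
Proof.
apply: measurable_diskCM; apply: measurable_diskCX; first exact: measurable_diskC_id.
by apply: measurable_diskCJ; exact: measurable_diskC_id.
Qed.

Lemma mono_le1 i j p : disk p -> normc (mono i j (cplx p)) <= 1.
Proof. by rewrite disk_normc normc_mono => /ltW h; rewrite exprn_ile1 // normc_ge0. Qed.

Lemma L2D_mono i j : L2D (mono i j).
Proof. exact: L2D_bounded (measurable_mono i j) (@mono_le1 i j). Qed.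

Lemma L2D_integrable (f : R[i] -> R[i]) : L2D f -> integrable_diskC f.
Proof.
move=> Lf; have := integrable_dot Lf (L2D_cst 1).
rewrite (_ : (fun z => f z * _) = f) //; apply/funext => z.
by rewrite /cst rmorph1 mulr1.
Qed.

(** At exponent 0 the truncated predecessor is multiplied by 0, so both formulas hold for all
    exponents. *)
Definition mono_dx i j z := i%:R * mono i.-1 j z + j%:R * mono i j.-1 z.
Definition mono_dy i j z := 'i%C * (i%:R * mono i.-1 j z - j%:R * mono i j.-1 z).

Lemma is_cderive_mono_x i j x y :
  is_cderive x (fun t => mono i j (cplx (t, y))) (mono_dx i j (cplx (x, y))).
Proof.
have d1 : is_cderive x (fun t => cplx (t, y)) 1.
  by split; [exact: is_derive_id|exact: is_derive_cst].
have d2 : is_cderive x (fun t => (cplx (t, y))^*) 1.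
  by split; [exact: is_derive_id|exact: (is_derive_cst (- y))].
apply: is_cderive_eq (is_cderiveM (is_cderiveX i d1) (is_cderiveX j d2)) _.
by rewrite /mono_dx /mono; ring.
Qed.

Lemma is_cderive_mono_y i j x y :
  is_cderive y (fun t => mono i j (cplx (x, t))) (mono_dy i j (cplx (x, y))).
Proof.
have d1 : is_cderive y (fun t => cplx (x, t)) 'i%C.
  by split; [exact: is_derive_cst|exact: is_derive_id].
have d2 : is_cderive y (fun t => (cplx (x, t))^*) (- 'i%C).
  split; first by rewrite /= oppr0; exact: (is_derive_cst x).
  by have := is_deriveN (is_derive_id y (1 : R)).
apply: is_cderive_eq (is_cderiveM (is_cderiveX i d1) (is_cderiveX j d2)) _.
rewrite /mono_dy /mono; set I := ('i%C : R[i]); ring.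
Qed.

Lemma is_cderiveZ t c F l : is_cderive t F l -> is_cderive t (fun x => c * F x) (c * l).
Proof.
move=> h; apply: is_cderive_eq (is_cderiveM (is_cderive_cst t c) h) _.
by rewrite mul0r add0r.
Qed.

Lemma disk_integralD_dx (W W' : R[i] -> R[i]) : L2D W' ->
  (forall x y, is_cderive x (fun t => W (cplx (t, y))) (W' (cplx (x, y)))) ->
  (forall x y, exists l, is_cderive x (fun t => W' (cplx (t, y))) l) ->
  (forall z, normc z = 1 -> W z = 0) -> integralD W' = 0.
Proof.
move=> /L2D_integrable[i1 i2] dW cW W0.
have W0' p : p.1 ^+ 2 + p.2 ^+ 2 = 1 -> W (cplx p) = 0.
  by move=> h; apply: W0; rewrite /= h sqrtr1.
apply: complex_ext => /=.
- rewrite (_ : Rintegral _ _ _ = 0) ?mulr0 //; apply: (@disk_integral_dx (rePart W)) => //.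
  + by move=> x y; have [] := dW x y.
  + by move=> y x; have [l /is_cderive_continuous[]] := cW x y.
  + by move=> p h; rewrite /rePart W0'.
- rewrite (_ : Rintegral _ _ _ = 0) ?mulr0 //; apply: (@disk_integral_dx (imPart W)) => //.
  + by move=> x y; have [] := dW x y.
  + by move=> y x; have [l /is_cderive_continuous[]] := cW x y.
  + by move=> p h; rewrite /imPart W0'.
Qed.

Lemma disk_integralD_dy (W W' : R[i] -> R[i]) : L2D W' ->
  (forall x y, is_cderive y (fun t => W (cplx (x, t))) (W' (cplx (x, y)))) ->
  (forall x y, exists l, is_cderive y (fun t => W' (cplx (x, t))) l) ->
  (forall z, normc z = 1 -> W z = 0) -> integralD W' = 0.
Proof.
move=> /L2D_integrable[i1 i2] dW cW W0.
have W0' p : p.1 ^+ 2 + p.2 ^+ 2 = 1 -> W (cplx p) = 0.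
  by move=> h; apply: W0; rewrite /= h sqrtr1.
apply: complex_ext => /=.
- rewrite (_ : Rintegral _ _ _ = 0) ?mulr0 //; apply: (@disk_integral_dy (rePart W)) => //.
  + by move=> x y; have [] := dW x y.
  + by move=> x y; have [l /is_cderive_continuous[]] := cW x y.
  + by move=> p h; rewrite /rePart W0'.
- rewrite (_ : Rintegral _ _ _ = 0) ?mulr0 //; apply: (@disk_integral_dy (imPart W)) => //.
  + by move=> x y; have [] := dW x y.
  + by move=> x y; have [l /is_cderive_continuous[]] := cW x y.
  + by move=> p h; rewrite /imPart W0'.
Qed.

Definition moment i j : R[i] := integralD (mono i j).

Lemma L2D_mono_dx i j : L2D (mono_dx i j).
Proof. by apply: L2DD; apply: L2DZ; exact: L2D_mono. Qed.

Lemma L2D_mono_dy i j : L2D (mono_dy i j).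
Proof. by apply/L2DZ/L2DB; apply: L2DZ; exact: L2D_mono. Qed.

Lemma mono_circle i j z : normc z = 1 -> mono i j z + (-1) * mono i.+1 j.+1 z = 0.
Proof.
move=> z1; have -> : mono i.+1 j.+1 z = (z * z^*) * mono i j z.
  by rewrite /mono !exprS; ring.
by rewrite mulcJ z1 expr1n; rewrite mul1r mulN1r subrr.
Qed.

Lemma is_cderive_mono_dx i j x y :
  exists l, is_cderive x (fun t => mono_dx i j (cplx (t, y))) l.
Proof.
by eexists; apply: is_cderiveD; apply: is_cderiveZ; exact: is_cderive_mono_x.
Qed.

Lemma is_cderive_mono_dy i j x y :
  exists l, is_cderive y (fun t => mono_dy i j (cplx (x, t))) l.
Proof.
rewrite /mono_dy; eexists; apply: is_cderiveZ; apply: is_cderiveD.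
  by apply: is_cderiveZ; exact: is_cderive_mono_y.
under [fun t => _]funext do rewrite -mulN1r.
by do 2! apply: is_cderiveZ; exact: is_cderive_mono_y.
Qed.

(* Stokes: the d-bar derivative of [(1 - |z|^2) z^i (z^* )^j] integrates to 0. *)
Lemma moment_rec i j : j%:R * moment i j.-1 = j.+1%:R * moment i.+1 j.
Proof.
have LX k m : L2D (fun z => (-1) * mono_dx k m z) by apply/L2DZ/L2D_mono_dx.
have LY k m : L2D (fun z => (-1) * mono_dy k m z) by apply/L2DZ/L2D_mono_dy.
have hx : integralD (fun z => mono_dx i j z + (-1) * mono_dx i.+1 j.+1 z) = 0.
  apply: (@disk_integralD_dx (fun z => mono i j z + (-1) * mono i.+1 j.+1 z)).
  - by apply: L2DD => //; exact: L2D_mono_dx.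
  - move=> x y; apply: is_cderiveD; first exact: is_cderive_mono_x.
    by apply: is_cderiveZ; exact: is_cderive_mono_x.
  - move=> x y; have [l hl] := is_cderive_mono_dx i j x y.
    have [l' hl'] := is_cderive_mono_dx i.+1 j.+1 x y.
    by exists (l + (-1) * l'); apply: is_cderiveD => //; exact: is_cderiveZ.
  - exact: mono_circle.
have hy : integralD (fun z => mono_dy i j z + (-1) * mono_dy i.+1 j.+1 z) = 0.
  apply: (@disk_integralD_dy (fun z => mono i j z + (-1) * mono i.+1 j.+1 z)).
  - by apply: L2DD => //; exact: L2D_mono_dy.
  - move=> x y; apply: is_cderiveD; first exact: is_cderive_mono_y.
    by apply: is_cderiveZ; exact: is_cderive_mono_y.
  - move=> x y; have [l hl] := is_cderive_mono_dy i j x y.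
    have [l' hl'] := is_cderive_mono_dy i.+1 j.+1 x y.
    by exists (l + (-1) * l'); apply: is_cderiveD => //; exact: is_cderiveZ.
  - exact: mono_circle.
have hxI : integrable_diskC (fun z => mono_dx i j z + (-1) * mono_dx i.+1 j.+1 z).
  by apply: L2D_integrable; apply: L2DD => //; exact: L2D_mono_dx.
have hyI : integrable_diskC (fun z => mono_dy i j z + (-1) * mono_dy i.+1 j.+1 z).
  by apply: L2D_integrable; apply: L2DD => //; exact: L2D_mono_dy.
have Im k m : integrable_diskC (mono k m) by apply/L2D_integrable/L2D_mono.
have ImZ c k m : integrable_diskC (fun z => c * mono k m z).
  by apply/L2D_integrable/L2DZ/L2D_mono.
(* The combination dx + i dy is twice d-bar: the terms with factor [i%:R] or [i.+1%:R] cancel. *)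
have : integralD (fun z => (2 * j%:R) * mono i j.-1 z + (- (2 * j.+1%:R)) * mono i.+1 j z) = 0.
  transitivity (integralD (fun z => (mono_dx i j z + (-1) * mono_dx i.+1 j.+1 z) +
     'i%C * (mono_dy i j z + (-1) * mono_dy i.+1 j.+1 z))).
    apply: eq_integralD => p _; rewrite /mono_dx /mono_dy /=.
    have e (u v w : R[i]) : w ^+ 2 = -1 -> w * (w * u + (-1) * (w * v)) = - u + v.
      by move=> w2; transitivity (w ^+ 2 * (u - v)); [ring|rewrite w2; ring].
    by rewrite e ?sqr_i //; ring.
  rewrite integralDD //; last exact: integrable_diskCZ.
  by rewrite integralDZ // hx hy mulr0 addr0.
rewrite integralDD // !integralDZ // -/(moment i j.-1) -/(moment i.+1 j) => h.
apply: (@mulfI _ (2 : R[i])); first by rewrite pnatr_eq0.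
by apply/eqP; rewrite -subr_eq0 !mulrA -mulNr h.
Qed.

Lemma momentJ i j : moment j i = (moment i j)^*.
Proof.
rewrite /moment -integralDJ; last exact/L2D_integrable/L2D_mono.
by apply: eq_integralD => p _; rewrite monoJ.
Qed.

(** In place of rotation invariance: [moment_rec] lowers both exponents together until the smaller
    one is 0, where its left side carries the factor 0. *)
Lemma moment_neq i j : i != j -> moment i j = 0.
Proof.
wlog ij : i j / (j < i)%N => [hw|_].
  move=> ij; case: (ltngtP j i) => h; first exact: hw.
    by rewrite momentJ hw ?rmorph0 // eq_sym.
  by rewrite h eqxx in ij.
elim: j i ij => [|j IH] [//|i] ij.
  by apply/eqP; have := moment_rec i 0; rewrite mul0r mul1r => <-.
have := moment_rec i j.+1; rewrite IH // mulr0 => /esym/eqP.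
by rewrite mulf_eq0 pnatr_eq0 /= => /eqP.
Qed.

(** The normalized area of the disk; only its positivity is used. *)
Definition area0 : R := nsq (fun=> 1).

Lemma moment_diag i : moment i i = (area0 / i.+1%:R)%:C.
Proof.
elim: i => [|i IH].
  rewrite divr1 /area0 -dotDff; apply: eq_integralD => p _.
  by rewrite /mono !expr0 rmorph1.
have := moment_rec i i.+1; rewrite /= IH => h.
apply: (@mulfI _ (i.+2%:R : R[i])); first by rewrite pnatr_eq0.
rewrite -h -![_%:R in RHS](rmorph_nat (real_complex R)).
rewrite -![_%:R in LHS](rmorph_nat (real_complex R)) -!rmorphM /=.
by rewrite !(mulrC _ (area0 / _)) !divfK ?pnatr_eq0.
Qed.

Lemma dot_mono i j k m : dotD (mono i j) (mono k m) = moment (i + m) (j + k).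
Proof.
by apply: eq_integralD => p _; rewrite -monoM; congr (_ * _); exact: monoJ.
Qed.

End Moments.

(** * Real parts of power series are harmonic *)

Section PowerSeries.
Context {R : realType}.
Implicit Types (c : nat -> R[i]) (p q v : R * R) (z w : R[i]).

(** Amounts to a radius of convergence at least 1; bounded terms for every r < 1 are easier to carry
    through sums and derivatives than a limit superior. *)
Definition subexponential c : Prop :=
  forall r : R, 0 <= r < 1 -> exists M, forall k, normc (c k) * r ^+ k <= M.

Definition diff_coef c k : R[i] := k.+1%:R * c k.+1.

Definition harm_series c p : R := limn (series (fun k => Re (c k * cplx p ^+ k))).

(** Each of the k + 1 terms of the geometric sum up to s^k is at least s^k, and the sum is at most 1
    / (1 - s). *)
Lemma mulrn_exp_le (s : R) k : 0 <= s < 1 -> k.+1%:R * s ^+ k <= (1 - s)^-1.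
Proof.
move=> /andP[s0 s1]; rewrite -[leRHS]mul1r ler_pdivlMr ?subr_gt0 //.
apply: (@le_trans _ _ ((\sum_(i < k.+1) s ^+ i) * (1 - s))).
  rewrite ler_wpM2r ?subr_ge0 ?(ltW s1) // mulr_natl -[k.+1 in leLHS]card_ord -sumr_const.
  apply: ler_sum => i _; apply: ler_wiXn2l => //; first exact: ltW.
  by rewrite -ltnS.
by rewrite mulrC -opprB mulNr -subrX1 opprB gerBl exprn_ge0.
Qed.

(** With s = 1 - (1 - r) / 4, Bernoulli's inequality gives r <= s^4. Of the four factors s^k, one
    bounds c k, two absorb (k + 1)^2 and the last is the geometric decay. *)
Lemma subexponential_geometric c (r : R) : subexponential c -> 0 <= r < 1 ->
  exists M s, [/\ 0 <= M, 0 <= s < 1 &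
    forall k, normc (c k) * k.+1%:R ^+ 2 * r ^+ k <= M * s ^+ k].
Proof.
move=> hc /andP[r0 r1]; pose s := 1 - (1 - r) / 4.
have s01 : 0 <= s < 1 by rewrite /s; lra.
have rs : r <= s ^+ 4.
  rewrite /s; set t := (1 - r) / 4; have -> : r = 1 - 4 * t by rewrite /t; field.
  have t0 : 0 <= t by rewrite /t; lra.
  have t1 : t <= 1 / 4 by rewrite /t; lra.
  by nra.
have [M hM] := hc s s01; have [s0 s1] := andP s01.
exists (M * ((1 - s)^-1) ^+ 2), s; split => //.
  rewrite mulr_ge0 ?sqr_ge0 //; apply: le_trans (hM 0); rewrite expr0 mulr1; exact: normc_ge0.
move=> k; apply: (@le_trans _ _ (normc (c k) * k.+1%:R ^+ 2 * (s ^+ 4) ^+ k)).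
  rewrite ler_wpM2l ?mulr_ge0 ?sqr_ge0 ?normc_ge0 //.
  by apply: lerXn2r; rewrite ?nnegrE ?exprn_ge0.
have -> : normc (c k) * k.+1%:R ^+ 2 * (s ^+ 4) ^+ k =
   ((normc (c k) * s ^+ k) * (k.+1%:R * s ^+ k) ^+ 2) * s ^+ k.
  by rewrite -!exprM mulnC !exprM; ring.
rewrite ler_wpM2r ?exprn_ge0 // ler_pM ?mulr_ge0 ?sqr_ge0 ?normc_ge0 ?exprn_ge0 //.
have s1' : 0 <= 1 - s by rewrite subr_ge0 ltW.
by rewrite lerXn2r ?nnegrE ?mulr_ge0 ?exprn_ge0 ?invr_ge0 // mulrn_exp_le.
Qed.

Lemma subexponential_diff c : subexponential c -> subexponential (diff_coef c).
Proof.
(* The index shift costs a division by the radius, hence a radius t >= r kept away from 0. *)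
move=> hc r /andP[r0 r1]; pose t := Num.max r 2^-1.
have rt : r <= t by rewrite le_max lexx.
have t0 : 0 < t by rewrite lt_max invr_gt0 ltr0n orbT.
have t1 : t < 1 by rewrite gt_max r1 invf_lt1 // ltr1n.
have [|M [s [M0 s01 h]]] := subexponential_geometric (r := t) hc; first by rewrite ltW.
exists (M / t) => k; rewrite ler_pdivlMr //.
have /andP[s0 s1] := s01.
apply: (@le_trans _ _ (M * s ^+ k.+1)); last first.
  by rewrite ler_piMr // exprn_ile1 // ltW.
apply: le_trans (h k.+1).
rewrite /diff_coef Normc.normcM -mulrA.
rewrite -(rmorph_nat (real_complex R)) normc_real ger0_norm // mulrAC -mulrA.
apply: (@le_trans _ _ (k.+1%:R * (normc (c k.+1) * t ^+ k.+1))).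
  rewrite ler_wpM2l // exprS [leRHS]mulrCA ler_wpM2l ?(ltW t0) // ler_wpM2l ?normc_ge0 //.
  by apply: lerXn2r; rewrite ?nnegrE // ltW.
rewrite [leRHS]mulrAC [leRHS]mulrC ler_wpM2r ?mulr_ge0 ?normc_ge0 ?exprn_ge0 ?(ltW t0) //.
rewrite -natrX ler_nat; apply: (@leq_trans k.+2); first exact: leqnSn.
by rewrite expnS leq_pmulr.
Qed.

Lemma subexponentialZ w c : subexponential c -> subexponential (fun k => w * c k).
Proof.
move=> hc r /hc[M h]; exists (normc w * M) => k.
by rewrite Normc.normcM -mulrA ler_wpM2l ?normc_ge0.
Qed.

Lemma subexponentialD c c' : subexponential c -> subexponential c' ->
  subexponential (fun k => c k + c' k).
Proof.
move=> hc hc' r r01; have [M h] := hc r r01; have [M' h'] := hc' r r01.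
exists (M + M') => k; apply: le_trans (lerD (h k) (h' k)); rewrite -mulrDl.
by rewrite ler_wpM2r ?le_normcD // exprn_ge0 //; case/andP: r01.
Qed.

Lemma subexponential_linear c (M : R) : (forall k, normc (c k) <= M * k.+1%:R) ->
  subexponential c.
Proof.
move=> h r r01; exists (M * (1 - r)^-1) => k.
have M0 : 0 <= M by have := le_trans (normc_ge0 _) (h 0); rewrite mulr1.
apply: (@le_trans _ _ (M * (k.+1%:R * r ^+ k))).
  by rewrite mulrA ler_wpM2r // exprn_ge0 //; case/andP: r01.
by rewrite ler_wpM2l // mulrn_exp_le.
Qed.

Lemma series_geometric_bound (u : nat -> R) (M s : R) : 0 <= M -> 0 <= s < 1 ->
  (forall k, `|u k| <= M * s ^+ k) ->
  cvgn (series u) /\ `|limn (series u)| <= M / (1 - s).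
Proof.
move=> M0 /andP[s0 s1] h.
have cg := @cvg_geometric_series R M s; rewrite ger0_norm // in cg.
have cn : cvgn [normed series u].
  apply: (@series_le_cvg _ _ (geometric M s)) => //.
  - by move=> n /=.
  - by move=> n /=; rewrite mulr_ge0 // exprn_ge0.
  - by apply/cvg_ex; eexists; exact: cg.
have cu := normed_cvg cn; split => //.
apply: le_trans (lim_series_norm cn) _; rewrite -(cvg_lim _ (cg s1)) //.
apply: lim_series_le => //.
by apply/cvg_ex; eexists; exact: cg.
Qed.

Lemma harm_series_cvg c p : subexponential c -> disk p ->
  cvgn (series (fun k => Re (c k * cplx p ^+ k))).
Proof.
rewrite disk_normc => hc p1.
have [|M [s [M0 s01 h]]] := subexponential_geometric (r := normc (cplx p)) hc.
  by rewrite normc_ge0.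
apply: (series_geometric_bound M0 s01 _).1 => k.
apply: le_trans (norm_Re_le _) (le_trans _ (h k)).
rewrite Normc.normcM normcX mulrAC ler_peMr ?mulr_ge0 ?normc_ge0 ?exprn_ge0 ?normc_ge0 //.
by rewrite -natrX ler1n expn_gt0.
Qed.

Lemma harm_seriesD c c' p : subexponential c -> subexponential c' -> disk p ->
  harm_series (fun k => c k + c' k) p = harm_series c p + harm_series c' p.
Proof.
move=> hc hc' dp; have h1 := harm_series_cvg hc dp; have h2 := harm_series_cvg hc' dp.
rewrite /harm_series -limD //; congr (limn _); apply/funext => n.
by rewrite /series /= fctE -big_split /=; apply: eq_bigr => k _; rewrite mulrDl ReD.
Qed.

Lemma harm_seriesZ (t : R) c p : subexponential c -> disk p ->
  harm_series (fun k => t%:C * c k) p = t * harm_series c p.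
Proof.
move=> hc dp; have h := harm_series_cvg hc dp.
apply: cvg_lim => //; apply: cvg_trans (cvgM (cvg_cst t) h); apply: near_eq_cvg.
apply: nearW => n; rewrite /series /= mulr_sumr; apply: eq_bigr => k _.
by rewrite -[in RHS]mulrA [in RHS]ReM mul0r subr0.
Qed.

Definition pow_err (z w : R[i]) k : R[i] := (z + w) ^+ k - z ^+ k - k%:R * z ^+ k.-1 * w.

(** Induction on E(k+1) = (z + w) E(k) + k z^(k-1) w^2, where E(k) is the second-order Taylor
    remainder of the k-th power. The factor r^2 on the left stands for an exponent k - 2 on the
    right. *)
Lemma pow_err_le z w (r : R) k : normc z <= r -> normc (z + w) <= r ->
  normc (pow_err z w k) * r ^+ 2 <= k%:R ^+ 2 * r ^+ k * normc w ^+ 2.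
Proof.
move=> zr zwr; have r0 := le_trans (normc_ge0 _) zr.
elim: k => [|k IH].
  by rewrite /pow_err !expr0 !mul0r subr0 subrr Normc.normc0 mul0r expr0n /= !mul0r.
have -> : pow_err z w k.+1 = (z + w) * pow_err z w k + k%:R * z ^+ k.-1 * w ^+ 2.
  rewrite /pow_err -natr1 /=; case: k {IH} => [|k] /=; first by rewrite !expr0 expr1; ring.
  by rewrite !exprS; ring.
apply: (@le_trans _ _ ((r * normc (pow_err z w k) + k%:R * r ^+ k.-1 * normc w ^+ 2) * r ^+ 2)).
  rewrite ler_wpM2r ?sqr_ge0 //; apply: le_trans (le_normcD _ _) (lerD _ _).
    by rewrite Normc.normcM ler_wpM2r ?normc_ge0.
  rewrite !Normc.normcM !normcX -(rmorph_nat (real_complex R)) normc_real ger0_norm //.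
  rewrite ler_wpM2r ?sqr_ge0 // ler_wpM2l //.
  by apply: lerXn2r; rewrite ?nnegrE ?normc_ge0.
rewrite mulrDl.
apply: (@le_trans _ _ (r * (k%:R ^+ 2 * r ^+ k * normc w ^+ 2) +
   k%:R * r ^+ k.+1 * normc w ^+ 2)).
  apply: lerD; first by rewrite -mulrA ler_wpM2l.
  case: (k) => [|j]; first by rewrite !mul0r.
  by rewrite /= le_eqVlt; apply/orP; left; apply/eqP; rewrite !exprS; ring.
rewrite (_ : _ + _ = (k%:R ^+ 2 + k%:R) * (r ^+ k.+1 * normc w ^+ 2)); last first.
  by rewrite (exprS r k); ring.
rewrite -[leRHS]mulrA ler_wpM2r ?mulr_ge0 ?exprn_ge0 ?normc_ge0 //.
by rewrite -natr1; have := ler0n R k; nra.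
Qed.

Lemma series_shift (u : nat -> R) (l : R) : u 0 = 0 ->
  series (fun k => u k.+1) @ \oo --> l -> series u @ \oo --> l.
Proof.
move=> u0 cu; rewrite -cvg_shiftS (_ : [sequence _]_n = series (fun k => u k.+1)) //.
by apply/funext => n; rewrite /series /= big_nat_recl // u0 add0r.
Qed.

(** A remainder quadratic in q - p, uniform on |z| <= r, yields both the directional derivatives and
    joint continuity. It is [pow_err_le] summed against [subexponential_geometric]. *)
Lemma harm_series_taylor c (r : R) : subexponential c -> 0 < r < 1 ->
  exists K, forall p q, normc (cplx p) <= r -> normc (cplx q) <= r ->
   `|harm_series c q - harm_series c p
     - harm_series (fun k => (cplx q - cplx p) * diff_coef c k) p| <=
   K * normc (cplx q - cplx p) ^+ 2.
Proof.
move=> hc /andP[r0 r1].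
have [|M [s [M0 s01 h]]] := subexponential_geometric (r := r) hc; first by rewrite ltW.
exists (M / r ^+ 2 / (1 - s)) => p q pr qr.
pose w := cplx q - cplx p; rewrite -/w.
have dp : disk p by rewrite disk_normc (le_lt_trans pr).
have dq : disk q by rewrite disk_normc (le_lt_trans qr).
have qw : cplx q = cplx p + w by rewrite /w addrC subrK.
have cq := harm_series_cvg hc dq; have cp := harm_series_cvg hc dp.
have cd := harm_series_cvg (subexponentialZ w (subexponential_diff hc)) dp.
pose u k := Re (c k * (k%:R * cplx p ^+ k.-1 * w)).
have ue : (fun k => u k.+1) = (fun k => Re (w * diff_coef c k * cplx p ^+ k)).
  by apply/funext => k; rewrite /u /diff_coef /=; congr Re; ring.
have cu1 : cvgn (series (fun k => u k.+1)) by rewrite ue.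
have u0 : u 0 = 0 by rewrite /u !mul0r mulr0.
have cu := series_shift u0 cu1.
have ch : cvgn (series u) by apply/cvg_ex; eexists; exact: cu.
rewrite /harm_series -ue -(cvg_lim _ cu) //.
pose E k := Re (c k * pow_err (cplx p) w k).
have -> : limn (series (fun k => Re (c k * cplx q ^+ k))) -
    limn (series (fun k => Re (c k * cplx p ^+ k))) - limn (series u) = limn (series E).
  apply/esym/cvg_lim => //; apply: cvg_trans (cvgB (cvgB cq cp) ch).
  apply: near_eq_cvg; apply: nearW => n; rewrite /series /= !fctE -!sumrB.
  apply: eq_bigr => k _; rewrite /E /u /pow_err qw -!ReN -!ReD; congr Re; ring.
have r2 : 0 < r ^+ 2 by rewrite exprn_gt0.
have w2 : 0 <= normc w ^+ 2 by rewrite sqr_ge0.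
have C0 : 0 <= M / r ^+ 2 * normc w ^+ 2.
  by apply: mulr_ge0 => //; apply: divr_ge0 => //; exact: ltW.
have [|_] := @series_geometric_bound E _ s C0 s01; last by rewrite mulrAC.
move=> k; apply: le_trans (norm_Re_le _) _; rewrite Normc.normcM.
rewrite -(ler_pM2r r2) -[leLHS]mulrA.
apply: (@le_trans _ _ (normc (c k) * (k%:R ^+ 2 * r ^+ k * normc w ^+ 2))).
  by rewrite ler_wpM2l ?normc_ge0 // pow_err_le // -qw.
rewrite (_ : _ * r ^+ 2 = (M * s ^+ k) * normc w ^+ 2); last by field; rewrite gt_eqF.
rewrite mulrA ler_wpM2r //; apply: le_trans (h k).
rewrite mulrA ler_wpM2r ?exprn_ge0 ?(ltW r0) // ler_wpM2l ?normc_ge0 //.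
by rewrite -!natrX ler_nat leq_sqr.
Qed.

Lemma cplxD p q : cplx (p + q) = cplx p + cplx q.
Proof. by []. Qed.

Lemma cplxZ (t : R) v : cplx (t *: v) = t%:C * cplx v.
Proof. by apply: complex_ext; rewrite ?ReM ?ImM /= !mul0r ?subr0 ?addr0. Qed.

Lemma normc_le_norm v : normc (cplx v) <= 2 * `|v|.
Proof.
apply: (@le_trans _ _ (`|v.1| + `|v.2|)).
  rewrite -ler_sqr ?nnegrE ?normc_ge0 ?addr_ge0 // sqr_normc_parts /=.
  rewrite -[v.1 ^+ 2]real_normK ?num_real // -[v.2 ^+ 2]real_normK ?num_real //.
  by have := normr_ge0 v.1; have := normr_ge0 v.2; nra.
have h1 : `|v.1| <= `|v| by rewrite [`|v|]prod_normE le_max lexx.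
have h2 : `|v.2| <= `|v| by rewrite [`|v|]prod_normE le_max lexx orbT.
by lra.
Qed.

Lemma normc_nbhs p (r : R) : normc (cplx p) < r -> \forall q \near p, normc (cplx q) < r.
Proof.
move=> p1; near=> q.
have -> : cplx q = cplx p + cplx (q - p) by rewrite -cplxD addrC subrK.
apply: le_lt_trans (le_normcD _ _) _; rewrite -ltrBrDl.
apply: le_lt_trans (normc_le_norm _) _; rewrite mulrC -ltr_pdivlMr // distrC.
by near: q; apply: cvgr_dist_lt; [exact: cvg_id|rewrite divr_gt0 ?subr_gt0].
Unshelve. all: by end_near.
Qed.

Lemma disk_nbhs p : disk p -> \forall q \near p, disk q.
Proof.
rewrite disk_normc => /normc_nbhs; apply: filterS => q.
by rewrite disk_normc.
Qed.

Lemma disk_radius p : disk p -> exists r : R, 0 < r < 1 /\ normc (cplx p) < r.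
Proof.
rewrite disk_normc => h; exists ((1 + normc (cplx p)) / 2).
have := normc_ge0 (cplx p); move: (normc _) h => t h h0.
by split; [apply/andP; split|]; lra.
Qed.

Lemma is_derive_harm_series c p v : subexponential c -> disk p ->
  is_derive p v (harm_series c) (harm_series (fun k => cplx v * diff_coef c k) p).
Proof.
move=> hc dp; have [r [r01 pr]] := disk_radius dp.
have [K hK] := harm_series_taylor hc r01.
set l := harm_series (fun k => _) p.
have key : h^-1 *: ((harm_series c \o shift p) (h *: v) - harm_series c p) @[h --> 0^'] --> l.
  apply/cvgrPdist_le => e e0.
  pose B := `|K| * normc (cplx v) ^+ 2 + 1.
  have B0 : 0 < B by rewrite ltr_wpDl // mulr_ge0 // sqr_ge0.
  have vd : 0 < normc (cplx v) + 1 by rewrite ltr_wpDl // normc_ge0.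
  pose d := (r - normc (cplx p)) / (normc (cplx v) + 1).
  have d0 : 0 < d by rewrite divr_gt0 // subr_gt0.
  near=> h.
  have h0 : h != 0 by near: h; exact: nbhs_dnbhs_neq.
  have hB : `|h| <= e / B.
    near: h; apply: dnbhs0_le; exact: divr_gt0.
  have hr : normc (cplx (h *: v + p)) <= r.
    have hd : `|h| <= d by near: h; exact: dnbhs0_le.
    rewrite cplxD cplxZ; apply: le_trans (le_normcD _ _) _.
    rewrite Normc.normcM normc_real -lerBrDr; move: hd; rewrite ler_pdivlMr //.
    by apply: le_trans; rewrite ler_wpM2l // lerDl.
  have := hK p (h *: v + p) (ltW pr) hr.
  rewrite cplxD addrK cplxZ.
  rewrite (_ : (fun k => _) = (fun k => h%:C * (cplx v * diff_coef c k))); last first.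
    by apply/funext => k; rewrite mulrA.
  rewrite harm_seriesZ //; last exact/subexponentialZ/subexponential_diff.
  rewrite -/l => hh.
  rewrite distrC /=; have -> : h^-1 *: (harm_series c (h *: v + p) - harm_series c p) - l =
    h^-1 * (harm_series c (h *: v + p) - harm_series c p - h * l).
    by rewrite -[_ *: _]/(_ * _) [in RHS]mulrBr mulKf.
  rewrite normrM normfV ler_pdivrMl ?normr_gt0 //; apply: le_trans hh _.
  rewrite Normc.normcM normc_real exprMn.
  apply: (@le_trans _ _ (`|h| * (`|h| * B))).
    rewrite mulrA -expr2 mulrCA ler_wpM2l ?sqr_ge0 //.
    rewrite /B; apply: (@le_trans _ _ (`|K| * normc (cplx v) ^+ 2)); last by rewrite lerDl.
    by rewrite ler_wpM2r ?sqr_ge0 // ler_norm.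
  by rewrite ler_wpM2l // -ler_pdivlMr.
apply: DeriveDef; first by apply/cvg_ex; exists l.
exact: cvg_lim key.
Unshelve. all: by end_near.
Qed.

(** Directional derivatives do not give continuity in the plane; the uniform Taylor remainder
    does. *)
Lemma harm_series_continuous c p : subexponential c -> disk p ->
  {for p, continuous (harm_series c)}.
Proof.
move=> hc dp; have [r [r01 pr]] := disk_radius dp.
have [K hK] := harm_series_taylor hc r01.
have cd := subexponential_diff hc.
(* The increment q - p sits inside the coefficients; splitting it into real and imaginary parts
   takes it out of the series. *)
have lin q : `|harm_series (fun k => (cplx q - cplx p) * diff_coef c k) p| <=
    normc (cplx q - cplx p) * (`|harm_series (diff_coef c) p| +
      `|harm_series (fun k => 'i%C * diff_coef c k) p|).
  set w := cplx q - cplx p.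
  have -> : (fun k => w * diff_coef c k) =
      (fun k => (Re w)%:C * diff_coef c k + (Im w)%:C * ('i%C * diff_coef c k)).
    by apply/funext => k; rewrite {1}[w]complexE; ring.
  have ci := subexponentialZ 'i%C cd.
  rewrite harm_seriesD ?harm_seriesZ //; try exact: subexponentialZ.
  apply: le_trans (ler_normD _ _) _; rewrite !normrM mulrDr.
  by rewrite lerD // ler_wpM2r // ?norm_Re_le ?norm_Im_le.
set B := _ + _ in lin.
have B0 : 0 <= B by rewrite /B addr_ge0.
pose C := 2 * (B + 2 * `|K| + 1).
have C0 : 0 < C by rewrite /C mulr_gt0 // ltr_wpDl // addr_ge0 // mulr_ge0.
apply/cvgrPdist_le => e e0; near=> q.
have qr : normc (cplx q) < r by near: q; exact: normc_nbhs.
have := hK p q (ltW pr) (ltW qr); have := lin q.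
set L := harm_series (fun k => _) p; have -> : cplx q - cplx p = cplx (q - p) by [].
move: (normc_ge0 (cplx (q - p))) (normc_le_norm (q - p)); set n := normc _ => n0 n2 h1 h2.
have q1 : `|q - p| <= 1 by rewrite distrC; near: q; exact: cvgr_dist_le.
have qe : `|q - p| <= e / C.
  by rewrite distrC; near: q; apply: cvgr_dist_le; [exact: cvg_id|exact: divr_gt0].
rewrite ler_pdivlMr // in qe; apply: le_trans qe; rewrite distrC.
have -> : harm_series c q - harm_series c p = (harm_series c q - harm_series c p - L) + L.
  by rewrite subrK.
apply: le_trans (ler_normD _ _) _; apply: le_trans (lerD h2 h1) _.
have hK' : K <= `|K| by exact: ler_norm.
have hn : n ^+ 2 <= 2 * n by nra.
apply: (@le_trans _ _ (`|K| * (2 * n) + n * B)).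
  rewrite lerD2r; apply: (@le_trans _ _ (`|K| * n ^+ 2)); first by rewrite ler_wpM2r ?sqr_ge0.
  by rewrite ler_wpM2l.
apply: (@le_trans _ _ (n * (B + 2 * `|K| + 1))); first by nra.
by rewrite /C mulrA ler_wpM2r ?(mulrC _ 2) // addr_ge0 // addr_ge0 // mulr_ge0.
Unshelve. all: by end_near.
Qed.

Lemma near_disk_harm_series c p v : subexponential c -> disk p ->
  \forall q \near p, harm_series (fun k => cplx v * diff_coef c k) q = 'D_v (harm_series c) q.
Proof.
move=> hc /disk_nbhs; apply: filterS => q dq.
by have [_ ->] := is_derive_harm_series v hc dq.
Qed.

(** Differentiating along v multiplies the differentiated coefficients by v, so the Laplacian
    multiplies the second ones by 1^2 + i^2 = 0. Derivatives are identified on a neighbourhood,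
    which is what iterating them requires. *)
Lemma harm_series_harmonic c : subexponential c -> harmonic_on_disk (harm_series c).
Proof.
move=> hc p dp; have hd v := subexponentialZ (cplx v) (subexponential_diff hc).
have eD v := near_disk_harm_series v hc dp.
have hdd v (w : R * R) := subexponentialZ (cplx w) (subexponential_diff (hd v)).
have d2 v (w : R * R) : is_derive p w ('D_v (harm_series c))
    (harm_series (fun k => cplx w * diff_coef (fun k => cplx v * diff_coef c k) k) p).
  by apply: near_eq_is_derive (eD v) _; exact: is_derive_harm_series.
have near_cont (f g : R * R -> R) : (\forall q \near p, f q = g q) ->
    {for p, continuous f} -> {for p, continuous g}.
  move=> fg cf; rewrite /prop_for /continuous_at -(nbhs_singleton fg).
  by apply: cvg_trans cf; apply: near_eq_cvg; exact: fg.
split; first split.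
- exact: harm_series_continuous.
- move=> v _; split.
  + by have [] := is_derive_harm_series v hc dp.
  + by apply: near_cont (eD v) _; exact: harm_series_continuous.
  + move=> w _; split; first by have [] := d2 v w.
    have h : \forall q \near p,
        harm_series (fun k => cplx w * diff_coef (fun k => cplx v * diff_coef c k) k) q =
        'D_w ('D_v (harm_series c)) q.
      move/disk_nbhs: (dp); apply: filterS => q dq.
      have := near_disk_harm_series v hc dq => /(near_eq_derive w) <-.
      by have [_ ->] := is_derive_harm_series w (hd v) dq.
    by apply: near_cont h _; exact: harm_series_continuous.
- have [_ hx] := d2 e_x e_x; have [_ hy] := d2 e_y e_y.
  rewrite [X in X + _]hx [X in _ + X]hy {hx hy}.
  rewrite -harm_seriesD //; apply: cvg_lim => //.
  rewrite (_ : series _ = cst 0); first exact: cvg_cst.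
  apply/funext => n; rewrite /series /= big1 // => k _.
  rewrite (_ : _ + _ = 0) ?mul0r //.
  have -> : cplx e_x = 1 :> R[i] by [].
  have -> : cplx e_y = 'i%C :> R[i] by [].
  rewrite /diff_coef !mul1r; set C := c _.
  have -> : 'i%C * (k.+1%:R * ('i%C * (k.+2%:R * C))) = 'i%C ^+ 2 * (k.+1%:R * (k.+2%:R * C)).
    by ring.
  by rewrite sqr_i mulN1r subrr.
Qed.

End PowerSeries.

(** * Approximation of harmonic functions by polynomials *)

Section MaximumPrinciple.
Context {R : realType}.
Implicit Types (g h : R * R -> R) (p q v : R * R) (z w : R[i]).

(** If a > 0, then f1 is positive just to the right of 0, and the mean value theorem gives a point
    with f t > f 0. *)
Lemma second_derivative_max (f f1 : R -> R) (a : R) :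
  (\forall t \near (0 : R), is_derive (t : R) 1 f (f1 t)) -> is_derive (0 : R) 1 f1 a ->
  (\forall t \near (0 : R), f t <= f 0) -> a <= 0.
Proof.
move=> df [df1 df1a] fmax; rewrite leNgt; apply/negP => a0.
have : nbhs (0 : R) [set t : R | is_derive t 1 f (f1 t) /\ f t <= f 0].
  by near=> t; split; near: t.
move=> /nbhs_ballP[d /= d0 hb].
have he (t : R) : `|t| < d -> is_derive t 1 f (f1 t) /\ f t <= f 0.
  by move=> td; apply: hb; rewrite /ball /= sub0r normrN.
have f10 : f1 0 = 0.
  have : is_derive (0 : R) 1 f 0.
    apply: (@derive1_at_max _ f (- d) d 0).
    - by rewrite ge0_cp // ltW.
    - by move=> t; rewrite in_itv /= -ltr_norml => /he[[]].
    - by rewrite in_itv /= oppr_lt0 d0.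
    - by move=> t; rewrite in_itv /= -ltr_norml => /he[].
  have [|[_ h1] _] := he 0; first by rewrite normr0.
  by move=> [_ h2]; rewrite -h1 h2.
have /cvgrPdist_lt/(_ _ a0) : h^-1 *: (f1 h - f1 0) @[h --> 0^'] --> a.
  have := df1; rewrite /derivable => /cvg_ex[l hl].
  have : 'D_1 f1 0 = l by apply: cvg_lim.
  rewrite df1a => ->; apply: cvg_trans hl; apply: near_eq_cvg; near=> h => /=.
  by rewrite addr0 [h *: _]mulr1.
rewrite f10 => /nbhs_ballP[c /= c0 hc].
pose t := Num.min (c / 2) (d / 2).
have t0 : 0 < t by rewrite lt_min !divr_gt0.
have half (x : R) : 0 < x -> x / 2 < x by lra.
have td : t < d by rewrite gt_min (half d) // orbT.
have tc : t < c by rewrite gt_min (half c).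
have small s : 0 <= s <= t -> `|s| < d.
  by move=> /andP[s0 s1]; rewrite ger0_norm // (le_lt_trans s1).
have [||s hs e1] := @MVT R f f1 0 t t0.
- move=> s; rewrite in_itv /= => /andP[s0 s1].
  by have [] := he s (small s _); rewrite ?(ltW s0) ?(ltW s1).
- apply: derivable_within_continuous => s; rewrite in_itv /= => /small /he[[]//].
have := hs; rewrite in_itv /= => /andP[s0 s1].
have t01 : 0 <= t <= t by rewrite ltW /=.
have [_] := he t (small t t01).
rewrite leNgt -subr_gt0 e1 subr0 => /negP; apply.
rewrite mulr_gt0 //.
have : `|a - s^-1 *: (f1 s - 0)| < a.
  apply: hc; last by rewrite gt_eqF.
  by rewrite /ball /= sub0r normrN gtr0_norm // (lt_trans s1).
rewrite subr0 -[_ *: _]/(_ * _) ltr_norml => /andP[_]; rewrite gtrBl.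
by rewrite pmulr_rgt0 // invr_gt0.
Unshelve. all: by end_near.
Qed.

(* Only one-dimensional second derivatives are needed at a maximum, so neither
   mixed nor continuous derivatives are required. *)
Definition laplacian_at g p (l : R) : Prop := exists f1 f2 : R -> R, exists a b : R,
  [/\ (\forall t \near (0 : R), is_derive (t : R) 1 (fun s => g (p + s *: e_x)) (f1 t)) /\
      is_derive (0 : R) 1 f1 a,
      (\forall t \near (0 : R), is_derive (t : R) 1 (fun s => g (p + s *: e_y)) (f2 t)) /\
      is_derive (0 : R) 1 f2 b & a + b = l].

Lemma laplacian_atD g h p k l : laplacian_at g p k -> laplacian_at h p l ->
  laplacian_at (fun q => g q + h q) p (k + l).
Proof.
move=> [f1 [f2 [a [b [[x1 x2] [y1 y2] <-]]]]] [f1' [f2' [a' [b' [[x1' x2'] [y1' y2'] <-]]]]].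
exists (f1 + f1'), (f2 + f2'), (a + a'), (b + b'); split; last by rewrite addrACA.
- split; last exact: is_deriveD.
  by near=> t; apply: is_deriveD; near: t.
- split; last exact: is_deriveD.
  by near=> t; apply: is_deriveD; near: t.
Unshelve. all: by end_near.
Qed.

Lemma laplacian_atZ (c : R) g p l : laplacian_at g p l ->
  laplacian_at (fun q => c * g q) p (c * l).
Proof.
move=> [f1 [f2 [a [b [[x1 x2] [y1 y2] <-]]]]].
exists (c \*: f1), (c \*: f2), (c * a), (c * b); split; last by rewrite mulrDr.
- split; last exact: is_deriveZ.
  by near=> t; apply: is_deriveZ; near: t.
- split; last exact: is_deriveZ.
  by near=> t; apply: is_deriveZ; near: t.
Unshelve. all: by end_near.
Qed.

Lemma laplacian_at_max g p l : laplacian_at g p l ->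
  (\forall q \near p, g q <= g p) -> l <= 0.
Proof.
move=> [f1 [f2 [a [b [[x1 x2] [y1 y2] <-]]]]] gmax.
have line v : \forall t \near (0 : R), g (p + t *: v) <= g (p + 0 *: v).
  have : (p + t *: v) @[t --> (0 : R)] --> p.
    rewrite -[X in _ --> X](addr0 p) -(scale0r v).
    by apply: cvgD; [exact: cvg_cst|apply: cvgZr_tmp; exact: cvg_id].
  by rewrite scale0r addr0 => /(_ _ gmax).
by have := second_derivative_max x1 x2 (line _); have := second_derivative_max y1 y2 (line _); lra.
Qed.

End MaximumPrinciple.

(** * Harmonic polynomials and the maximum principle *)

Section HarmonicPolynomials.
Context {R : realType}.
Implicit Types (g h : R * R -> R) (p q v : R * R) (c z w : R[i]) (k : nat).

Lemma is_derive_slice g p v (t : R) : derivable g (p + t *: v) v ->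
  is_derive t 1 (fun s => g (p + s *: v)) ('D_v g (p + t *: v)).
Proof.
move=> dg; have e : (fun u : R => u^-1 *: (((fun s => g (p + s *: v)) \o shift t) (u *: (1 : R)) -
     g (p + t *: v))) = (fun u => u^-1 *: ((g \o shift (p + t *: v)) (u *: v) - g (p + t *: v))).
  apply/funext => u /=; rewrite [u *: (1 : R)]mulr1 scalerDl.
  by rewrite addrCA.
by apply: DeriveDef; rewrite /derivable /derive e.
Qed.

Lemma harmonic_laplacian_at g p : harmonic_on_disk g -> disk p -> laplacian_at g p 0.
Proof.
move=> hg dp; have [[_ c2] lap] := hg p dp.
have near_line v : \forall t \near (0 : R), disk (p + t *: v).
  have : (p + t *: v) @[t --> (0 : R)] --> p.
    rewrite -[X in _ --> X](addr0 p) -(scale0r v).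
    by apply: cvgD; [exact: cvg_cst|apply: cvgZr_tmp; exact: cvg_id].
  by move/(_ _ (disk_nbhs dp)).
have in_e v : (v \in [:: e_x; e_y : R * R]) -> forall q, disk q -> derivable g q v.
  by move=> hv q dq; have [[_ h] _] := hg q dq; have [] := h v hv.
have ex : (e_x : R * R) \in [:: e_x; e_y] by rewrite inE eqxx.
have ey : (e_y : R * R) \in [:: e_x; e_y] by rewrite !inE eqxx orbT.
have dd v : (v \in [:: e_x; e_y : R * R]) ->
    is_derive (0 : R) 1 (fun t => 'D_v g (p + t *: v)) ('D_v ('D_v g) p).
  move=> hv; have [_ _ /(_ v hv)[dv _]] := c2 v hv.
  rewrite -[X in 'D_v _ X]addr0 -(scale0r v); apply: is_derive_slice.
  by rewrite scale0r addr0.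
have lines v : (v \in [:: e_x; e_y : R * R]) ->
    (\forall t \near (0 : R),
       is_derive (t : R) 1 (fun s => g (p + s *: v)) ('D_v g (p + t *: v))) /\
    is_derive (0 : R) 1 (fun t => 'D_v g (p + t *: v)) ('D_v ('D_v g) p).
  move=> hv; split; last exact: dd.
  move: (near_line v); apply: filterS => t dt; apply: is_derive_slice; exact: in_e dt.
exists (fun t => 'D_e_x g (p + t *: e_x)), (fun t => 'D_e_y g (p + t *: e_y)).
exists ('D_e_x ('D_e_x g) p), ('D_e_y ('D_e_y g) p).
exact: (And3 (lines e_x ex) (lines e_y ey) lap).
Qed.

Lemma laplacian_at_sq p : laplacian_at (fun q => q.1 ^+ 2 + q.2 ^+ 2) p 4.
Proof.
have d1 (a t : R) : is_derive t 1 (fun s : R => (a + s * 1) ^+ 2) (2 * (a + t)).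
  rewrite (_ : (fun s => _) = (cst a + id) ^+ 2); last first.
    by apply/funext => s; rewrite mulr1.
  apply: is_derive_eq; rewrite add0r -![_ *: _]/(_ * _) mulr1.
  by rewrite expr1.
have d2 (a t : R) : is_derive t 1 (fun s : R => 2 * (a + s)) 2.
  rewrite (_ : (fun s => _) = 2 \*: (cst a + id)); last first.
    by apply/funext => s.
  by apply: is_derive_eq; rewrite add0r [_ *: _]mulr1.
exists (fun t => 2 * (p.1 + t)), (fun t => 2 * (p.2 + t)), 2, 2; split; last by rewrite -natrD.
- split; last exact: d2.
  near=> t.
  rewrite (_ : (fun s => _) = (fun s : R => (p.1 + s * 1) ^+ 2) + cst (p.2 ^+ 2)); last first.
    by apply/funext => s /=; rewrite -[s *: 0]/(s * 0) mulr0 addr0.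
  by rewrite -[2 * _]addr0; apply: is_deriveD.
- split; last exact: d2.
  near=> t.
  rewrite (_ : (fun s => _) = cst (p.1 ^+ 2) + (fun s : R => (p.2 + s * 1) ^+ 2)); last first.
    by apply/funext => s /=; rewrite -[s *: 0]/(s * 0) mulr0 addr0.
  by rewrite -[2 * _]add0r; apply: is_deriveD.
Unshelve. all: by end_near.
Qed.

(** A list of coefficient-exponent pairs in which exponents may repeat, so that addition is
    concatenation. *)
Definition hpoly (s : seq (R[i] * nat)) z : R := \sum_(x <- s) Re (x.1 * z ^+ x.2).

Lemma laplacian_at_monomial c k p : laplacian_at (fun q => Re (c * cplx q ^+ k)) p 0.
Proof.
have line v (t : R) : is_cderive t (fun s => cplx (p + s *: v)) (cplx v).
  split => /=.
  - rewrite (_ : (fun s => _) = cst p.1 + (v.1 \*: id)); last first.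
      by apply/funext => s /=; rewrite [s *: _]mulrC.
    by apply: is_derive_eq; rewrite add0r [_ *: _]mulr1.
  - rewrite (_ : (fun s => _) = cst p.2 + (v.2 \*: id)); last first.
      by apply/funext => s /=; rewrite [s *: _]mulrC.
    by apply: is_derive_eq; rewrite add0r [_ *: _]mulr1.
pose d1 v (t : R) := c * (k%:R * cplx (p + t *: v) ^+ k.-1 * cplx v).
pose d2 v := c * ((k%:R * (k.-1%:R * cplx p ^+ k.-1.-1 * cplx v)) * cplx v).
have D1 v t : is_cderive t (fun s => c * cplx (p + s *: v) ^+ k) (d1 v t).
  by apply: is_cderiveZ; apply: is_cderiveX; exact: line.
have D2 v : is_cderive (0 : R) (d1 v) (d2 v).
  rewrite /d1 /d2; apply: is_cderiveZ.
  set X := (X in is_cderive _ X _).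
  have -> : X = (fun t => cplx v * (k%:R * cplx (p + t *: v) ^+ k.-1)).
    by apply/funext => t; rewrite /X; ring.
  rewrite mulrC; apply: is_cderiveZ; apply: is_cderiveZ.
  have -> : cplx p = cplx (p + 0 *: v) by rewrite scale0r addr0.
  by apply: is_cderiveX; exact: line.
exists (fun t => Re (d1 e_x t)), (fun t => Re (d1 e_y t)), (Re (d2 e_x)), (Re (d2 e_y)).
have lines v : (\forall t \near (0 : R), is_derive (t : R) 1
      (fun s : R => Re (c * cplx (p + s *: v) ^+ k)) (Re (d1 v t))) /\
    is_derive (0 : R) 1 (fun t => Re (d1 v t)) (Re (d2 v)).
  split; last by have [] := D2 v.
  by near=> t; have [] := D1 v t.
split; try exact: lines.
rewrite -ReD /d2.
have -> : cplx e_x = 1 :> R[i] by [].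
have -> : cplx e_y = 'i%C :> R[i] by [].
have -> (i : R[i]) : c * (k%:R * (k.-1%:R * cplx p ^+ k.-1.-1 * 1) * 1) +
  c * (k%:R * (k.-1%:R * cplx p ^+ k.-1.-1 * i) * i) =
  c * k%:R * k.-1%:R * cplx p ^+ k.-1.-1 * (1 + i ^+ 2) by ring.
by rewrite sqr_i subrr mulr0.
Unshelve. all: by end_near.
Qed.

Lemma hpoly_cons x (s : seq (R[i] * nat)) z : hpoly (x :: s) z = Re (x.1 * z ^+ x.2) + hpoly s z.
Proof. by rewrite /hpoly big_cons. Qed.

Lemma laplacian_at_hpoly (s : seq (R[i] * nat)) p : laplacian_at (fun q => hpoly s (cplx q)) p 0.
Proof.
elim: s => [|x s IH].
  have := laplacian_at_monomial 0 0 p; congr laplacian_at.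
  by apply/funext => q; rewrite /hpoly big_nil mul0r.
rewrite (_ : (fun q => _) = (fun q => Re (x.1 * cplx q ^+ x.2) + hpoly s (cplx q))).
  by rewrite -[0]addr0; apply: laplacian_atD => //; exact: laplacian_at_monomial.
by apply/funext => q; rewrite hpoly_cons.
Qed.

Lemma continuous_monomial c k : continuous (fun p => Re (c * cplx p ^+ k)) /\
  continuous (fun p => Im (c * cplx p ^+ k)).
Proof.
elim: k => [|k [IH1 IH2]].
  split.
  - by under eq_fun do rewrite expr0; move=> p; exact: cvg_cst.
  - by under eq_fun do rewrite expr0; move=> p; exact: cvg_cst.
have c1 : continuous (fun p : R * R => p.1) by move=> p; exact: cvg_fst.
have c2 : continuous (fun p : R * R => p.2) by move=> p; exact: cvg_snd.
split.
- rewrite (_ : (fun p => _) =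
      (fun p : R * R => Re (c * cplx p ^+ k) * p.1 - Im (c * cplx p ^+ k) * p.2)).
    by move=> p; apply: cvgB; apply: cvgM; [exact: IH1|exact: c1|exact: IH2|exact: c2].
  by apply/funext => p; rewrite exprSr mulrA ReM.
- rewrite (_ : (fun p => _) =
      (fun p : R * R => Re (c * cplx p ^+ k) * p.2 + Im (c * cplx p ^+ k) * p.1)).
    by move=> p; apply: cvgD; apply: cvgM; [exact: IH1|exact: c2|exact: IH2|exact: c1].
  by apply/funext => p; rewrite exprSr mulrA ImM.
Qed.

Lemma continuous_hpoly (s : seq (R[i] * nat)) : continuous (fun p => hpoly s (cplx p)).
Proof.
elim: s => [|x s IH].
  rewrite (_ : (fun p => _) = cst 0); first by move=> p; exact: cvg_cst.
  by apply/funext => p; rewrite /hpoly big_nil.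
rewrite (_ : (fun q => _) = (fun q => Re (x.1 * cplx q ^+ x.2) + hpoly s (cplx q))).
  by move=> p; apply: cvgD; [exact: (continuous_monomial _ _).1|exact: IH].
by apply/funext => q; rewrite hpoly_cons.
Qed.

Lemma continuous_sqnorm : continuous (fun p : R * R => p.1 ^+ 2 + p.2 ^+ 2).
Proof.
rewrite (_ : (fun p => _) = (fun p : R * R => p.1 * p.1 + p.2 * p.2)) //.
by move=> p; apply: cvgD; apply: cvgM; try exact: cvg_fst; exact: cvg_snd.
Qed.

Lemma compact_closed_disk (r : R) : compact [set p : R * R | normc (cplx p) <= r].
Proof.
apply: (@subclosed_compact _ _ (`[- r, r]%classic `*` `[- r, r]%classic)).
- have -> : [set p : R * R | normc (cplx p) <= r] =
     (fun p : R * R => normc (cplx p)) @^-1` [set x | x <= r] by [].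
  apply: closed_comp; last exact: closed_le.
  move=> p _; rewrite /continuous_at /=.
  apply: (@continuous_comp _ _ _ (fun p : R * R => p.1 ^+ 2 + p.2 ^+ 2) (@Num.sqrt R)).
    exact: continuous_sqnorm.
  exact: sqrt_continuous.
- by apply: compact_setX; exact: segment_compact.
- move=> p /= h; split; rewrite /= in_itv /= -ler_norml; apply: le_trans h.
    exact: (norm_Re_le (cplx p)).
  exact: (norm_Im_le (cplx p)).
Qed.

(** Adding n |q|^2 with n > 0 makes the Laplacian 4 n > 0, which excludes an interior maximum. The
    choice n (r^2 + 1) = g p - e keeps the perturbed function on the circle below g p, hence below
    its value at p. *)
Lemma maximum_principle g (r e : R) : 0 <= r ->
  (forall p, normc (cplx p) <= r -> {for p, continuous g}) ->
  (forall p, normc (cplx p) < r -> laplacian_at g p 0) ->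
  (forall p, normc (cplx p) = r -> g p <= e) ->
  forall p, normc (cplx p) <= r -> g p <= e.
Proof.
move=> r0 cg lg be p pr; rewrite leNgt; apply/negP => ep.
pose n := (g p - e) / (r ^+ 2 + 1).
have d0 : 0 < r ^+ 2 + 1 by rewrite ltr_wpDl // sqr_ge0.
have n0 : 0 < n by rewrite divr_gt0 // subr_gt0.
have nE : n * (r ^+ 2 + 1) = g p - e by rewrite /n divfK // gt_eqF.
pose sq q : R := q.1 ^+ 2 + q.2 ^+ 2.
pose G q := g q + n * sq q.
have [||c] := @compact_EVT_max _ R G _ _ (@compact_closed_disk r).
- by exists p.
- apply: continuous_in_subspaceT => q; rewrite inE /= => qr.
  apply: cvgD; first exact: cg.
  apply: cvgM; first exact: cvg_cst.
  exact: continuous_sqnorm.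
move=> /set_mem cr cmax; have {}cr : normc (cplx c) <= r := cr.
have {}cmax q : normc (cplx q) <= r -> G q <= G c by move=> qr; exact: cmax (mem_set qr).
have sqE q : sq q = normc (cplx q) ^+ 2 by rewrite sqr_normc_parts.
have := cr; rewrite le_eqVlt => /orP[/eqP ce|clt].
  have := cmax p pr.
  rewrite /G !sqE ce; have := be c ce; have := sqr_ge0 (normc (cplx p)); nra.
have : laplacian_at G c (0 + n * 4).
  by apply: laplacian_atD; [exact: lg|apply: laplacian_atZ; exact: laplacian_at_sq].
move/laplacian_at_max; rewrite add0r => h; suff : n * 4 <= 0 by lra.
apply: h; have := normc_nbhs clt; apply: filterS => q qr.
by apply: cmax; exact: ltW.
Qed.

End HarmonicPolynomials.

(** * Bernstein means and polynomials on a circle *)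

Section CircleApproximation.
Context {R : realType}.
Implicit Types (x y c : R) (n : nat) (phi psi : nat -> R) (p q : R * R) (f g : R * R -> R).

(* The mean of [phi] under the binomial law of parameters [n] and [x], that is,
   the value at [x] of the Bernstein polynomial of [i / n |-> phi i]. *)
Fixpoint binomial_mean n x phi : R :=
  if n is n'.+1 then
    x * binomial_mean n' x (fun i => phi i.+1) + (1 - x) * binomial_mean n' x phi
  else phi 0.

Lemma binomial_mean_dist n x c phi psi : 0 <= x <= 1 ->
  (forall i, (i <= n)%N -> `|c - phi i| <= psi i) ->
  `|c - binomial_mean n x phi| <= binomial_mean n x psi.
Proof.
move=> /andP[x0 x1]; elim: n phi psi => [|n IH] phi psi h /=; first exact: h.
have -> (a b : R) : c - (x * a + (1 - x) * b) = x * (c - a) + (1 - x) * (c - b) by ring.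
apply: le_trans (ler_normD _ _) _; have x1' : 0 <= 1 - x by rewrite subr_ge0.
rewrite !normrM (ger0_norm x0) (ger0_norm x1').
apply: lerD; rewrite ler_wpM2l //; apply: IH => i hi; apply: h => //.
exact: leqW.
Qed.

Lemma binomial_mean_affine n x a c phi :
  binomial_mean n x (fun i => a + c * phi i) = a + c * binomial_mean n x phi.
Proof. by elim: n phi => [|n IH] phi //=; rewrite !IH; ring. Qed.

(** Variance plus squared bias. The centre c is arbitrary because a success moves it to c - 1 in the
    induction. *)
Lemma binomial_mean_sq n x c :
  binomial_mean n x (fun i => (i%:R - c) ^+ 2) = n%:R * x * (1 - x) + (n%:R * x - c) ^+ 2.
Proof.
elim: n c => [|n IH] c /=; first ring.
have -> : (fun i => (i.+1%:R - c) ^+ 2) = (fun i => (i%:R - (c - 1)) ^+ 2).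
  by apply/funext => i; rewrite -natr1; congr (_ ^+ 2); ring.
by rewrite !IH -natr1; ring.
Qed.

Lemma binomial_mean_variance n x : (0 < n)%N ->
  binomial_mean n x (fun i => (x - i%:R / n%:R) ^+ 2) = x * (1 - x) / n%:R.
Proof.
move=> n0; have nn : n%:R != 0 :> R by rewrite pnatr_eq0 -lt0n.
have -> : (fun i => (x - i%:R / n%:R) ^+ 2) =
    (fun i => 0 + (n%:R ^+ 2)^-1 * (i%:R - n%:R * x) ^+ 2).
  by apply/funext => i; field.
by rewrite binomial_mean_affine binomial_mean_sq; field.
Qed.

(** Agreement on the circle alone is what makes this class an algebra; it contains both coordinates,
    hence all real polynomials in x and y. *)
Definition circle_hpoly (r : R) g : Prop :=
  exists s, forall p, normc (cplx p) = r -> g p = hpoly s (cplx p).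

Lemma circle_hpoly_monomial r (a : R[i]) k : circle_hpoly r (fun p => Re (a * cplx p ^+ k)).
Proof. by exists [:: (a, k)] => p _; rewrite hpoly_cons /hpoly big_nil addr0. Qed.

Lemma circle_hpolyD r f g : circle_hpoly r f -> circle_hpoly r g ->
  circle_hpoly r (fun p => f p + g p).
Proof.
move=> [s hs] [t ht]; exists (s ++ t) => p pr.
by rewrite /hpoly big_cat /= hs // ht.
Qed.

Lemma circle_hpoly_eq r f g : (forall p, normc (cplx p) = r -> f p = g p) ->
  circle_hpoly r f -> circle_hpoly r g.
Proof. by move=> e [s hs]; exists s => p pr; rewrite -e // hs. Qed.

Lemma circle_hpoly_cst r c : circle_hpoly r (cst c).
Proof.
apply: circle_hpoly_eq (circle_hpoly_monomial r c%:C 0) => p _.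
by rewrite expr0 mulr1.
Qed.

Lemma circle_hpoly_fst r : circle_hpoly r (fun p => p.1).
Proof.
apply: circle_hpoly_eq (circle_hpoly_monomial r 1 1) => p _.
by rewrite expr1 mul1r.
Qed.

Lemma circle_hpoly_snd r : circle_hpoly r (fun p => p.2).
Proof.
apply: circle_hpoly_eq (circle_hpoly_monomial r (- 'i%C) 1) => p _.
by rewrite expr1 ReM /=; ring.
Qed.

Lemma circle_hpoly_sum r (I : Type) (s : seq I) (F : I -> R * R -> R) :
  (forall i, circle_hpoly r (F i)) -> circle_hpoly r (fun p => \sum_(i <- s) F i p).
Proof.
move=> h; elim: s => [|i s IH].
  by apply: circle_hpoly_eq (circle_hpoly_cst r 0) => p _; rewrite big_nil.
by apply: circle_hpoly_eq (circle_hpolyD (h i) IH) => p _; rewrite big_cons.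
Qed.

(* On the circle of radius [r], [z * z^* = r ^+ 2] cancels the common powers. *)
Lemma circle_hpoly_mono r (a : R[i]) k l :
  circle_hpoly r (fun p => Re (a * mono k l (cplx p))).
Proof.
wlog lk : a k l / (l <= k)%N => [hw|].
  case/orP: (leq_total l k) => lk; first exact: hw.
  apply: circle_hpoly_eq (hw (a^*) _ _ lk) => p _.
  by rewrite -(monoJ k l) -rmorphM ReJ.
apply: circle_hpoly_eq (circle_hpoly_monomial r (a * (r ^+ 2 ^+ l)%:C) (k - l)) => p pr.
congr Re; rewrite /mono -(subnK lk) exprD addnK -mulrA; congr (_ * _).
by rewrite rmorphXn /= -pr -mulcJ exprMn; ring.
Qed.

(** Re u Re v is half the real part of u v + u v', v' being the conjugate of v; the mixed monomials
    of the second product are reduced by [circle_hpoly_mono]. *)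
Lemma circle_hpolyM r f g : circle_hpoly r f -> circle_hpoly r g ->
  circle_hpoly r (fun p => f p * g p).
Proof.
move=> [s hs] [t ht].
have mon (x y : R[i] * nat) : circle_hpoly r (fun p =>
    Re (x.1 * cplx p ^+ x.2) * Re (y.1 * cplx p ^+ y.2)).
  have h1 := circle_hpoly_mono r (x.1 * y.1 / 2) (x.2 + y.2) 0.
  have h2 := circle_hpoly_mono r (x.1 * y.1^* / 2) x.2 y.2.
  apply: circle_hpoly_eq (circle_hpolyD h1 h2) => p _.
  rewrite -ReD /mono expr0 mulr1 exprD.
  have Rep (u v : R[i]) : Re u * Re v = Re ((u * v + u * v^*) / 2).
    have -> : (u * v + u * v^*) / 2 = u * (Re v)%:C.
      by rewrite -mulrDr addcJ mulrA; field.
    by rewrite ReM /=; ring.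
  rewrite Rep rmorphM rmorphXn /=; congr Re; by field.
have h : circle_hpoly r (fun p => \sum_(x <- s) \sum_(y <- t)
    Re (x.1 * cplx p ^+ x.2) * Re (y.1 * cplx p ^+ y.2)).
  apply: circle_hpoly_sum => x; apply: circle_hpoly_sum => y; exact: mon.
apply: circle_hpoly_eq h => p pr.
rewrite hs // ht // /hpoly mulr_suml; apply: eq_bigr => x _.
by rewrite mulr_sumr.
Qed.

Lemma circle_hpoly_binomial_mean r n (X : R * R -> R) (F : nat -> R * R -> R) :
  circle_hpoly r X -> (forall i, circle_hpoly r (F i)) ->
  circle_hpoly r (fun p => binomial_mean n (X p) (fun i => F i p)).
Proof.
move=> hX; elim: n F => [|n IH] F hF /=; first exact: hF.
apply: circle_hpolyD; apply: circle_hpolyM => //; try exact: IH.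
apply: circle_hpolyD; first exact: circle_hpoly_cst.
apply: circle_hpoly_eq (circle_hpolyM (circle_hpoly_cst r (-1)) hX) => p _.
by rewrite mulN1r.
Qed.

(** Heine-Cantor, from the near-covering form of compactness with the radius, tending to 0 from the
    right, as parameter. *)
Lemma compact_uniform (K : set (R * R)) f (e : R) : compact K -> 0 < e ->
  (forall p, K p -> {for p, continuous f}) ->
  exists2 d : R, 0 < d & forall p q, K p -> `|p - q| < d -> `|f p - f q| <= e.
Proof.
move=> cK e0 cf.
have := (compact_near_coveringP K).1 cK _ (0^'+)
  (fun d p => forall q, `|p - q| < d -> `|f p - f q| <= e).
case=> [p Kp|d /= d0 hd].
  have e2 : 0 < e / 2 by rewrite divr_gt0.
  have /cvgrPdist_le/(_ _ e2)/nbhs_ballP[d /= d0 hd] := cf p Kp.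
  exists (ball p (d / 2), [set t | 0 < t < d / 2]) => /=.
    split; first by apply: nbhsx_ballx; rewrite divr_gt0.
    have d2 : 0 < d / 2 by rewrite divr_gt0.
    near=> t; apply/andP; split; near: t; [exact: nbhs_right_gt|exact: nbhs_right_lt].
  move=> [p' t] /= [pp' /andP[t0 td]] q p'q.
  have h1 : `|f p - f p'| <= e / 2.
    apply: hd; apply: le_ball pp'; lra.
  have h2 : `|f p - f q| <= e / 2.
    apply: hd; rewrite -ball_normE /=.
    move: pp'; rewrite -ball_normE /= => pp'.
    have -> : p - q = (p - p') + (p' - q) by rewrite addrA subrK.
    apply: le_lt_trans (ler_normD _ _) _; lra.
  have -> : f p' - f q = (f p - f q) - (f p - f p') by ring.
  by apply: le_trans (ler_normB _ _) _; lra.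
exists (d / 2); first by rewrite divr_gt0.
move=> p q Kp pq; apply: (hd (d / 2)) pq => //=.
- by rewrite sub0r normrN gtr0_norm ?divr_gt0 //; lra.
- by rewrite divr_gt0.
Unshelve. all: by end_near.
Qed.

End CircleApproximation.

Section HarmonicApproximation.
Context {R : realType}.
Implicit Types (r e : R) (p q : R * R) (f g : R * R -> R).

(** Radial retraction onto the closed disk of radius r. Composing with it makes f continuous on the
    whole plane, hence on the square that carries the Bernstein nodes. *)
Definition retract r p : R * R := (r / Num.max r (normc (cplx p))) *: p.

Lemma continuous_normc : continuous (fun p : R * R => normc (cplx p)).
Proof.
move=> p; apply: (@continuous_comp _ _ _ (fun p : R * R => p.1 ^+ 2 + p.2 ^+ 2) (@Num.sqrt R)).
  exact: continuous_sqnorm.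
exact: sqrt_continuous.
Qed.

Lemma continuous_retract r : 0 < r -> continuous (retract r).
Proof.
move=> r0 p; rewrite /retract; apply: cvgZ; last exact: cvg_id.
have m0 : Num.max r (normc (cplx p)) != 0 by rewrite gt_eqF // lt_max r0.
apply: cvgM; first exact: cvg_cst.
apply: cvgV => //.
rewrite maxr_absE; under eq_fun do rewrite maxr_absE.
have cn := @continuous_normc p.
apply: cvgM; last exact: cvg_cst.
apply: cvgD; first by apply: cvgD; [exact: cvg_cst|exact: cn].
by apply: cvg_norm; apply: cvgB; [exact: cvg_cst|exact: cn].
Qed.

Lemma retract_in r p : 0 < r -> normc (cplx (retract r p)) <= r.
Proof.
move=> r0; rewrite cplxZ Normc.normcM normc_real.
have m0 : 0 < Num.max r (normc (cplx p)) by rewrite lt_max r0.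
have h : 0 <= r / Num.max r (normc (cplx p)) by apply: divr_ge0; exact: ltW.
rewrite (ger0_norm h) mulrAC ler_pdivrMr // ler_wpM2l ?(ltW r0) //.
by rewrite le_max lexx orbT.
Qed.

Lemma retract_id r p : 0 < r -> normc (cplx p) = r -> retract r p = p.
Proof. by move=> r0 pr; rewrite /retract pr maxxx divff ?gt_eqF // scale1r. Qed.

(* Bernstein polynomials in two variables suffice: on the circle every real
   polynomial in [x, y] is the real part of a polynomial in [z]. *)
Lemma circle_approx f r e : 0 < r < 1 -> 0 < e ->
  (forall p, normc (cplx p) <= r -> {for p, continuous f}) ->
  exists s, forall p, normc (cplx p) = r -> `|f p - hpoly s (cplx p)| <= e.
Proof.
move=> /andP[r0 r1] e0 cf.
pose F p := f (retract r p).
have cF : continuous F.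
  move=> p; apply: continuous_comp; first exact: continuous_retract.
  exact: cf (retract_in _ r0).
pose K : set (R * R) := `[-1, 1]%classic `*` `[-1, 1]%classic.
have cK : compact K by apply: compact_setX; exact: segment_compact.
have K0 : K !=set0 by exists (0, 0); split; rewrite /= in_itv /= lerN10 ler01.
have [M M0 FM] : exists2 M : R, 0 <= M & forall p, K p -> `|F p| <= M.
  have [|c _ hc] := @compact_EVT_max _ R (fun p => `|F p|) K K0 cK.
    apply: continuous_subspaceT => p; exact: cvg_norm (cF p).
  by exists (`|F c|) => // p Kp; exact: hc (mem_set Kp).
have e2 : 0 < e / 2 by rewrite divr_gt0.
have [d d0 hd] := compact_uniform cK e2 (fun p _ => cF p).
(* Chebyshev's argument: a node at distance at least d differs from p by at least d in one
   coordinate, so d^2 <= 4 (x i + y j) and 2 M <= C (x i + y j). The means of x and y are at most 1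
   / n, which dictates the choice of n. *)
pose C : R := 8 * M / d ^+ 2.
have C0 : 0 <= C by apply: divr_ge0; [exact: mulr_ge0|exact: sqr_ge0].
pose n := (Num.bound (4 * C / e)).+1.
have n0 : 0 < n%:R :> R by rewrite ltr0n.
have hn : 2 * C / n%:R <= e / 2.
  rewrite ler_pdivrMr // mulrAC ler_pdivlMr // mulrC.
  have : 4 * C / e <= n%:R.
    apply: ltW; apply: (lt_trans (archi_boundP _)); last by rewrite ltr_nat.
    by apply: divr_ge0; [exact: mulr_ge0|exact: ltW].
  by rewrite ler_pdivrMr //; lra.
pose X p : R := (p.1 + 1) / 2; pose Y p : R := (p.2 + 1) / 2.
pose node i : R := 2 * (i%:R / n%:R) - 1.
pose B p := binomial_mean n (X p) (fun i => binomial_mean n (Y p) (fun j => F (node i, node j))).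
have hB : circle_hpoly r B.
  have half (g : R * R -> R) : circle_hpoly r g -> circle_hpoly r (fun p => (g p + 1) / 2).
    move=> hg; apply: circle_hpolyM; last exact: circle_hpoly_cst.
    by apply: circle_hpolyD => //; exact: circle_hpoly_cst.
  apply: (@circle_hpoly_binomial_mean _ r n X
     (fun i p => binomial_mean n (Y p) (fun j => F (node i, node j)))).
    exact/half/circle_hpoly_fst.
  move=> i; apply: (@circle_hpoly_binomial_mean _ r n Y (fun j p => F (node i, node j))).
    exact/half/circle_hpoly_snd.
  by move=> j; exact: circle_hpoly_cst.
have [s hs] := hB; exists s => p pr; rewrite -hs //.
have -> : f p = F p by rewrite /F retract_id.
have p1 : `|p.1| <= 1 by apply: le_trans (ltW r1); rewrite -pr; exact: (norm_Re_le (cplx p)).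
have p2 : `|p.2| <= 1 by apply: le_trans (ltW r1); rewrite -pr; exact: (norm_Im_le (cplx p)).
have Kp : K p by split; rewrite /= in_itv /= -ler_norml.
have X01 : 0 <= X p <= 1 by move: p1; rewrite /X ler_norml => /andP[? ?]; apply/andP; split; lra.
have Y01 : 0 <= Y p <= 1 by move: p2; rewrite /Y ler_norml => /andP[? ?]; apply/andP; split; lra.
have node1 i : (i <= n)%N -> -1 <= node i <= 1.
  move=> hi; have h0 : 0 <= (i%:R / n%:R : R) by rewrite divr_ge0 // ltW.
  have h1 : (i%:R / n%:R : R) <= 1 by rewrite ler_pdivrMr // mul1r ler_nat.
  by rewrite /node; apply/andP; split; lra.
pose x i := (X p - i%:R / n%:R) ^+ 2; pose y j := (Y p - j%:R / n%:R) ^+ 2.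
have main i j : (i <= n)%N -> (j <= n)%N ->
    `|F p - F (node i, node j)| <= (e / 2 + C * x i) + C * y j.
  move=> hi hj; have x0 : 0 <= x i by rewrite sqr_ge0.
  have y0 : 0 <= y j by rewrite sqr_ge0.
  have [pd|pd] := ltP `|p - (node i, node j)| d.
    apply: le_trans (hd _ _ Kp pd) _.
    by rewrite -addrA lerDl addr_ge0 // mulr_ge0.
  have hM : `|F p - F (node i, node j)| <= 2 * M.
    apply: le_trans (ler_normB _ _) _; rewrite mulr_natl mulr2n lerD // FM //.
    by split; rewrite /= in_itv /= node1.
  apply: le_trans hM _; apply: (@le_trans _ _ (C * (x i + y j))); last first.
    by rewrite mulrDr -addrA lerDr ltW.
  suff : d ^+ 2 <= 4 * (x i + y j).
    move=> h; rewrite /C mulrAC ler_pdivlMr ?exprn_gt0 //.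
    by rewrite -!mulrA mulrCA [leRHS]mulrCA; nra.
  have ex : (p.1 - node i) ^+ 2 = 4 * x i by rewrite /x /X /node; field; rewrite gt_eqF.
  have ey : (p.2 - node j) ^+ 2 = 4 * y j by rewrite /y /Y /node; field; rewrite gt_eqF.
  rewrite mulrDr -ex -ey; move: pd; rewrite prod_normE /= le_max => /orP[] h.
  - rewrite -[leLHS]addr0 lerD ?sqr_ge0 // -[leRHS]real_normK ?num_real //.
    by rewrite ler_sqr ?nnegrE // ltW.
  - rewrite -[leLHS]add0r lerD ?sqr_ge0 // -[leRHS]real_normK ?num_real //.
    by rewrite ler_sqr ?nnegrE // ltW.
apply: (@le_trans _ _ (binomial_mean n (X p)
    (fun i => (e / 2 + C * (Y p * (1 - Y p) / n%:R)) + C * x i))).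
  apply: binomial_mean_dist => // i hi.
  have -> : (e / 2 + C * (Y p * (1 - Y p) / n%:R)) + C * x i =
     binomial_mean n (Y p) (fun j => (e / 2 + C * x i) + C * y j).
    by rewrite binomial_mean_affine binomial_mean_variance // addrAC.
  by apply: binomial_mean_dist => // j hj; exact: main.
rewrite binomial_mean_affine binomial_mean_variance //.
have var z : 0 <= z <= 1 -> C * (z * (1 - z) / n%:R) <= C / n%:R.
  move=> /andP[z0 z1]; rewrite ler_wpM2l // ler_pdivrMr // mulVf ?gt_eqF //.
  nra.
have := var _ X01; have := var _ Y01; move: hn; rewrite -mulrA; lra.
Qed.

Lemma harmonic_approx f r e : harmonic_on_disk f -> 0 < r < 1 -> 0 < e ->
  exists s, forall p, normc (cplx p) <= r -> `|f p - hpoly s (cplx p)| <= e.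
Proof.
move=> hf r01 e0; have /andP[r0 r1] := r01.
have rd p : normc (cplx p) <= r -> disk p.
  by rewrite disk_normc => /le_lt_trans; apply.
have cf p : normc (cplx p) <= r -> {for p, continuous f}.
  by move=> /rd dp; have [[]] := hf p dp.
have [s hs] := circle_approx r01 e0 cf; exists s => p pr.
rewrite ler_norml; apply/andP; split.
- rewrite lerNl; have -> : - (f p - hpoly s (cplx p)) = (-1) * f p + hpoly s (cplx p) by ring.
  apply: (@maximum_principle _ (fun p => (-1) * f p + hpoly s (cplx p)) r e (ltW r0)) pr.
  + move=> q qr; apply: cvgD; last exact: continuous_hpoly.
    by apply: cvgM; [exact: cvg_cst|exact: cf].
  + move=> q /ltW/rd dq; have -> : (0 : R) = (-1) * 0 + 0 by ring.
    apply: laplacian_atD; last exact: laplacian_at_hpoly.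
    by apply: laplacian_atZ; exact: harmonic_laplacian_at.
  + by move=> q qr; have := hs q qr; rewrite ler_norml => /andP[h _]; lra.
- have -> : f p - hpoly s (cplx p) = f p + (-1) * hpoly s (cplx p) by ring.
  apply: (@maximum_principle _ (fun p => f p + (-1) * hpoly s (cplx p)) r e (ltW r0)) pr.
  + move=> q qr; apply: cvgD; first exact: cf.
    by apply: cvgM; [exact: cvg_cst|exact: continuous_hpoly].
  + move=> q /ltW/rd dq; have -> : (0 : R) = 0 + (-1) * 0 by ring.
    apply: laplacian_atD; first exact: harmonic_laplacian_at.
    by apply: laplacian_atZ; exact: laplacian_at_hpoly.
  + by move=> q qr; have := hs q qr; rewrite ler_norml => /andP[_ h]; lra.
Qed.

End HarmonicApproximation.

(** * Density of polynomials in the harmonic Bergman space *)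

Section Dilation.
Context {R : realType}.
Local Notation mR := (measurableTypeR R).
Local Notation mD := (@disk R : set (mR * mR)).
Local Notation mu := (@area R).

Definition dilation1 (r : R) : mR -> mR := fun x => r * x.

Lemma measurable_dilation1 r : measurable_fun [set: mR] (dilation1 r).
Proof. by apply: measurable_funM; [exact: measurable_cst|exact: measurable_id]. Qed.

Definition dilation2 (r : R) : mR * mR -> mR * mR := fun p => (r * p.1, r * p.2).

Lemma measurable_dilation2 r : measurable_fun [set: mR * mR] (dilation2 r).
Proof.
apply/measurable_fun_pairP; split.
- exact: (measurableT_comp (measurable_dilation1 r) measurable_fst).
- exact: (measurableT_comp (measurable_dilation1 r) measurable_snd).
Qed.

(** The left side is a measure in A, a scaled pushforward, which agrees with Lebesgue measure on
    half-open intervals; uniqueness concludes. *)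
Lemma lebesgue_dilation (r : R) (A : set mR) : 0 < r -> measurable A ->
  (r%:E * lebesgue_measure (dilation1 r @^-1` A) = lebesgue_measure A)%E.
Proof.
move=> r0 mA; have rn : 0 <= r by exact: ltW.
have [m mE] : exists m : {measure set mR -> \bar R},
    forall B, m B = (r%:E * lebesgue_measure (dilation1 r @^-1` B))%E.
  unshelve eexists (mscale (NngNum rn) (pushforward (@lebesgue_measure R) (dilation1 r))).
    exact: measurable_dilation1.
  by [].
rewrite -mE; apply/esym; apply: lebesgue_measure_unique => //= _ [[a b]] _ <-.
rewrite mE.
have -> : dilation1 r @^-1` `]a, b]%classic = `](a / r), (b / r)]%classic.
  by apply/seteqP; split => x /=; rewrite !in_itv /= ltr_pdivrMr // ler_pdivlMr // mulrC.
rewrite !lebesgue_measure_itv /= !lte_fin ltr_pM2r ?invr_gt0 //.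
case: ifP => _; last by rewrite mule0.
by rewrite -!EFinB -EFinM mulrBr ![r * _]mulrC !divfK // gt_eqF.
Qed.

Lemma area_dilation (r : R) (A : set (mR * mR)) : 0 < r -> measurable A ->
  ((r ^+ 2)%:E * mu (dilation2 r @^-1` A) = mu A)%E.
Proof.
move=> r0 mA; have rn : 0 <= r ^+ 2 by exact: sqr_ge0.
have [m mE] : exists m : {measure set (mR * mR) -> \bar R},
    forall B, m B = ((r ^+ 2)%:E * mu (dilation2 r @^-1` B))%E.
  unshelve eexists (mscale (NngNum rn) (pushforward mu (dilation2 r))).
    exact: measurable_dilation2.
  by [].
rewrite -mE /area; apply/esym; apply: product_measure_unique => // A1 A2 m1 m2.
rewrite mE.
have -> : dilation2 r @^-1` (A1 `*` A2) = (dilation1 r @^-1` A1) `*` (dilation1 r @^-1` A2) by [].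
have p1 : measurable (dilation1 r @^-1` A1).
  by rewrite -[X in measurable X]setTI; exact: (measurable_dilation1 r measurableT m1).
have p2 : measurable (dilation1 r @^-1` A2).
  by rewrite -[X in measurable X]setTI; exact: (measurable_dilation1 r measurableT m2).
rewrite -[X in (_ * X)%E]/((@lebesgue_measure R \x @lebesgue_measure R)%E _).
rewrite product_measure1E // -[in RHS]/(lebesgue_measure A1) -[in RHS]/(lebesgue_measure A2).
transitivity ((r%:E * lebesgue_measure (dilation1 r @^-1` A1)) *
    (r%:E * lebesgue_measure (dilation1 r @^-1` A2)))%E.
  by rewrite expr2 EFinM muleACA.
by congr (_ * _)%E; exact: lebesgue_dilation.
Qed.

Lemma integral_dilation (r : R) (D : set (mR * mR)) (f : mR * mR -> \bar R) : 0 < r ->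
  measurable D -> measurable_fun D f -> (forall p, D p -> 0 <= f p)%E ->
  ((r ^+ 2)%:E * \int[mu]_(p in dilation2 r @^-1` D) f (dilation2 r p) = \int[mu]_(p in D) f p)%E.
Proof.
move=> r0 mE mf f0; have rn : 0 <= r ^+ 2 by exact: sqr_ge0.
rewrite -(@ge0_integral_pushforward _ _ _ _ _ _ (measurable_dilation2 r) mu D f) //; last first.
  by move=> p; rewrite inE; exact: f0.
rewrite -(@ge0_integral_mscale _ _ _ _ D mE (NngNum rn)) //; first exact: measurable_dilation2.
by move=> md; apply: eq_measure_integral => A mA _; exact: area_dilation.
Qed.

(** The dilation sends D into D, so the integral over D is at most the one over the preimage of D,
    which the change of variables evaluates. *)
Lemma L2D_dilation (r : R) (f : R[i] -> R[i]) : 0 < r <= 1 -> L2D f ->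
  L2D (fun z => f (r%:C * z)) /\ nsq (fun z => f (r%:C * z)) <= r ^- 2 * nsq f.
Proof.
move=> /andP[r0 r1] Lf.
have cd p : cplx (dilation2 r p) = r%:C * cplx p.
  by rewrite -cplxZ.
have sub : mD `<=` dilation2 r @^-1` mD.
  move=> p; rewrite /preimage /= !disk_normc cd Normc.normcM normc_real gtr0_norm //.
  by apply: le_lt_trans; rewrite ler_piMl // normc_ge0.
have [[mf1 mf2] _] := (L2DP f).1 Lf.
have md := @measurable_disk R.
have mpre : measurable (dilation2 r @^-1` mD).
  by rewrite -[X in measurable X]setTI; exact: (measurable_dilation2 r measurableT md).
have m : measurable_diskC (fun z => f (r%:C * z)).
  have comp (g : mR * mR -> R) : measurable_fun mD g -> measurable_fun mD (g \o dilation2 r).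
    move=> mg; apply: (measurable_comp (F := mD)) => //.
    - by move=> _ [p dp <-]; exact: sub.
    - exact: measurable_funS (measurable_dilation2 r).
  split.
  - rewrite (_ : rePart _ = rePart f \o dilation2 r); first exact: comp.
    by apply/funext => p; rewrite /rePart /= cd.
  - rewrite (_ : imPart _ = imPart f \o dilation2 r); first exact: comp.
    by apply/funext => p; rewrite /imPart /= cd.
have msq g : measurable_diskC g -> measurable_fun mD (fun p => (sqPart g p)%:E).
  by move=> mg; apply/measurable_EFinP; exact: measurable_sqPart.
have le : (\int[mu]_(p in mD) (sqPart (fun z => f (r%:C * z)) p)%:E <=
    (r ^- 2)%:E * (pi * nsq f)%:E)%E.
  rewrite -(nsq_integral Lf) -(@integral_dilation r mD (fun p => (sqPart f p)%:E)) //; last 2 first.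
  - exact: msq.
  - by move=> p _; rewrite lee_fin sqPart_ge0.
  rewrite muleA -EFinM mulVf ?gt_eqF ?exprn_gt0 // mul1e.
  have -> : (\int[mu]_(p in mD) (sqPart (fun z => f (r%:C * z)) p)%:E =
      \int[mu]_(p in mD) (sqPart f (dilation2 r p))%:E)%E.
    by apply: eq_integral => p _; rewrite !sqPartE cd.
  apply: ge0_subset_integral => //.
  - apply: (measurable_comp (F := mD) (f := fun p => (sqPart f p)%:E)) => //.
    + by move=> _ [p dp <-].
    + exact: msq.
    + exact: measurable_funS (measurable_dilation2 r).
  - by move=> p _; rewrite lee_fin sqPart_ge0.
have L : L2D (fun z => f (r%:C * z)).
  have [m1 m2] := m; split => //.
  by apply: le_lt_trans le _; rewrite -EFinM ltry.
split; first exact: L.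
move: le; rewrite (nsq_integral L) -EFinM lee_fin [leRHS]mulrCA.
by rewrite ler_pM2l // pi_gt0.
Qed.

End Dilation.

(** * Fatou's lemma, dilates and density *)

Section Density.
Context {R : realType}.
Local Notation mR := (measurableTypeR R).
Local Notation mD := (@disk R : set (mR * mR)).
Local Notation mu := (@area R).
Implicit Types (f g h w : R[i] -> R[i]).

Lemma limn_einf_le (u : nat -> \bar R) (M : \bar R) :
  (forall n, (u n <= M)%E) -> (limn_einf u <= M)%E.
Proof.
move=> h; rewrite limn_einf_lim; apply: lime_le; first exact: is_cvg_einfs.
apply: nearW => n; apply: le_trans (h n); apply: ereal_inf_lbound.
by exists n => /=.
Qed.

(** The substitute for completeness: it puts pointwise limits in L^2 and passes norm bounds to
    them. *)
Lemma nsq_fatou (g : nat -> R[i] -> R[i]) h (M : R) :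
  (forall n, L2D (g n)) -> measurable_diskC h -> (forall n, nsq (g n) <= M) ->
  (forall p, disk p -> (rePart (g n) p @[n --> \oo] --> rePart h p) /\
                       (imPart (g n) p @[n --> \oo] --> imPart h p)) ->
  L2D h /\ nsq h <= M.
Proof.
move=> Lg mh bg cg; have md := @measurable_disk R.
have mg n : measurable_diskC (g n) by have [] := (L2DP _).1 (Lg n).
have msq k : measurable_diskC k -> measurable_fun mD (fun p => (sqPart k p)%:E).
  by move=> mk; apply/measurable_EFinP; exact: measurable_sqPart.
have le : (\int[mu]_(p in mD) (sqPart h p)%:E <= (pi * M)%:E)%E.
  have := @fatou _ _ _ mu mD md (fun n p => (sqPart (g n) p)%:E) (fun n => msq _ (mg n)) _.
  have -> : (\int[mu]_(p in mD) (limn_einf (fun n => (sqPart (g n) p)%:E)) =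
      \int[mu]_(p in mD) (sqPart h p)%:E)%E.
    apply: eq_integral => p; rewrite inE => dp.
    have [c1 c2] := cg p dp.
    have : ((sqPart (g n) p)%:E @[n --> \oo] --> (sqPart h p)%:E)%E.
      apply: cvg_EFin; first by apply: nearW.
      rewrite /sqPart; under eq_fun do rewrite !expr2; rewrite !expr2.
      by apply: cvgD; apply: cvgM.
    by move/cvg_limn_einf_sup => [-> _].
  move=> hf; apply: le_trans (hf _) _; first by move=> n p _; rewrite lee_fin sqPart_ge0.
  apply: limn_einf_le => n; rewrite nsq_integral // lee_fin ler_pM2l //; exact: pi_gt0.
have Lh : L2D h by have [m1 m2] := mh; split => //; apply: le_lt_trans le _; exact: ltry.
split; first exact: Lh.
by move: le; rewrite (nsq_integral Lh) lee_fin ler_pM2l // pi_gt0.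
Qed.

(** Re (A z^k) is half the sum of A z^k and its conjugate, so real parts of polynomials lie in the
    span of the monomials. *)
Lemma orth_hpoly w (r : R) (s : seq (R[i] * nat)) : L2D w ->
  (forall k, dotD w (mono k 0) = 0) -> (forall k, dotD w (mono 0 k) = 0) ->
  L2D (fun z => (hpoly s (r%:C * z))%:C) /\
  dotD w (fun z => (hpoly s (r%:C * z))%:C) = 0.
Proof.
move=> Lw o1 o2; elim: s => [|[a k] s [IH1 IH2]].
  have e (z : R[i]) : (hpoly [::] (r%:C * z))%:C = 0 by rewrite /hpoly big_nil.
  split; last by apply: dotD0r => // p _; exact: e.
  by apply: (@eqD_L2D _ (cst 0)) (L2D_cst 0) => p _; rewrite e.
pose A := a * r%:C ^+ k.
have e z : (hpoly ((a, k) :: s) (r%:C * z))%:C =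
    ((A / 2) * mono k 0 z + (A^* / 2) * mono 0 k z) + (hpoly s (r%:C * z))%:C.
  rewrite hpoly_cons rmorphD /=; congr (_ + _).
  rewrite exprMn mulrA -/A /mono !expr0 mulr1 mul1r.
  rewrite ReJ_add rmorphM rmorphXn /=; by field.
have L1 : L2D (fun z => (A / 2) * mono k 0 z) by apply/L2DZ/L2D_mono.
have L2 : L2D (fun z => (A^* / 2) * mono 0 k z) by apply/L2DZ/L2D_mono.
have L12 := L2DD L1 L2; have L := L2DD L12 IH1.
split; first by apply: eqD_L2D L => p _; rewrite e.
transitivity (dotD w (fun z => ((A / 2) * mono k 0 z + (A^* / 2) * mono 0 k z) +
   (hpoly s (r%:C * z))%:C)).
  by apply: eq_dotD => // p _; exact: e.
rewrite (dotDDr Lw L12 IH1) IH2 addr0 (dotDDr Lw L1 L2).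
by rewrite (dotDZr _ Lw (L2D_mono k 0)) (dotDZr _ Lw (L2D_mono 0 k)) o1 o2 !mulr0 addr0.
Qed.

(** The orthogonal complement of w is closed: <w,f> = <w,f - g>, which Cauchy-Schwarz makes
    small. *)
Lemma nsq_le_dot0 w f : L2D w -> L2D f ->
  (forall e : R, 0 < e -> exists2 g, L2D g & dotD w g = 0 /\ nsq (fun z => f z - g z) <= e) ->
  dotD w f = 0.
Proof.
move=> Lw Lf h; apply: Normc.eq0_normc; apply/eqP; rewrite -sqrf_eq0 eq_le sqr_ge0 andbT.
apply/ler_addgt0Pr => e e0; rewrite add0r.
have w0 : 0 < nsq w + 1 by rewrite ltr_wpDl // nsq_ge0.
have [g Lg [wg ge]] := h _ (divr_gt0 e0 w0).
have -> : dotD w f = dotD w (fun z => f z - g z) by rewrite dotDBr // wg subr0.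
apply: le_trans (dotD_CauchySchwarz Lw (L2DB Lf Lg)) _.
apply: (@le_trans _ _ ((nsq w + 1) * (e / (nsq w + 1)))); last by rewrite mulrC divfK // gt_eqF.
by apply: ler_pM; rewrite ?nsq_ge0 // lerDl.
Qed.

(** Approximating f uniformly on |z| <= r approximates f (r z) uniformly on all of D. The real and
    imaginary parts each cost d, hence the bound 2 d. *)
Lemma orth_dilation w f (r : R) : L2D w -> L2h f -> 0 < r < 1 ->
  (forall k, dotD w (mono k 0) = 0) -> (forall k, dotD w (mono 0 k) = 0) ->
  dotD w (fun z => f (r%:C * z)) = 0.
Proof.
move=> Lw [Lf hf1 hf2] r01 o1 o2; have /andP[r0 r1] := r01.
have r01' : 0 < r <= 1 by rewrite r0 ltW.
have [Lr _] := L2D_dilation r01' Lf.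
apply: nsq_le_dot0 => // e e0.
have [d d0 de] : exists2 d : R, 0 < d & (2 * d) ^+ 2 * nsq (fun=> 1 : R[i]) <= e.
  move: (nsq _) (@nsq1_gt0 R) => N N0.
  have N4 : 0 < 4 * N by rewrite mulr_gt0.
  exists (Num.min 1 (e / (4 * N))); first by rewrite lt_min ltr01 divr_gt0.
  set d := Num.min _ _.
  have d0 : 0 <= d by rewrite le_min ler01 divr_ge0 // ltW.
  have d1 : d <= 1 by rewrite ge_min lexx.
  have : d <= e / (4 * N) by rewrite ge_min lexx orbT.
  rewrite ler_pdivlMr // => h; apply: le_trans h.
  have dd : d ^+ 2 <= d by rewrite expr2 ler_piMl.
  by rewrite exprMn; nra.
have [s1 h1] := harmonic_approx hf1 r01 d0.
have [s2 h2] := harmonic_approx hf2 r01 d0.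
have [L1 p1] := orth_hpoly r s1 Lw o1 o2; have [L2 p2] := orth_hpoly r s2 Lw o1 o2.
have LI2 := L2DZ 'i%C L2.
exists (fun z => (hpoly s1 (r%:C * z))%:C + 'i%C * (hpoly s2 (r%:C * z))%:C).
  exact: L2DD.
split; first by rewrite dotDDr // dotDZr // p1 p2 mulr0 addr0.
apply: le_trans (nsq_sup (M := 2 * d) _ _) _ => //; last first.
  by apply: L2DB => //; exact: L2DD.
move=> p dp; have -> : r%:C * cplx p = cplx (r *: p) by rewrite cplxZ.
have pr : normc (cplx (r *: p)) <= r.
  rewrite cplxZ Normc.normcM normc_real gtr0_norm // ler_piMr ?(ltW r0) //.
  by move: dp; rewrite disk_normc => /ltW.
have := h1 _ pr; have := h2 _ pr; rewrite /rePart /imPart.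
set F := f _; set a := hpoly s1 _; set b := hpoly s2 _ => ib ra.
have -> : F - (a%:C + 'i%C * b%:C) = (Re F - a)%:C + 'i%C * (Im F - b)%:C.
  by apply: complex_ext; rewrite !(ReD, ImD, ReN, ImN, ReM, ImM) /=; ring.
apply: le_trans (le_normcD _ _) _; rewrite Normc.normcM !normc_real.
have -> : normc ('i%C : R[i]) = 1 by rewrite /= expr0n /= add0r expr1n sqrtr1.
by rewrite mul1r mulr_natl mulr2n lerD.
Qed.

(* If all dilates [f (r z)] stayed at squared distance more than [d], then by the
   parallelogram law [f + f (r z)] would have squared norm at most
   [4 |f|^2 - d / 2] as [r] tends to 1, against Fatou's lemma. *)
Lemma dilation_cvg f (d : R) : L2h f -> 0 < d ->
  exists r : R, [/\ 0 < r < 1, L2D (fun z => f (r%:C * z)) &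
    nsq (fun z => f z - f (r%:C * z)) <= d].
Proof.
move=> [Lf hf1 hf2] d0; apply: contrapT => no.
pose N := nsq f; have N0 : 0 <= N := nsq_ge0 f.
(* From r >= 1 - t and t <= 1/4 follows r^-2 <= 1 + 4 t; the second bound gives 8 t N <= d / 2, so
   the parallelogram law yields at most 2 N + 2 (1 + 4 t) N - d <= 4 N - d / 2. *)
pose t := Num.min 4^-1 (d / (16 * (N + 1))).
have N1 : 0 < 16 * (N + 1) by rewrite mulr_gt0 // ltr_wpDl.
have t0 : 0 < t by rewrite lt_min invr_gt0 ltr0n divr_gt0.
have t1 : t <= 4^-1 by rewrite ge_min lexx.
have td : t * (16 * (N + 1)) <= d by rewrite -ler_pdivlMr // ge_min lexx orbT.
pose r n : R := 1 - t / n.+1%:R.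
have rn n : 1 - t <= r n < 1.
  rewrite /r lerD2l lerN2 ler_pdivrMr ?ltr0n // ler_peMr ?(ltW t0) ?ler1n //=.
  by rewrite gtrBl divr_gt0 // ltr0n.
have r01 n : 0 < r n < 1.
  by have /andP[h ->] := rn n; rewrite andbT (lt_le_trans _ h) //; lra.
have r01' n : 0 < r n <= 1 by have /andP[-> /ltW] := r01 n.
have Lr n := (L2D_dilation (r01' n) Lf).1.
have Br n := (L2D_dilation (r01' n) Lf).2.
have Bd n : d < nsq (fun z => f z - f ((r n)%:C * z)).
  by rewrite ltNge; apply/negP => h; apply: no; exists (r n).
have sum n : nsq (fun z => f z + f ((r n)%:C * z)) <= 4 * N - d / 2.
  have := Bd n; rewrite nsqB // nsqD // -/N => hd.
  have := Br n; rewrite -/N => hr.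
  have hi : (r n) ^- 2 <= 1 + 4 * t.
    have /andP[rt rl] := rn n.
    rewrite -[leLHS]mul1r ler_pdivrMr ?exprn_gt0 //; last by have /andP[] := r01 n.
    have h2 : 1 - 2 * t <= r n ^+ 2 by nra.
    by nra.
  have hN : (r n) ^- 2 * N <= (1 + 4 * t) * N by rewrite ler_wpM2r.
  have tN : 16 * t * N <= d by nra.
  by lra.
have cvr : r n @[n --> \oo] --> (1 : R).
  rewrite /r -[X in _ --> X]subr0; apply: cvgB; first exact: cvg_cst.
  rewrite -[X in _ --> X](mulr0 t); apply: cvgM; first exact: cvg_cst.
  exact: cvg_harmonic.
have m2 : measurable_diskC (fun z => f z + f z).
  by apply: measurable_diskCD; have [] := (L2DP f).1 Lf.
have cvp (p : R * R) : ((r n) *: p) @[n --> \oo] --> p.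
  by rewrite -[X in _ --> X](scale1r p); exact: (cvgZr_tmp cvr).
have [||L4 B4] := @nsq_fatou (fun n z => f z + f ((r n)%:C * z)) (fun z => f z + f z)
  (4 * N - d / 2) _ m2 sum.
- by move=> n; exact: L2DD.
- move=> p dp; split.
  + rewrite (_ : rePart _ p = rePart f p + rePart f p); last by rewrite /rePart ReD.
    rewrite (_ : (fun n => _) = (fun n => rePart f p + rePart f ((r n) *: p))); last first.
      by apply/funext => n; rewrite /rePart ReD cplxZ.
    apply: cvgD; first exact: cvg_cst.
    have [[c _] _] := hf1 p dp.
    exact: (cvg_comp _ _ (cvp p) c).
  + rewrite (_ : imPart _ p = imPart f p + imPart f p); last by rewrite /imPart ImD.
    rewrite (_ : (fun n => _) = (fun n => imPart f p + imPart f ((r n) *: p))); last first.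
      by apply/funext => n; rewrite /imPart ImD cplxZ.
    apply: cvgD; first exact: cvg_cst.
    have [[c _] _] := hf2 p dp.
    exact: (cvg_comp _ _ (cvp p) c).
have : nsq (fun z => f z + f z) = 4 * N.
  by rewrite nsqD // -/(nsq f) -/N; ring.
by move=> e; move: B4; rewrite e; lra.
Qed.

Theorem L2h_dense w f : L2D w -> L2h f ->
  (forall k, dotD w (mono k 0) = 0) -> (forall k, dotD w (mono 0 k) = 0) ->
  dotD w f = 0.
Proof.
move=> Lw hf o1 o2; have [Lf _ _] := hf.
apply: nsq_le_dot0 => // e e0; have [r [r01 Lr le]] := dilation_cvg hf e0.
by exists (fun z => f (r%:C * z)) => //; split => //; exact: orth_dilation.
Qed.

End Density.

(** * Existence of the orthogonal projection *)

Section OrthogonalExpansion.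
Context {R : realType}.
Variables (E : nat -> R[i] -> R[i]) (g : R[i] -> R[i]).
Hypotheses (LE : forall j, L2D (E j)) (Lg : L2D g).
Hypothesis orthE : forall i j, i != j -> dotD (E i) (E j) = 0.
Hypothesis posE : forall j, 0 < nsq (E j).

Definition fourier_coef j : R[i] := dotD g (E j) / (nsq (E j))%:C.
Definition fourier_sum n z : R[i] := \sum_(j < n) fourier_coef j * E j z.
Definition fourier_energy n : R := \sum_(j < n) normc (fourier_coef j) ^+ 2 * nsq (E j).

Lemma L2D_fourier_sum n : L2D (fourier_sum n).
Proof. by apply: L2D_sum => j; exact: L2DZ. Qed.

Lemma fourier_sumS n z : fourier_sum n.+1 z = fourier_sum n z + fourier_coef n * E n z.
Proof. by rewrite /fourier_sum big_ord_recr. Qed.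

Lemma dot_fourier_sum n j : dotD (fourier_sum n) (E j) =
  if (j < n)%N then dotD g (E j) else 0.
Proof.
elim: n => [|n IH].
  rewrite (eq_dotD (f' := fun z => 0 * E j z) (g' := E j)) ?dotDZl ?mul0r //.
  by move=> p _; rewrite /fourier_sum big_ord0 mul0r.
have LS := L2D_fourier_sum n.
rewrite (eq_dotD (f' := fun z => fourier_sum n z + fourier_coef n * E n z) (g' := E j)) //;
  last first.
  by move=> p _; exact: fourier_sumS.
rewrite dotDDl //; last exact: L2DZ.
rewrite IH dotDZl // ltnS; have [jn|jn|->] := ltngtP j n.
- by rewrite orthE ?mulr0 ?addr0 // eq_sym ltn_eqF.
- by rewrite orthE ?mulr0 ?addr0 // ltn_eqF.
rewrite add0r dotDff /fourier_coef divfK //.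
by rewrite (fmorph_eq0 (real_complex R)) gt_eqF.
Qed.

Lemma nsq_fourier_tail m n :
  nsq (fun z => fourier_sum (n + m) z - fourier_sum n z) =
  fourier_energy (n + m) - fourier_energy n.
Proof.
elim: m => [|m IH].
  rewrite addn0 subrr (nsq_eqD (g := fun z => 0 * E 0%N z)).
    by rewrite nsqZ // Normc.normc0 expr0n /= mul0r.
  by move=> p _; rewrite subrr mul0r.
rewrite addnS; set D := fun z => fourier_sum (n + m) z - fourier_sum n z.
have LD : L2D D by apply: L2DB; exact: L2D_fourier_sum.
rewrite (nsq_eqD (g := fun z => D z + fourier_coef (n + m) * E (n + m) z)); last first.
  by move=> p _; rewrite fourier_sumS /D addrAC.
rewrite nsqD //; last exact: L2DZ.
rewrite dotDZr // dotDBl //; try exact: L2D_fourier_sum.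
rewrite !dot_fourier_sum ltnn ltnNge leq_addr /= subrr mulr0 IH nsqZ //.
by rewrite {3}/fourier_energy big_ord_recr /= -/(fourier_energy (n + m)); ring.
Qed.

Lemma nsq_fourier_sum n : nsq (fourier_sum n) = fourier_energy n.
Proof.
have := nsq_fourier_tail n 0; rewrite add0n {2}/fourier_energy big_ord0 subr0 => <-.
by apply: nsq_eqD => p _; rewrite {3}/fourier_sum big_ord0 subr0.
Qed.

Lemma dot_fourier_sumr n : dotD g (fourier_sum n) = (fourier_energy n)%:C.
Proof.
have LS := L2D_fourier_sum n.
suff h : dotD (fun z => g z - fourier_sum n z) (fourier_sum n) = 0.
  move: h; rewrite dotDBl // => /eqP; rewrite subr_eq0 => /eqP ->.
  by rewrite dotDff nsq_fourier_sum.
have LD : L2D (fun z => g z - fourier_sum n z) by exact: L2DB.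
rewrite dotDC // dotD_suml //; last by move=> j; exact: L2DZ.
rewrite big1 ?rmorph0 // => j _; rewrite dotDZl // dotDC // dotDBl // dot_fourier_sum ltn_ord.
by rewrite subrr rmorph0 mulr0.
Qed.

Lemma bessel n : fourier_energy n <= nsq g.
Proof.
have LS := L2D_fourier_sum n.
have := nsq_ge0 (fun z => g z - fourier_sum n z).
by rewrite nsqB // nsq_fourier_sum dot_fourier_sumr /=; lra.
Qed.

Lemma fourier_energy_homo : {homo fourier_energy : m n / (m <= n)%N >-> m <= n}.
Proof.
apply: homo_leq; [by []|exact: le_trans|move=> n].
by rewrite /fourier_energy big_ord_recr /= lerDl mulr_ge0 ?sqr_ge0 // ltW.
Qed.

Lemma fourier_energy_tail (e : R) : 0 < e ->
  exists n, forall m, fourier_energy (n + m) - fourier_energy n <= e.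
Proof.
move=> e0; have ub : has_ubound (range fourier_energy).
  by exists (nsq g) => _ [n _ <-]; exact: bessel.
have cv := nondecreasing_is_cvgn fourier_energy_homo ub.
have /cvgrPdist_le/(_ _ e0)[n _ hn] := cv.
exists n => m; have := hn n (leqnn n) => /=.
have := nondecreasing_cvgn_le fourier_energy_homo cv (n + m).
move=> h1 /(le_trans (ler_norm _)) h2; lra.
Qed.

End OrthogonalExpansion.

Section HarmonicProjection.
Context {R : realType}.
Local Notation mR := (measurableTypeR R).
Local Notation mD := (@disk R : set (mR * mR)).

(** Powers of z at even indices and of its conjugate, starting from exponent 1, at odd ones: the
    constant occurs once. *)
Definition hbasis (j : nat) : R[i] -> R[i] :=
  if odd j then mono 0 j./2.+1 else mono j./2 0.

Lemma L2D_hbasis j : L2D (hbasis j).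
Proof. by rewrite /hbasis; case: ifP => _; exact: L2D_mono. Qed.

Lemma hbasis_orth i j : i != j -> dotD (hbasis i) (hbasis j) = 0.
Proof.
move=> ij; rewrite /hbasis; case: ifP => oi; case: ifP => oj;
  rewrite dot_mono ?addn0 ?add0n; apply: moment_neq.
- apply: contra ij => /eqP[e]; apply/eqP.
  by move: (odd_double_half i) (odd_double_half j); rewrite oi oj e => h1 h2;
    exact: etrans (esym h1) h2.
- by rewrite addSn.
- by rewrite addnS eq_sym.
- apply: contra ij => /eqP e; apply/eqP.
  by move: (odd_double_half i) (odd_double_half j); rewrite oi oj e => h1 h2;
    exact: etrans (esym h1) h2.
Qed.

Lemma nsq_mono i j : nsq (mono i j) = (@area0 R) / (i + j).+1%:R.
Proof. by rewrite /nsq dot_mono (addnC j) moment_diag. Qed.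

Lemma area0_gt0 : 0 < @area0 R.
Proof. exact: nsq1_gt0. Qed.

Lemma nsq_mono_gt0 i j : 0 < nsq (@mono R i j).
Proof. by rewrite nsq_mono divr_gt0 // area0_gt0. Qed.

Lemma nsq_hbasis_gt0 j : 0 < nsq (hbasis j).
Proof. by rewrite /hbasis; case: ifP => _; exact: nsq_mono_gt0. Qed.

Lemma hbasis_even k : hbasis k.*2 = mono k 0.
Proof. by rewrite /hbasis odd_double doubleK. Qed.

Lemma hbasis_odd k : hbasis k.*2.+1 = mono 0 k.+1.
Proof. by rewrite /hbasis /= odd_double /= uphalf_double. Qed.

Variable g : R[i] -> R[i].
Hypothesis Lg : L2D g.

Local Notation c := (fourier_coef hbasis g).
Local Notation S := (fourier_sum hbasis g).

Definition coefA k : R[i] := c k.*2.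
(** Conjugated because conjugating a number keeps its real part and turns powers of the conjugate
    variable into powers of z. The value 0 at index 0 leaves the constant term to [coefA]. *)
Definition coefB k : R[i] := if k is j.+1 then (c j.*2.+1)^* else 0.

Lemma fourier_sum_double n z : S n.*2 z =
  \sum_(0 <= k < n) coefA k * z ^+ k + \sum_(0 <= k < n) c k.*2.+1 * z^* ^+ k.+1.
Proof.
elim: n => [|n IH]; first by rewrite /fourier_sum big_ord0 !big_nil addr0.
rewrite doubleS !fourier_sumS IH hbasis_even hbasis_odd !big_nat_recr //.
by rewrite /mono !expr0 mulr1 mul1r -addrA; exact: addrACA.
Qed.

Lemma Re_mulJ (u z : R[i]) m : Re (u * z^* ^+ m) = Re (u^* * z ^+ m).
Proof. by rewrite -[in RHS]ReJ rmorphM rmorphXn /= conjcK. Qed.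

(** Cauchy-Schwarz and the norm of the monomial give growth like the square root of i + j + 1; the
    cruder linear bound suffices for [subexponential]. *)
Lemma coef_bound (k : nat) i j : c k = dotD g (mono i j) / (nsq (@mono R i j))%:C ->
  normc (c k) <= Num.sqrt (nsq g / @area0 R) * (i + j).+1%:R.
Proof.
move=> ->; have A0 := area0_gt0; have n0 := nsq_mono_gt0 i j.
rewrite Normc.normcM -fmorphV normc_real ger0_norm ?invr_ge0 ?(ltW n0) // ler_pdivrMr //.
rewrite -ler_sqr ?nnegrE ?normc_ge0 //; last first.
  by apply: mulr_ge0; [apply: mulr_ge0 => //; exact: sqrtr_ge0|exact: ltW].
apply: le_trans (dotD_CauchySchwarz Lg (L2D_mono i j)) _.
have q0 : 0 <= nsq g / area0 by apply: divr_ge0; [exact: nsq_ge0|exact: ltW].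
rewrite nsq_mono; move: (nsq g) (nsq_ge0 g) q0 => N N0 q0; set m : R := (i + j).+1%:R.
have m1 : 1 <= m by rewrite ler1n.
have m0 : 0 < m by exact: lt_le_trans m1.
move: area0 A0 q0 => A A0 q0; rewrite exprMn exprMn sqr_sqrtr //.
rewrite (_ : _ * (A / m) ^+ 2 = N * (A / m) * m); last by field; rewrite !gt_eqF.
by rewrite ler_peMr // mulr_ge0 // divr_ge0 // ltW.
Qed.

Lemma subexponentialA : subexponential coefA.
Proof.
apply: (@subexponential_linear _ _ (Num.sqrt (nsq g / area0))) => k.
have := @coef_bound k.*2 k 0; rewrite addn0; apply.
by rewrite /fourier_coef hbasis_even.
Qed.

Lemma subexponentialB : subexponential coefB.
Proof.
apply: (@subexponential_linear _ _ (Num.sqrt (nsq g / area0))) => -[|k].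
  rewrite [coefB 0]/(0 : R[i]) Normc.normc0; apply: mulr_ge0 => //; exact: sqrtr_ge0.
have -> : normc (coefB k.+1) = normc (c k.*2.+1) by exact: normcJ_real.
apply: le_trans (@coef_bound k.*2.+1 0 k.+1 _) _ => //.
by rewrite /fourier_coef hbasis_odd.
Qed.

Definition coefRe k : R[i] := coefA k + coefB k.
(** Im u = Re (- i u); conjugating the antiholomorphic terms changes - i into i. *)
Definition coefIm k : R[i] := - 'i%C * coefA k + 'i%C * coefB k.

(* The antiholomorphic part enters [harm_series] through its conjugate, so that
   real and imaginary parts are each the real part of a power series. *)
Definition harmonic_proj (z : R[i]) : R[i] :=
  harm_series coefRe (Re z, Im z) +i* harm_series coefIm (Re z, Im z).

Lemma rePart_proj : rePart harmonic_proj = harm_series coefRe.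
Proof. by apply/funext => -[x y]. Qed.

Lemma imPart_proj : imPart harmonic_proj = harm_series coefIm.
Proof. by apply/funext => -[x y]. Qed.

Lemma subexponentialRe : subexponential coefRe.
Proof. exact: subexponentialD subexponentialA subexponentialB. Qed.

Lemma subexponentialIm : subexponential coefIm.
Proof.
by apply: subexponentialD; apply: subexponentialZ;
  [exact: subexponentialA|exact: subexponentialB].
Qed.

(** Along even indices the holomorphic and antiholomorphic parts have equally many terms and
    converge separately. *)
Lemma fourier_cvg p : disk p ->
  (rePart (S n.*2) p @[n --> \oo] --> rePart harmonic_proj p) /\
  (imPart (S n.*2) p @[n --> \oo] --> imPart harmonic_proj p).
Proof.
move=> dp; rewrite rePart_proj imPart_proj.
have key (a b : nat -> R[i]) : subexponential a -> subexponential b -> b 0 = 0 ->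
    (\sum_(0 <= k < n) Re (a k * cplx p ^+ k) +
     \sum_(0 <= k < n) Re (b k.+1 * cplx p ^+ k.+1)) @[n --> \oo] -->
    harm_series (fun k => a k + b k) p.
  move=> ha hb b0; rewrite harm_seriesD //.
  apply: cvgD; first exact: harm_series_cvg.
  have := harm_series_cvg hb dp; rewrite -/(harm_series b p) -cvg_shiftS.
  apply: cvg_trans; apply: near_eq_cvg; apply: nearW => n.
  by rewrite /series /= big_nat_recl //= b0 mul0r add0r.
have hA := subexponentialA; have hB := subexponentialB.
split.
- have := key _ _ hA hB erefl; apply: cvg_trans; apply: near_eq_cvg; apply: nearW => n.
  rewrite /rePart fourier_sum_double ReD !Re_sum; congr (_ + _).
  by apply: eq_bigr => k _; rewrite [RHS]Re_mulJ.
- have := key _ _ (subexponentialZ (- 'i%C) hA) (subexponentialZ 'i%C hB) (mulr0 _).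
  apply: cvg_trans; apply: near_eq_cvg; apply: nearW => n.
  have ImE (z : R[i]) : Im z = Re (- 'i%C * z) by rewrite ReM /=; ring.
  rewrite /imPart fourier_sum_double ImD !Im_sum; congr (_ + _).
    by apply: eq_bigr => k _; rewrite -mulrA [RHS]ImE.
  apply: eq_bigr => k _; rewrite [RHS]ImE mulrA Re_mulJ; congr (Re (_ * _)).
  by rewrite /coefB; apply: complex_ext; rewrite /=; ring.
Qed.

Lemma measurable_proj : measurable_diskC harmonic_proj.
Proof.
have mS n : measurable_diskC (S n) by have [] := (L2DP _).1 (L2D_fourier_sum g L2D_hbasis n).
split.
- by apply: (@measurable_fun_cvg _ _ _ mD (fun n => rePart (S n.*2))) => [n|p dp];
    [have [] := mS n.*2|have [] := fourier_cvg dp].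
- by apply: (@measurable_fun_cvg _ _ _ mD (fun n => imPart (S n.*2))) => [n|p dp];
    [have [] := mS n.*2|have [] := fourier_cvg dp].
Qed.

Lemma L2D_S n : L2D (S n).
Proof. exact: L2D_fourier_sum L2D_hbasis n. Qed.

Lemma L2D_proj : L2D harmonic_proj.
Proof.
have [] := @nsq_fatou _ (fun n => S n.*2) harmonic_proj (nsq g) (fun n => L2D_S n.*2)
  measurable_proj _ fourier_cvg => // n.
rewrite nsq_fourier_sum; [|exact: L2D_hbasis|exact: hbasis_orth|exact: nsq_hbasis_gt0].
exact: (bessel L2D_hbasis Lg hbasis_orth nsq_hbasis_gt0).
Qed.

(** Pointwise convergence becomes convergence in norm: Fatou's lemma for the tails after a fixed m,
    whose norms are tails of a bounded increasing energy. *)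
Lemma proj_approx (e : R) : 0 < e ->
  exists n, forall m, (n <= m)%N -> nsq (fun z => harmonic_proj z - S m z) <= e.
Proof.
move=> e0; have [n hn] := fourier_energy_tail L2D_hbasis Lg hbasis_orth nsq_hbasis_gt0 e0.
have homo := fourier_energy_homo g nsq_hbasis_gt0.
exists n => m nm.
have [] := @nsq_fatou _ (fun k z => S (k + m).*2 z - S m z) (fun z => harmonic_proj z - S m z) e.
- by move=> k; apply: L2DB; exact: L2D_S.
- by have [] := (L2DP _).1 (L2DB L2D_proj (L2D_S m)).
(* The index 2 (k + m) is even, as [fourier_cvg] requires, and has the form m + _ that the tail
   formula requires. *)
- move=> k; have -> : (k + m).*2 = (m + (k.*2 + m))%N by rewrite doubleD -addnn; lia.
  rewrite nsq_fourier_tail; [|exact: L2D_hbasis|exact: hbasis_orth|exact: nsq_hbasis_gt0].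
  have := hn (m - n + (k.*2 + m))%N; rewrite addnA subnKC // => h.
  by apply: le_trans h; rewrite lerD2l lerN2 homo.
- move=> p dp; have [c1 c2] := fourier_cvg dp.
  have shift (u : nat -> R) (l : R) : u n @[n --> \oo] --> l -> u (k + m)%N @[k --> \oo] --> l.
    by move=> ul; rewrite cvg_shiftn.
  split.
  + rewrite (_ : rePart _ p = rePart harmonic_proj p - rePart (S m) p); last first.
      by rewrite /rePart ReD ReN.
    rewrite (_ : (fun k => _) = (fun k => rePart (S (k + m).*2) p - rePart (S m) p)); last first.
      by apply/funext => k; rewrite /rePart ReD ReN.
    by apply: cvgB; [exact: (shift _ _ c1)|exact: cvg_cst].
  + rewrite (_ : imPart _ p = imPart harmonic_proj p - imPart (S m) p); last first.
      by rewrite /imPart ImD ImN.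
    rewrite (_ : (fun k => _) = (fun k => imPart (S (k + m).*2) p - imPart (S m) p)); last first.
      by apply/funext => k; rewrite /imPart ImD ImN.
    by apply: cvgB; [exact: (shift _ _ c2)|exact: cvg_cst].
- by [].
Qed.

(** For m > j the function g - S m is exactly orthogonal to [hbasis j], and it tends in norm to g -
    [harmonic_proj]. *)
Lemma proj_orth_hbasis j : dotD (fun z => g z - harmonic_proj z) (hbasis j) = 0.
Proof.
have Lh := L2D_proj; have LD := L2DB Lg Lh; have LE := L2D_hbasis j.
rewrite dotDC //; suff -> : dotD (hbasis j) (fun z => g z - harmonic_proj z) = 0 by rewrite rmorph0.
apply: nsq_le_dot0 => // e e0; have [n hn] := proj_approx e0.
pose m := maxn n j.+1.
exists (fun z => g z - S m z); first by apply: L2DB => //; exact: L2D_S.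
split.
- rewrite dotDBr //; last exact: L2D_S.
  rewrite (dotDC Lg LE) (dotDC (L2D_S m) LE).
  rewrite dot_fourier_sum; [|exact: L2D_hbasis|exact: hbasis_orth|exact: nsq_hbasis_gt0].
  by rewrite leq_maxr subrr.
- rewrite (nsq_eqD (g := fun z => (-1) * (harmonic_proj z - S m z))); last first.
    by move=> p _; ring.
  rewrite nsqZ; last by apply: L2DB => //; exact: L2D_S.
  rewrite normcN Normc.normc1 expr1n mul1r; apply: hn; exact: leq_maxl.
Qed.

Theorem harmonic_projP :
  L2h harmonic_proj /\ orthD L2h (fun z => g z - harmonic_proj z).
Proof.
have Lh := L2D_proj; have LD := L2DB Lg Lh; split.
  split => //.
  - by rewrite rePart_proj; apply: harm_series_harmonic; exact: subexponentialRe.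
  - by rewrite imPart_proj; apply: harm_series_harmonic; exact: subexponentialIm.
split => // f hf; apply: L2h_dense => // k.
- by rewrite -hbasis_even proj_orth_hbasis.
- case: k => [|k]; last by rewrite -hbasis_odd proj_orth_hbasis.
  by have := proj_orth_hbasis 0.
Qed.

End HarmonicProjection.

(** * Dual Toeplitz operators *)

Section DualToeplitz.
Context {R : realType}.
Implicit Types (c l : R[i]) (f g h u v w phi : R[i] -> R[i]).

(** Read as a power series with a single nonzero coefficient, which spares computing partial
    derivatives again. *)
Lemma harmonic_monomial c k : harmonic_on_disk (fun p => Re (c * cplx p ^+ k)).
Proof.
pose a j : R[i] := if j == k then c else 0.
have ha : subexponential a.
  apply: (@subexponential_linear _ _ (normc c)) => j; rewrite /a.
  case: eqP => _; last by rewrite Normc.normc0 mulr_ge0 // normc_ge0.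
  by rewrite ler_peMr ?normc_ge0 // ler1n.
have <- : harm_series a = fun p => Re (c * cplx p ^+ k); last exact: harm_series_harmonic.
apply/funext => p; apply: cvg_lim => //.
rewrite -(cvg_shiftn k.+1); apply: cvg_trans (cvg_cst (F := \oo) (Re (c * cplx p ^+ k))).
apply: near_eq_cvg; apply: nearW => n; rewrite /series /= big_mkord.
have kn : (k < n + k.+1)%N by rewrite addnS ltnS leq_addl.
rewrite (bigD1 (Ordinal kn)) //= /a eqxx big1 ?addr0 // => j.
by rewrite -val_eqE /= => /negbTE ->; rewrite mul0r.
Qed.

Lemma L2h_mono_z k : L2h (@mono R k 0).
Proof.
split; first exact: L2D_mono.
- rewrite (_ : rePart _ = fun p => Re (1 * cplx p ^+ k)); first exact: harmonic_monomial.
  by apply/funext => p; rewrite /rePart /mono expr0 mulr1 mul1r.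
- rewrite (_ : imPart _ = fun p => Re (- 'i%C * cplx p ^+ k)); first exact: harmonic_monomial.
  by apply/funext => p; rewrite /imPart /mono expr0 mulr1 ReM /=; ring.
Qed.

Lemma L2h_mono_zJ k : L2h (@mono R 0 k).
Proof.
split; first exact: L2D_mono.
- rewrite (_ : rePart _ = fun p => Re (1 * cplx p ^+ k)); first exact: harmonic_monomial.
  by apply/funext => p; rewrite /rePart -(monoJ k 0) ReJ /mono expr0 mulr1 mul1r.
- rewrite (_ : imPart _ = fun p => Re ('i%C * cplx p ^+ k)); first exact: harmonic_monomial.
  by apply/funext => p; rewrite /imPart -(monoJ k 0) ImJ /mono expr0 mulr1 ReM /=; ring.
Qed.

Local Notation H := (orthD (@L2h R)).

(** The payoff of density: orthogonality to L_h^2 becomes a countable family of moment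
    conditions. *)
Lemma orth_monoP w : H w <-> [/\ L2D w, forall k, dotD w (mono k 0) = 0 &
  forall k, dotD w (mono 0 k) = 0].
Proof.
split=> [[Lw h]|[Lw h1 h2]].
  by split=> // k; apply: h; [exact: L2h_mono_z|exact: L2h_mono_zJ].
by split=> // f hf; exact: L2h_dense.
Qed.

Lemma orthZ c w : H w -> H (fun z => c * w z).
Proof.
move=> [Lw h]; split; first exact: L2DZ.
by move=> f hf; have [Lf _ _] := hf; rewrite dotDZl // h // mulr0.
Qed.

Lemma orthD_add v w : H v -> H w -> H (fun z => v z + w z).
Proof.
move=> [Lv hv] [Lw hw]; split; first exact: L2DD.
by move=> f hf; have [Lf _ _] := hf; rewrite dotDDl // hv // hw // addr0.
Qed.

Lemma orthB v w : H v -> H w -> H (fun z => v z - w z).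
Proof.
move=> [Lv hv] [Lw hw]; split; first exact: L2DB.
by move=> f hf; have [Lf _ _] := hf; rewrite dotDBl // hv // hw // subrr.
Qed.

Lemma orth_eqD v w : (forall p, disk p -> v (cplx p) = w (cplx p)) -> H v -> H w.
Proof.
move=> e [Lv hv]; split; first exact: eqD_L2D e Lv.
by move=> f hf; rewrite -(hv f hf); apply: eq_dotD => // p /e.
Qed.

Lemma dotDJ f g : L2D f -> L2D g ->
  dotD (fun z => (f z)^*) g = (dotD f (fun z => (g z)^*))^*.
Proof.
move=> Lf Lg; rewrite -dotDC //; last exact: L2DJ.
by apply: eq_integralD => p _; rewrite mulrC; congr (_ * _); exact/esym/conjcK.
Qed.

Lemma orthJ w : H w -> H (fun z => (w z)^*).
Proof.
move=> /orth_monoP[Lw h1 h2]; apply/orth_monoP; split; first exact: L2DJ.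
- move=> k; rewrite dotDJ //; last exact: L2D_mono.
  rewrite (eq_dotD (f' := w) (g' := mono 0 k)) ?h2 ?rmorph0 //.
  by move=> p _; exact: monoJ.
- move=> k; rewrite dotDJ //; last exact: L2D_mono.
  rewrite (eq_dotD (f' := w) (g' := mono k 0)) ?h1 ?rmorph0 //.
  by move=> p _; exact: monoJ.
Qed.

(* The double orthogonal complement of [L2h] is stable under linear
   combinations and conjugation without any computation on derivatives. *)
Definition biorth h : Prop := L2D h /\ forall w, H w -> dotD w h = 0.

Lemma L2h_biorth h : L2h h -> biorth h.
Proof. by move=> hh; have [Lh _ _] := hh; split => // w [_]; apply. Qed.

Lemma biorthZ c h : biorth h -> biorth (fun z => c * h z).
Proof.
move=> [Lh hh]; split; first exact: L2DZ.
by move=> w Hw; have [Lw _] := Hw; rewrite dotDZr // hh // mulr0.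
Qed.

Lemma biorthD g h : biorth g -> biorth h -> biorth (fun z => g z + h z).
Proof.
move=> [Lg hg] [Lh hh]; split; first exact: L2DD.
by move=> w Hw; have [Lw _] := Hw; rewrite dotDDr // hg // hh // addr0.
Qed.

Lemma biorthB g h : biorth g -> biorth h -> biorth (fun z => g z - h z).
Proof.
move=> [Lg hg] [Lh hh]; split; first exact: L2DB.
by move=> w Hw; have [Lw _] := Hw; rewrite dotDBr // hg // hh // subrr.
Qed.

Lemma biorthJ h : biorth h -> biorth (fun z => (h z)^*).
Proof.
move=> [Lh hh]; split; first exact: L2DJ.
move=> w Hw; have [Lw _] := Hw; have [LwJ _] := orthJ Hw.
rewrite -(conjcK (dotD _ _)) -dotDJ // hh ?rmorph0 //; exact: orthJ.
Qed.

(** Characterizes the projection up to null functions. Unlike the chosen [projQ], it is visibly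
    stable under linear combinations and conjugation, so explicit candidates can be checked and
    compared with [projQ] by their norms. *)
Definition is_proj g h : Prop := biorth h /\ H (fun z => g z - h z).

Lemma projQP g : L2D g -> is_proj g (projQ g).
Proof.
move=> Lg; have [P1 P2] : L2h (projQ g) /\ H (fun z => g z - projQ g z).
  rewrite /projQ; apply: (@xgetPex _ (fun=> 0) [set h | L2h h /\ H (fun z => g z - h z)]).
  by exists (harmonic_proj g); exact: harmonic_projP.
by split => //; exact: L2h_biorth.
Qed.

(** The difference lies both in [biorth] and in the orthogonal complement, hence is orthogonal to
    itself. *)
Lemma proj_unique g h h' : is_proj g h -> is_proj g h' -> nsq (fun z => h z - h' z) = 0.
Proof.
move=> [Bh Hh] [Bh' Hh']; have [_ D0] := biorthB Bh Bh'.
rewrite /nsq D0 //; apply: orth_eqD (orthB Hh' Hh) => p _; ring.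
Qed.

Lemma nsq_eq0_dot f g : L2D f -> L2D g -> nsq f = 0 -> dotD f g = 0.
Proof.
move=> Lf Lg n0; apply: Normc.eq0_normc; apply/eqP; rewrite -sqrf_eq0 eq_le sqr_ge0 andbT.
by have := dotD_CauchySchwarz Lf Lg; rewrite n0 mul0r.
Qed.

Lemma nsq_sub_eq0 f g : L2D f -> L2D g -> nsq (fun z => f z - g z) = 0 -> nsq f = nsq g.
Proof.
move=> Lf Lg n0; have LD := L2DB Lf Lg.
have h1 := nsq_eq0_dot LD Lf n0; have h2 := nsq_eq0_dot LD Lg n0.
rewrite dotDBl // in h1; rewrite dotDBl // in h2.
move/eqP: h1; rewrite subr_eq0 => /eqP h1; move/eqP: h2; rewrite subr_eq0 => /eqP h2.
by rewrite /nsq h1 -h2 (dotDC Lf Lg) ReJ.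
Qed.

Lemma nsq_proj g h : L2D g -> is_proj g h -> nsq (projQ g) = nsq h.
Proof.
move=> Lg ph; have pq := projQP Lg; apply: nsq_sub_eq0; last exact: proj_unique ph.
  by have [[]] := pq.
by have [[]] := ph.
Qed.

Lemma is_projZ c g h : is_proj g h -> is_proj (fun z => c * g z) (fun z => c * h z).
Proof.
move=> [Bh Hh]; split; first exact: biorthZ.
by apply: orth_eqD (orthZ c Hh) => p _; rewrite mulrBr.
Qed.

Lemma is_projD g g' h h' : is_proj g h -> is_proj g' h' ->
  is_proj (fun z => g z + g' z) (fun z => h z + h' z).
Proof.
move=> [Bh Hh] [Bh' Hh']; split; first exact: biorthD.
by apply: orth_eqD (orthD_add Hh Hh') => p _; rewrite opprD addrACA.
Qed.

Lemma is_projJ g h : is_proj g h -> is_proj (fun z => (g z)^*) (fun z => (h z)^*).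
Proof.
move=> [Bh Hh]; split; first exact: biorthJ.
by apply: orth_eqD (orthJ Hh) => p _; rewrite rmorphB.
Qed.

Lemma eq_nsq_normc f g : (forall p, disk p -> normc (f (cplx p)) = normc (g (cplx p))) ->
  nsq f = nsq g.
Proof.
move=> h; rewrite !nsqE; congr (_ * _); apply: eq_Rintegral => p; rewrite inE => dp.
by rewrite -[LHS]/(sqPart f p) -[RHS]/(sqPart g p) !sqPartE h.
Qed.

Lemma nsqJ f : nsq (fun z => (f z)^*) = nsq f.
Proof. by apply: eq_nsq_normc => p _; exact: normcJ_real. Qed.

Lemma nsq_projJ g : L2D g -> nsq (projQ (fun z => (g z)^*)) = nsq (projQ g).
Proof.
move=> Lg; rewrite (nsq_proj (L2DJ Lg) (is_projJ (projQP Lg))); exact: nsqJ.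
Qed.

Definition bounded_symbol (phi : R[i] -> R[i]) : Prop := measurable_diskC phi /\
  exists M, forall p, disk p -> normc (phi (cplx p)) <= M.

Lemma bounded_symbolM phi u : bounded_symbol phi -> L2D u -> L2D (fun z => phi z * u z).
Proof. by move=> [m [M h]]; exact: L2DM h. Qed.

Lemma bounded_symbolJ phi : bounded_symbol phi -> bounded_symbol (fun z => (phi z)^*).
Proof.
move=> [m [M h]]; split; first exact: measurable_diskCJ.
by exists M => p /h; rewrite normcJ_real.
Qed.

Lemma dualToeplitz_orth phi u : bounded_symbol phi -> L2D u -> H (dualToeplitz phi u).
Proof. by move=> bphi Lu; have [] := projQP (bounded_symbolM bphi Lu). Qed.

Lemma dotD_mulJ phi u v : dotD (fun z => phi z * u z) v = dotD u (fun z => (phi z)^* * v z).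
Proof.
have e (x y z : R[i]) : x * y * z^* = y * (x^* * z)^*.
  by case: x y z => a b [c d] [c' d']; apply: complex_ext => /=; ring.
by apply: eq_integralD => p _; exact: e.
Qed.

Lemma dualToeplitz_dot phi u v : bounded_symbol phi -> L2D u -> H v ->
  dotD (dualToeplitz phi u) v = dotD (fun z => phi z * u z) v.
Proof.
move=> bphi Lu Hv; have [Lv _] := Hv; have Lpu := bounded_symbolM bphi Lu.
have [[Lq hq] _] := projQP Lpu.
by rewrite dotDBl // -/(projQ _) (dotDC Lv Lq) hq // rmorph0 subr0.
Qed.

Lemma dualToeplitz_dotr phi u v : bounded_symbol phi -> L2D u -> H v ->
  dotD v (dualToeplitz phi u) = dotD v (fun z => phi z * u z).
Proof.
move=> bphi Lu Hv; have [Lv _] := Hv; have Lpu := bounded_symbolM bphi Lu.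
have [LT _] := dualToeplitz_orth bphi Lu.
by rewrite dotDC // dualToeplitz_dot // -dotDC.
Qed.

Lemma nsq_dualToeplitz phi u : bounded_symbol phi -> L2D u ->
  nsq (dualToeplitz phi u) + nsq (projQ (fun z => phi z * u z)) = nsq (fun z => phi z * u z).
Proof.
move=> bphi Lu; have [[Lq hq] Hg] := projQP (bounded_symbolM bphi Lu).
have HT := dualToeplitz_orth bphi Lu; have [LT _] := HT.
rewrite -[RHS](nsq_eqD (f := fun z => dualToeplitz phi u z + projQ (fun z => phi z * u z) z)).
  by rewrite nsqD // hq // mulr0 addr0.
by move=> p _; rewrite /dualToeplitz subrK.
Qed.

Lemma nsq_mulJ phi u : nsq (fun z => (phi z)^* * u z) = nsq (fun z => phi z * u z).
Proof.
by apply: eq_nsq_normc => p _; rewrite !Normc.normcM; congr (_ * _); exact: normcJ_real.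
Qed.

Lemma normal_hyponormal T : (forall u, H u -> H (T u)) -> normal_op H T -> hyponormal H T.
Proof.
move=> HT [T' [[HT' adj] nor]]; exists T'; split => // u Hu.
have [Lu _] := Hu; have [L1 _] := HT' _ (HT _ Hu); have [L2 _] := HT _ (HT' _ Hu).
by rewrite dotDBl // (aeD_dot L1 L2 Lu (nor u Hu)) subrr.
Qed.

(** Any adjoint agrees in norm with the operator of the conjugate symbol, since both have the same
    inner products with the whole space. As phi u and its analogue for the conjugate symbol have
    equal norms, Pythagoras reverses the hyponormality inequality when passing to the projected
    parts. *)
Lemma hyponormal_proj_le phi u : bounded_symbol phi -> hyponormal H (dualToeplitz phi) -> H u ->
  nsq (projQ (fun z => phi z * u z)) <= nsq (projQ (fun z => (phi z)^* * u z)).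
Proof.
move=> bphi [T' [[HT' adj] hyp]] Hu; have [Lu _] := Hu.
have bphiJ := bounded_symbolJ bphi.
set T := dualToeplitz phi; set T1 := dualToeplitz (fun z => (phi z)^*).
have HT v : H v -> H (T v) by move=> [Lv _]; exact: dualToeplitz_orth.
have HTu := HT _ Hu; have HT'u := HT' _ Hu.
have HT1u : H (T1 u) by exact: dualToeplitz_orth.
have adj1 v : H v -> dotD v (T' u) = dotD v (T1 u).
  move=> Hv; have [Lv _] := Hv; rewrite -adj // dualToeplitz_dot // dotD_mulJ.
  by rewrite dualToeplitz_dotr.
have [LTu _] := HTu; have [LT'u _] := HT'u; have [LT1u _] := HT1u.
have n0 : nsq (fun z => T' u z - T1 u z) = 0.
  have HD := orthB HT'u HT1u; have [LD _] := HD.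
  by rewrite /nsq dotDBr // adj1 // subrr.
have e1 := nsq_sub_eq0 LT'u LT1u n0.
have [L1 _] := HT' _ HTu; have [L2 _] := HT _ HT'u.
have e2 : dotD (fun z => T' (T u) z - T (T' u) z) u = (nsq (T u) - nsq (T' u))%:C.
  have a1 : dotD (T (T' u)) u = (nsq (T' u))%:C by rewrite -dotDff; exact: adj.
  have a2 : dotD u (T' (T u)) = (nsq (T u))%:C by rewrite -dotDff; exact/esym/adj.
  by rewrite (dotDBl L1 L2 Lu) a1 (dotDC Lu L1) a2 conjc_real -rmorphB.
have : 0 <= (nsq (T u) - nsq (T' u))%:C by rewrite -e2; exact: hyp.
rewrite ler0c subr_ge0 e1.
have aux (x y A B N : R) : x + A = N -> y + B = N -> y <= x -> A <= B by lra.
by apply: aux (nsq_dualToeplitz bphi Lu) _; rewrite -(nsq_mulJ phi u); exact: nsq_dualToeplitz.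
Qed.

(* The inequality for the conjugate test function is the reverse one, since
   the projection commutes with conjugation. *)
Lemma hyponormal_proj_eq phi u : bounded_symbol phi -> hyponormal H (dualToeplitz phi) -> H u ->
  nsq (projQ (fun z => phi z * u z)) = nsq (projQ (fun z => (phi z)^* * u z)).
Proof.
move=> bphi hyp Hu; have [Lu _] := Hu; apply/le_anti/andP; split.
  exact: hyponormal_proj_le.
have a : nsq (projQ (fun z => phi z * (u z)^*)) = nsq (projQ (fun z => (phi z)^* * u z)).
  have e : (fun z => ((phi z)^* * u z)^*) = (fun z => phi z * (u z)^*).
    apply/funext => z; case: (phi z) (u z) => x y [x' y'].
    by apply: complex_ext => /=; ring.
  rewrite -e; apply: nsq_projJ; exact: bounded_symbolM (bounded_symbolJ bphi) Lu.
have b : nsq (projQ (fun z => (phi z)^* * (u z)^*)) = nsq (projQ (fun z => phi z * u z)).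
  have e : (fun z => (phi z * u z)^*) = (fun z => (phi z)^* * (u z)^*).
    apply/funext => z; case: (phi z) (u z) => x y [x' y'].
    by apply: complex_ext => /=; ring.
  rewrite -e; apply: nsq_projJ; exact: bounded_symbolM bphi Lu.
by rewrite -a -b; exact: hyponormal_proj_le bphi hyp (orthJ Hu).
Qed.

(** The adjoint is l times the operator itself, so both products equal l T^2, up to a null
    function. *)
Lemma normal_of_proportional phi l : bounded_symbol phi ->
  (forall z, (phi z)^* = l * phi z) -> normal_op H (dualToeplitz phi).
Proof.
move=> bphi e; set T := dualToeplitz phi.
have HT v : H v -> H (T v) by move=> [Lv _]; exact: dualToeplitz_orth.
exists (fun v z => l * T v z); split; first split.
- by move=> v Hv; apply: orthZ; exact: HT.
- move=> u v Hu Hv; have [Lu _] := Hu; have [Lv _] := Hv; have [LTv _] := HT _ Hv.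
  rewrite dotDZr // dualToeplitz_dotr // dualToeplitz_dot // dotD_mulJ.
  rewrite -dotDZr //; last exact: bounded_symbolM.
  by apply: eq_dotD => // p _; rewrite mulrA; congr (_ * _); exact: e.
- move=> u Hu; have [LTu _] := HT _ Hu.
  have Lg := bounded_symbolM bphi LTu; have Lg' := L2DZ l Lg.
  (* Homogeneity of [projQ] is only available in norm: [projQ] of the multiple and the multiple of
     [projQ] are two projections of one function, hence equal almost everywhere on the disk. *)
  have p1 := is_projZ l (projQP Lg); have p2 := projQP Lg'.
  have n0 := proj_unique p2 p1.
  have L3 := L2DB p2.1.1 p1.1.1.
  have ef : (fun z => phi z * (l * T u z)) = (fun z => l * (phi z * T u z)).
    by apply/funext => z; rewrite mulrCA.
  have eT z : T (fun z => l * T u z) z =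
      l * (phi z * T u z) - projQ (fun z => l * (phi z * T u z)) z.
    by rewrite -ef /T /dualToeplitz mulrCA.
  have [N [mN N0 sN]] := nsq0_ae L3 n0; exists N; split=> // p np; apply: sN => h.
  apply: np => dp; have /eqP := h dp; rewrite subr_eq0 => /eqP e'.
  by rewrite eT e' -mulrBr.
Qed.

End DualToeplitz.

(** * Cauchy matrices *)

Section CauchySystem.
Variable F : numFieldType.

(* A Cauchy matrix is invertible: after clearing denominators, a kernel vector
   is a polynomial of degree < K with the K roots 0, ..., K - 1. *)
Lemma cauchy_kernel (K : nat) (x : 'I_K -> nat) (b : 'I_K -> F) : injective x ->
  (forall i, (i < K)%N -> \sum_(j < K) b j / (x j + i).+1%:R = 0) -> forall j, b j = 0.
Proof.
move=> ix h j.
pose y l : F := - (x l).+1%:R.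
pose Q l : {poly F} := \prod_(m <- enum (predC1 l)) ('X - (y m)%:P).
have QE l t : (Q l).[t] = \prod_(m | m != l) (t - y m).
  by rewrite /Q horner_prod big_enum; apply: eq_bigr => m _; rewrite !hornerE.
pose P := \sum_l b l *: Q l.
have P0 : P = 0.
  apply: (@roots_geq_poly_eq0 _ P [seq i%:R | i <- iota 0 K]).
  - rewrite all_map; apply/seq.allP => i; rewrite mem_iota add0n => /andP[_ iK] /=.
    rewrite rootE /P horner_sum.
    have xi m : i%:R - y m != 0 by rewrite opprK -natrD pnatr_eq0 addnS.
    apply/eqP; transitivity (\prod_m (i%:R - y m) * \sum_(l < K) b l / (x l + i).+1%:R).
      rewrite mulr_sumr.
      apply: eq_bigr => l _; rewrite hornerZ QE [in RHS](bigD1 l) //=.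
      rewrite opprK -natrD addnS addnC; set u : F := _.+1%:R.
      have u0 : u != 0 by rewrite pnatr_eq0.
      by rewrite [RHS]mulrC -[RHS]mulrA mulKf.
    by rewrite h // mulr0.
  - by rewrite map_inj_uniq ?iota_uniq // => i1 i2 /eqP; rewrite eqr_nat => /eqP.
  - rewrite size_map size_iota; apply: leq_trans (size_sum _ _ _) _.
    apply/bigmax_leqP => l _; apply: leq_trans (size_scale_leq _ _) _.
    rewrite /Q size_prod_XsubC -cardE.
    by have := cardC1 l; rewrite card_ord => ->; case: (K) l => // -[].
(* At the node [y j] every [Q l] with l != j vanishes, which isolates [b j]. *)
have := congr1 (fun p : {poly F} => p.[y j]) P0.
rewrite horner0 /P horner_sum (bigD1 j) //= big1 => [|l lj]; last first.
  by rewrite hornerZ QE (bigD1 j) 1?eq_sym //= subrr mul0r mulr0.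
rewrite addr0 hornerZ QE => /eqP; rewrite mulf_eq0 => /orP[/eqP //|].
rewrite prodf_seq_eq0 => /hasP[l _ /andP[lj]].
by rewrite subr_eq0 eqr_opp eqr_nat eqSS => /eqP/ix e; rewrite e eqxx in lj.
Qed.

(** Taking as many unknowns as nodes makes the system square, so the trivial kernel gives
    solvability. *)
Lemma cauchy_solve (s : seq nat) (v : nat -> F) : uniq s ->
  exists alpha : nat -> F, forall k, k \in s ->
    \sum_(i < size s) alpha i / (k + i).+1%:R = v k.
Proof.
move=> us; set K := size s.
pose A : 'M[F]_K := \matrix_(i, j) ((nth 0%N s j + i).+1%:R)^-1.
have uA : A \in unitmx.
  rewrite -unitmx_tr -row_free_unit -kermx_eq0; apply/rowV0P => b /sub_kermxP bA.
  apply/rowP => j; rewrite [RHS]mxE.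
  apply: (@cauchy_kernel K (fun j => nth 0%N s j) (fun j => b 0 j)) j.
    by move=> j1 j2 /eqP; rewrite nth_uniq // => /eqP/val_inj.
  move=> i iK; have := congr1 (fun M : 'rV_K => M 0 (Ordinal iK)) bA; rewrite !mxE => e.
  by apply: etrans e; apply: eq_bigr => j _; rewrite !mxE.
pose al := (\row_j v (nth 0%N s j)) *m invmx A.
exists (fun i => if insub i is Some i' then al 0 i' else 0) => k ks.
have kK : (index k s < K)%N by rewrite index_mem.
have : (al *m A) 0 (Ordinal kK) = v k by rewrite mulmxKV // mxE /= nth_index.
rewrite mxE => <-; apply: eq_bigr => i _; rewrite valK; congr (_ * _).
by rewrite [RHS]mxE /= nth_index.
Qed.

End CauchySystem.

(** * Arguments of complex numbers *)

Section Argument.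
Context {R : realType}.
Implicit Types (a b z : R[i]) (x : R).

Lemma cos_ratio_itv z : -1 <= Re z / normc z <= 1.
Proof.
have [n0|n0] := eqVneq (normc z) 0; first by rewrite n0 invr0 mulr0 lerN10 ler01.
have np : 0 < normc z by rewrite lt0r n0 normc_ge0.
by rewrite ler_pdivlMr // ler_pdivrMr // mulN1r mul1r -ler_norml norm_Re_le.
Qed.

Lemma carg_polar z :
  Re z = normc z * cos (carg z) /\ Im z = normc z * sin (carg z).
Proof.
have [n0|n0] := eqVneq (normc z) 0.
  by rewrite n0 !mul0r; move/Normc.eq0_normc: n0 => ->.
have np : 0 < normc z by rewrite lt0r n0 normc_ge0.
have cE : carg z = if 0 <= Im z then acos (Re z / normc z) else - acos (Re z / normc z).
  by rewrite /carg normc_normE.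
have hx := cos_ratio_itv z; rewrite cE {cE}; set x := _ / _ in hx *.
have xE : normc z * x = Re z by rewrite /x mulrC divfK.
have sE : normc z * sin (acos x) = `|Im z|.
  rewrite sin_acos // -[X in X * _](@ger0_norm _ (normc z)) ?normc_ge0 //.
  rewrite -sqrtr_sqr -sqrtrM ?sqr_ge0 // mulrBr mulr1 -exprMn xE sqr_normc_parts.
  by rewrite addrC addKr sqrtr_sqr.
have cE : normc z * cos (acos x) = Re z by rewrite acosK // in_itv.
case: ifPn => i0; first by rewrite cE sE ger0_norm.
by rewrite cosN sinN mulrN cE sE ltr0_norm ?opprK // ltNge.
Qed.

Lemma carg_le_pi z : - pi <= carg z <= pi.
Proof.
have hx := cos_ratio_itv z.
have cE : carg z = if 0 <= Im z then acos (Re z / normc z) else - acos (Re z / normc z).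
  by rewrite /carg normc_normE.
have := acos_ge0 hx; have := acos_lepi hx; have := @pi_gt0 R.
by rewrite cE; case: ifP => _; lra.
Qed.

Lemma Im_mulJ_carg a b :
  Im (a * b^*) = normc a * normc b * sin (carg a - carg b).
Proof.
have [ra ia] := carg_polar a; have [rb ib] := carg_polar b.
by rewrite ImM ReJ ImJ ra ia rb ib sinB; ring.
Qed.

Lemma sin_mulz_pi (k : int) : sin (k%:~R * pi) = 0 :> R.
Proof.
have h n : sin (n%:R * pi) = 0 :> R.
  elim: n => [|n IH]; first by rewrite mul0r sin0.
  by rewrite -natr1 mulrDl mul1r sinDpi IH oppr0.
by case: k => n; rewrite ?NegzE ?mulrNz ?mulNr ?sinN ?[_%:~R]/(_%:R) h ?oppr0.
Qed.

(** The range is that of a difference of two principal arguments. *)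
Lemma sin_eq0_mulz_pi x : - (2 * pi) <= x <= 2 * pi -> sin x = 0 ->
  exists k : int, x = k%:~R * pi.
Proof.
have p0 := @pi_gt0 R.
wlog x0 : x / 0 <= x => [hw|].
  have [/hw|x0] := lerP 0 x; first exact.
  move=> hx s0; have [|||k kE] := hw (- x); [lra|lra|by rewrite sinN s0 oppr0|].
  by exists (- k); rewrite mulrNz mulNr -kE opprK.
move=> /andP[_ x2] s0; have [x1|x1] := lerP x pi.
  have [->|xn] := eqVneq x 0; first by exists 0; rewrite mul0r.
  have [->|xp] := eqVneq x pi; first by exists 1; rewrite mul1r.
  suff : 0 < sin x by rewrite s0 ltxx.
  by apply: sin_gt0_pi; rewrite lt0r xn x0 lt_neqAle xp x1.
have [->|xp] := eqVneq x (2 * pi); first by exists 2.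
suff : 0 < sin (x - pi) by rewrite -[sin _]opprK -sinDpi subrK s0 oppr0 ltxx.
apply: sin_gt0_pi; rewrite subr_gt0 x1 /= ltrBlDr -mulr2n -mulr_natl.
by rewrite lt_neqAle xp.
Qed.

(** Replaces the condition on arguments by an algebraic one, in which both directions of the theorem
    are proved. *)
Lemma eq_arg_mod_piP a b : a != 0 -> b != 0 ->
  eq_arg_mod_pi a b <-> Im (a * b^*) = 0.
Proof.
move=> a0 b0; rewrite Im_mulJ_carg; split=> [[k ->]|/eqP].
  by rewrite sin_mulz_pi mulr0.
rewrite !mulf_eq0 !normc_eq0 (negbTE a0) (negbTE b0) /= => /eqP.
apply: sin_eq0_mulz_pi; have := carg_le_pi a; have := carg_le_pi b; lra.
Qed.

End Argument.

(** * Test functions *)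

Section MonomialTest.
Context {R : realType}.
Local Notation H := (orthD (@L2h R)).
Variables (d K : nat) (alpha : nat -> R[i]).
Implicit Types n m p q e : nat.

Definition shell z : R[i] := \sum_(i < K) alpha i * mono (d + i) i z.

(** The function L of the overview; [shell] is its test function u. *)
Definition cauchy_sum k : R[i] := \sum_(i < K) alpha i / (k + i).+1%:R.

Lemma moment_diagC i : moment i i = (@area0 R)%:C / i.+1%:R.
Proof. by rewrite moment_diag rmorphM fmorphV rmorph_nat. Qed.

Lemma mono_shell n m z :
  mono n m z * shell z = \sum_(i < K) alpha i * mono (n + (d + i)) (m + i) z.
Proof. by rewrite mulr_sumr; apply: eq_bigr => i _; rewrite mulrCA monoM. Qed.

Lemma L2D_mono_shell n m : L2D (fun z => mono n m z * shell z).
Proof.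
apply: (eqD_L2D (f := fun z => \sum_(i < K) alpha i * mono (n + (d + i)) (m + i) z)).
  by move=> p _; rewrite mono_shell.
by apply: L2D_sum => i; apply: L2DZ; exact: L2D_mono.
Qed.

Lemma dot_mono_shell n m p q : dotD (fun z => mono n m z * shell z) (mono p q) =
  \sum_(i < K) alpha i * moment (n + (d + i) + q) (m + i + p).
Proof.
rewrite (eq_dotD (f' := fun z => \sum_(i < K) alpha i * mono (n + (d + i)) (m + i) z)
  (g' := mono p q)) //; last by move=> z _; rewrite mono_shell.
rewrite dotD_suml; [|by move=> i; apply: L2DZ; exact: L2D_mono|exact: L2D_mono].
apply: eq_bigr => i _; rewrite dotDZl; [|exact: L2D_mono|exact: L2D_mono].
by rewrite dot_mono addnA.
Qed.

Lemma dot_mono_shell0 n m p q : (n + d + q != m + p)%N ->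
  dotD (fun z => mono n m z * shell z) (mono p q) = 0.
Proof.
move=> h; rewrite dot_mono_shell big1 // => i _; rewrite moment_neq ?mulr0 //.
by rewrite addnA !(addnAC _ (i : nat)) eqn_add2r.
Qed.

Lemma dot_mono_shell_diag n m p q : (n + d + q = m + p)%N ->
  dotD (fun z => mono n m z * shell z) (mono p q) =
  (@area0 R)%:C * cauchy_sum (m + p).
Proof.
move=> h; rewrite dot_mono_shell mulr_sumr; apply: eq_bigr => i _.
by rewrite addnA !(addnAC _ (i : nat)) h moment_diagC mulrCA.
Qed.

Lemma shell_orth : (0 < d)%N -> cauchy_sum d = 0 -> H shell.
Proof.
move=> d_gt0 L0; apply: (@orth_eqD _ (fun z => mono 0 0 z * shell z)).
  by move=> p _; rewrite /mono !expr0 !mul1r.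
apply/orth_monoP; split=> [|k|k]; first exact: L2D_mono_shell.
- have [<-|kd] := eqVneq d k; last by rewrite dot_mono_shell0 // add0n addn0.
  by rewrite dot_mono_shell_diag ?addn0 // L0 mulr0.
- by rewrite dot_mono_shell0 // addn0 !add0n gtn_eqF // addn_gt0 d_gt0.
Qed.

(** The factor e + 1 is [area0] over the squared norm of z^e. Since e > 0, the product is orthogonal
    to the constants and to all powers of the conjugate of z. *)
Lemma is_proj_mono_shell n m e : (0 < e)%N -> (m + e = n + d)%N ->
  is_proj (fun z => mono n m z * shell z)
          (fun z => e.+1%:R * cauchy_sum (n + d) * mono e 0 z).
Proof.
move=> e0 he; have Lm := L2D_mono_shell n m.
set c := _%:R * _; have Le : L2D (@mono R e 0) := L2D_mono e 0.
have Lc : L2D (fun z => c * mono e 0 z) := L2DZ c Le.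
split; first by apply: biorthZ; apply: L2h_biorth; exact: L2h_mono_z.
apply/orth_monoP; split=> [|k|k]; first exact: L2DB.
- rewrite dotDBl //; last exact: L2D_mono.
  rewrite dotDZl // ?dot_mono; last exact: L2D_mono.
  have [<-|ke] := eqVneq e k.
    rewrite dot_mono_shell_diag ?addn0 // add0n moment_diagC he /c.
    have e1 : e.+1%:R != 0 :> R[i] by rewrite pnatr_eq0.
    by move: (_%:C) (cauchy_sum _) => x y; field.
  rewrite dot_mono_shell0; last by rewrite addn0 -he eqn_add2l.
  by rewrite moment_neq ?mulr0 ?subrr // addn0.
- rewrite dotDBl //; last exact: L2D_mono.
  rewrite dotDZl // ?dot_mono; last exact: L2D_mono.
  rewrite dot_mono_shell0; last by rewrite -he; apply/eqP; lia.
  by rewrite moment_neq ?mulr0 ?subrr //; apply/eqP; lia.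
Qed.

End MonomialTest.

Section SymbolProjection.
Context {R : realType}.
Local Notation H := (orthD (@L2h R)).
Implicit Types (a b x y : R[i]).

Lemma nsq_two_mono x y e e' : e != e' ->
  nsq (fun z => x * mono e 0 z + y * mono e' 0 z) =
  @area0 R * (normc x ^+ 2 / e.+1%:R + normc y ^+ 2 / e'.+1%:R).
Proof.
move=> ee; have L1 := @L2D_mono R e 0; have L2 := @L2D_mono R e' 0.
rewrite nsqD; [|exact: L2DZ|exact: L2DZ].
rewrite !nsqZ // !nsq_mono !addn0 dotDZl //; last exact: L2DZ.
rewrite dotDZr // dot_mono moment_neq ?addn0 ?add0n // !mulr0 addr0 mulrDr.
by rewrite -!(mulrCA (@area0 R)).
Qed.

Lemma nsq_one_mono x y e :
  nsq (fun z => x * mono e 0 z + y * mono e 0 z) =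
  @area0 R * (normc (x + y) ^+ 2 / e.+1%:R).
Proof.
have L1 := @L2D_mono R e 0.
rewrite (nsq_eqD (g := fun z => (x + y) * mono e 0 z)).
  by rewrite nsqZ // nsq_mono addn0 mulrCA.
by move=> p _; rewrite mulrDl.
Qed.

Lemma symbolE a b n1 m1 n2 m2 z :
  symbol a b n1 m1 n2 m2 z = a * mono n1 m1 z + b * mono n2 m2 z.
Proof. by rewrite /symbol /mono !mulrA. Qed.

Lemma symbolJ a b n1 m1 n2 m2 z :
  (symbol a b n1 m1 n2 m2 z)^* = symbol a^* b^* m1 n1 m2 n2 z.
Proof.
rewrite !symbolE -(monoJ n1 m1) -(monoJ n2 m2).
by move: (mono _ _ _) (mono _ _ _) => u v; rewrite rmorphD !rmorphM.
Qed.

Lemma symbol_bounded a b n1 m1 n2 m2 : bounded_symbol (symbol a b n1 m1 n2 m2).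
Proof.
have -> : symbol a b n1 m1 n2 m2 = fun z => a * mono n1 m1 z + b * mono n2 m2 z.
  by apply/funext => z; rewrite symbolE.
split.
  by apply: measurable_diskCD; apply: measurable_diskCM;
    first [exact: measurable_diskC_cst|exact: measurable_mono].
exists (normc a + normc b) => p dp; apply: le_trans (le_normcD _ _) _.
have h c i j : normc (c * mono i j (cplx p)) <= normc c.
  by rewrite Normc.normcM; apply: ler_piMr (normc_ge0 _) _; exact: mono_le1.
exact: lerD.
Qed.

Lemma is_proj_symbol_shell d K (alpha : nat -> R[i]) a b n1 m1 n2 m2 e1 e2 :
  (0 < e1)%N -> (0 < e2)%N -> (m1 + e1 = n1 + d)%N -> (m2 + e2 = n2 + d)%N ->
  is_proj (fun z => symbol a b n1 m1 n2 m2 z * shell d K alpha z)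
    (fun z => a * e1.+1%:R * cauchy_sum K alpha (n1 + d) * mono e1 0 z +
              b * e2.+1%:R * cauchy_sum K alpha (n2 + d) * mono e2 0 z).
Proof.
move=> e10 e20 h1 h2.
have := is_projD (is_projZ a (is_proj_mono_shell K alpha e10 h1))
  (is_projZ b (is_proj_mono_shell K alpha e20 h2)).
congr is_proj; apply/funext => z; first by rewrite symbolE mulrDl !mulrA.
by rewrite !mulrA.
Qed.

End SymbolProjection.

(** Excluding 0 from r keeps the node d, where orthogonality imposes the value 0, distinct from the
    nodes k + d. Exponents may coincide: duplicates are removed, and v is a function of the
    exponent. *)
Lemma shell_interpolation {R : realType} (r : seq nat) d (v : nat -> R[i]) :
  0%N \notin r -> exists K alpha, cauchy_sum K alpha d = 0 /\
    {in r, forall k, cauchy_sum K alpha (k + d) = v k}.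
Proof.
move=> r0; pose s := undup (d :: [seq (k + d)%N | k <- r]).
have [alpha al] := @cauchy_solve (R[i] : numFieldType) s
  (fun k => if k == d then 0 else v (k - d)%N) (undup_uniq _).
exists (size s), alpha; split; first by rewrite [LHS]al ?eqxx // mem_undup inE eqxx.
move=> k kr; have ks : (k + d)%N \in s by rewrite mem_undup inE (map_f (addn^~ d) kr) orbT.
rewrite [LHS]al // -[X in _ == X]add0n eqn_add2r addnK.
by case: eqP => // k0; rewrite k0 (negbTE r0) in kr.
Qed.

(** * Necessity of the three conditions *)

Section Necessity.
Context {R : realType}.
Local Notation H := (orthD (@L2h R)).
Variables (a b : R[i]) (n1 m1 n2 m2 : nat).
Hypotheses (n1_gt0 : (0 < n1)%N) (m1_gt0 : (0 < m1)%N).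
Hypotheses (n2_gt0 : (0 < n2)%N) (m2_gt0 : (0 < m2)%N).
Hypothesis hyp : hyponormal H (dualToeplitz (symbol a b n1 m1 n2 m2)).

Let d := (n1 + n2 + m1 + m2).+1.

(* [d] is large enough for every product to have positive angular frequency,
   and the Cauchy system lets the four projected amplitudes be prescribed. *)
Lemma hyponormal_test (v : nat -> R[i]) :
  let e1 := (n1 + d - m1)%N in let e2 := (n2 + d - m2)%N in
  let f1 := (m1 + d - n1)%N in let f2 := (m2 + d - n2)%N in
  nsq (fun z => a * e1.+1%:R * v n1 * mono e1 0 z + b * e2.+1%:R * v n2 * mono e2 0 z) =
  nsq (fun z => a^* * f1.+1%:R * v m1 * mono f1 0 z + b^* * f2.+1%:R * v m2 * mono f2 0 z).
Proof.
move=> e1 e2 f1 f2.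
have [|K [alpha [ald al]]] := @shell_interpolation R [:: n1; n2; m1; m2] d v.
  by rewrite !inE !negb_or; lia.
have Hu := shell_orth (isT : (0 < d)%N) ald.
have Lu : L2D (shell d K alpha) by have [] := Hu.
have e := hyponormal_proj_eq (symbol_bounded a b n1 m1 n2 m2) hyp Hu.
have p1 := @is_proj_symbol_shell R d K alpha a b n1 m1 n2 m2 e1 e2.
have p2 := @is_proj_symbol_shell R d K alpha a^* b^* m1 n1 m2 n2 f1 f2.
have [a1 a2 a3 a4] : [/\ cauchy_sum K alpha (n1 + d) = v n1,
    cauchy_sum K alpha (n2 + d) = v n2, cauchy_sum K alpha (m1 + d) = v m1 &
    cauchy_sum K alpha (m2 + d) = v m2].
  by split; apply: al; rewrite !inE eqxx ?orbT.
rewrite a1 a2 in p1; rewrite a3 a4 in p2.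
transitivity (nsq (projQ (fun z => symbol a b n1 m1 n2 m2 z * shell d K alpha z))).
  apply/esym/nsq_proj; first exact: bounded_symbolM (symbol_bounded _ _ _ _ _ _) Lu.
  by apply: p1; rewrite /e1 /e2 /d; lia.
rewrite e; transitivity (nsq (projQ (fun z => symbol a^* b^* m1 n1 m2 n2 z *
    shell d K alpha z))).
  by congr (nsq (projQ _)); apply/funext => z; congr (_ * _); exact: symbolJ.
apply: nsq_proj; first exact: bounded_symbolM (symbol_bounded _ _ _ _ _ _) Lu.
by apply: p2; rewrite /f1 /f2 /d; lia.
Qed.

(** The weight e + 1 of the frequency e = i + d - j: the square of the factor e + 1 in the
    projection, times 1 / (e + 1) from the squared norm of z^e. *)
Let E (i j : nat) : R := (i + d - j).+1%:R.

Lemma normc_amplitude (c w : R[i]) k :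
  normc (c * k.+1%:R * w) ^+ 2 / k.+1%:R = k.+1%:R * normc (c * w) ^+ 2 :> R.
Proof.
have k0 : k.+1%:R != 0 :> R by rewrite pnatr_eq0.
have kE : normc (k.+1%:R : R[i]) = k.+1%:R.
  by rewrite -(rmorph_nat (real_complex R)) [LHS]normc_real normr_nat.
by rewrite !Normc.normcM kE; field.
Qed.

(** The hypothesis says that n1 - m1 and n2 - m2 differ: on each side the two projected monomials
    are orthogonal. *)
Lemma hyponormal_test_neq (v : nat -> R[i]) : (n1 + m2 != n2 + m1)%N ->
  E n1 m1 * normc (a * v n1) ^+ 2 + E n2 m2 * normc (b * v n2) ^+ 2 =
  E m1 n1 * normc (a * v m1) ^+ 2 + E m2 n2 * normc (b * v m2) ^+ 2.
Proof.
move=> nm; have := hyponormal_test v; rewrite /= !nsq_two_mono; last first.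
- by rewrite /d; lia.
- by rewrite /d; lia.
move=> /(mulfI (lt0r_neq0 (@area0_gt0 R))); rewrite !normc_amplitude.
by rewrite !(Normc.normcM _^*) !normcJ_real -!Normc.normcM.
Qed.

(** Here n1 - m1 = n2 - m2, so on each side the two monomials project to the same power and their
    amplitudes interfere. *)
Lemma hyponormal_test_eq (v : nat -> R[i]) : (n1 + m2 = n2 + m1)%N ->
  E n1 m1 * normc (a * v n1 + b * v n2) ^+ 2 =
  E m1 n1 * normc (a^* * v m1 + b^* * v m2) ^+ 2.
Proof.
move=> nm; have := hyponormal_test v => /=.
rewrite (_ : n2 + d - m2 = n1 + d - m1)%N; last by rewrite /d; lia.
rewrite (_ : m2 + d - n2 = m1 + d - n1)%N; last by rewrite /d; lia.
rewrite !nsq_one_mono => /(mulfI (lt0r_neq0 (@area0_gt0 R))).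
have e (c c' x x' : R[i]) k : c * k.+1%:R * x + c' * k.+1%:R * x' =
  1 * k.+1%:R * (c * x + c' * x') by ring.
by rewrite !e !normc_amplitude !mul1r.
Qed.

Hypotheses (a_neq0 : a != 0) (b_neq0 : b != 0).

Lemma normc_sqr_gt0 (c : R[i]) : c != 0 -> 0 < normc c ^+ 2.
Proof. by move=> c0; rewrite exprn_gt0 // lt0r normc_ge0 normc_eq0 c0. Qed.

Lemma normc_ind (c : R[i]) (t : bool) : normc (c * t%:R) ^+ 2 = normc c ^+ 2 * t%:R.
Proof. by case: t; rewrite ?mulr1 // mulr0 Normc.normc0 expr0n /= mulr0. Qed.

(** Let v be the indicator of one exponent. If that exponent occurs on one side of the identity
    only, a positive number equals 0; hence n1 and n2 lie in {m1, m2} and conversely. *)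
Lemma hyponormal_cond_neq : (n1 + m2 != n2 + m1)%N ->
  [/\ n1 = m2, m1 = n2, n1 <> m1 & normc a = normc b].
Proof.
move=> nm.
have key k := hyponormal_test_neq (fun j => (j == k)%:R) nm.
have A0 := normc_sqr_gt0 a_neq0; have B0 := normc_sqr_gt0 b_neq0.
have E0 i j : 0 < E i j by rewrite ltr0n.
have EA0 i j := mulr_gt0 (E0 i j) A0; have EB0 i j := mulr_gt0 (E0 i j) B0.
have k1 : (n1 == m1) || (n1 == m2).
  apply: contraT; rewrite negb_or => /andP[/negbTE h1 /negbTE h2].
  have := key n1; rewrite !normc_ind eqxx ![_ == n1]eq_sym h1 h2 !mulr0 addr0 mulr1.
  by have := EA0 n1 m1; have := EB0 n2 m2; case: (n1 == n2) => /=; rewrite ?mulr1 ?mulr0; lra.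
have k2 : (n2 == m1) || (n2 == m2).
  apply: contraT; rewrite negb_or => /andP[/negbTE h1 /negbTE h2].
  have := key n2; rewrite !normc_ind eqxx ![_ == n2]eq_sym h1 h2 !mulr0 addr0 mulr1.
  by have := EA0 n1 m1; have := EB0 n2 m2; case: (n2 == n1) => /=; rewrite ?mulr1 ?mulr0; lra.
have k3 : (m1 == n1) || (m1 == n2).
  apply: contraT; rewrite negb_or => /andP[/negbTE h1 /negbTE h2].
  have := key m1; rewrite !normc_ind eqxx ![_ == m1]eq_sym h1 h2 !mulr0 addr0 mulr1.
  by have := EA0 m1 n1; have := EB0 m2 n2; case: (m1 == m2) => /=; rewrite ?mulr1 ?mulr0; lra.
have k4 : (m2 == n1) || (m2 == n2).
  apply: contraT; rewrite negb_or => /andP[/negbTE h1 /negbTE h2].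
  have := key m2; rewrite !normc_ind eqxx ![_ == m2]eq_sym h1 h2 !mulr0 addr0 mulr1.
  by have := EA0 m1 n1; have := EB0 m2 n2; case: (m2 == m1) => /=; rewrite ?mulr1 ?mulr0; lra.
(* The alternative n1 = m1, n2 = m2 contradicts [nm]. After substitution both weights in the test at
   n1 are [E n1 m1], which leaves |a|^2 = |b|^2. *)
have [e1 [e2 e3]] : n1 = m2 /\ m1 = n2 /\ n1 <> m1 by lia.
split=> //; have := key n1; rewrite !normc_ind -e1 -e2 eqxx.
have /negbTE -> : m1 != n1 by apply/eqP => h; exact: e3.
rewrite !mulr0 addr0 add0r !mulr1 => /(mulfI (lt0r_neq0 (E0 n1 m1))) h.
by apply/eqP; rewrite -(@eqrXn2 _ 2) ?normc_ge0 // h.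
Qed.

(** If n1 = n2, then m1 = m2, the symbol is a + b times one monomial, and the indicator of n1 tests
    it. Otherwise indicators match the exponents, the crossed matching being excluded since it would
    give n1 = n2. *)
Lemma hyponormal_cond_eq : (n1 + m2 = n2 + m1)%N ->
  (n1 = n2 -> m1 = m2 -> a + b != 0) ->
  [/\ n1 = m1, m1 = n2 & n2 = m2] \/
  [/\ n1 = m1, n2 = m2, n1 <> n2 & Im (a * b^*) = 0].
Proof.
move=> nm ab0.
have key k := hyponormal_test_eq (fun j => (j == k)%:R) nm.
have E0 i j : 0 < E i j by rewrite ltr0n.
have [n12|/eqP n12] := eqVneq n1 n2.
  have m12 : m1 = m2 by lia.
  left; suff : n1 = m1 by split; lia.
  apply/eqP; apply: contraT => /negbTE h.
  have := key n1; rewrite -n12 -m12 eqxx eq_sym h !mulr0 addr0 !mulr1 Normc.normc0.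
  move/eqP; rewrite expr0n /= mulr0 mulf_eq0 gt_eqF //=.
  by rewrite gt_eqF // normc_sqr_gt0 // ab0.
have m12 : m1 != m2 by lia.
have k1 : (n1 == m1) || (n1 == m2).
  apply: contraT; rewrite negb_or => /andP[/negbTE h1 /negbTE h2].
  have := key n1; rewrite eqxx ![_ == n1]eq_sym h1 h2 (introF eqP n12) !mulr0 !addr0 mulr1.
  move/eqP; rewrite Normc.normc0 expr0n /= mulr0 mulf_eq0 gt_eqF //=.
  by rewrite gt_eqF // normc_sqr_gt0.
have k2 : (n2 == m1) || (n2 == m2).
  apply: contraT; rewrite negb_or => /andP[/negbTE h1 /negbTE h2].
  have := key n2; rewrite eqxx ![m1 == _]eq_sym ![m2 == _]eq_sym h1 h2 (introF eqP n12).
  rewrite !mulr0 !addr0 add0r mulr1.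
  move/eqP; rewrite Normc.normc0 expr0n /= mulr0 mulf_eq0 gt_eqF //=.
  by rewrite gt_eqF // normc_sqr_gt0.
have [e1 e2] : n1 = m1 /\ n2 = m2 by lia.
right; split=> //.
(* Indicators miss the relative phase of a and b. With the values 1 and i the two sides are |a|^2 +
   |b|^2 plus and minus twice the imaginary part of a times the conjugate of b. *)
have := hyponormal_test_eq (fun j => if j == n1 then 1 else 'i%C) nm.
rewrite -e1 -e2 eqxx eq_sym (introF eqP n12) => /(mulfI (lt0r_neq0 (E0 n1 n1))).
rewrite !sqr_normc_parts; move: (a) (b) => [a1 a2] [b1 b2] /= h.
nra.
Qed.

End Necessity.

(** In the first two cases conjugation fixes the monomials, and l is the conjugate of a + b over a +
    b, or that of a over a. In the third it exchanges them, and l is the conjugate of b over a,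
    which equals that of a over b because |a| = |b|. *)
Lemma symbol_proportional {R : realType} (a b : R[i]) (n1 m1 n2 m2 : nat) :
  a != 0 -> b != 0 -> (n1 = n2 -> m1 = m2 -> a + b != 0) ->
  [\/ [/\ n1 = m1, m1 = n2 & n2 = m2],
      [/\ n1 = m1, n2 = m2, n1 <> n2 & complex.Im (a * b^*) = 0]
    | [/\ n1 = m2, m1 = n2, n1 <> m1 & Normc.normc a = Normc.normc b]] ->
  exists l, forall z, (symbol a b n1 m1 n2 m2 z)^* = l * symbol a b n1 m1 n2 m2 z.
Proof.
move=> a0 b0 ab0 h.
suff [l hl] : exists l, forall z : R[i],
    a^* * mono m1 n1 z + b^* * mono m2 n2 z = l * (a * mono n1 m1 z + b * mono n2 m2 z).
  by exists l => z; rewrite symbolJ !symbolE; exact: hl.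
have aux (c c' u w : R[i]) : c = c' / a * b -> c * u + c' * w = c' / a * (a * w + b * u).
  by move=> ->; field.
case: h => [[<- <- <-]|[<- <- _ h]|[<- <- _ h]] in ab0 *.
- have {}ab0 := ab0 erefl erefl; exists ((a^* + b^*) / (a + b)) => z.
  by rewrite -!mulrDl mulrA divfK.
- exists (a^* / a) => z.
  have e : b^* = a^* / a * b.
    apply: (mulfI a0); rewrite mulrC -[b^* * a]mulrC mulrA (mulrCA a) divff // mulr1.
    by move: h; case: (a) (b) => x y [x' y'] /= h; apply: complex_ext => /=; nra.
  rewrite addrC; exact: aux e.
- exists (b^* / a) => z.
  have e : a^* = b^* / a * b.
    apply: (mulfI a0); rewrite mulcJ h -mulcJ; move: (b^*) => c; by field.
  exact: aux e.
Qed.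

Theorem theorem3p1 (R : realType) (a b : R[i]) (n1 m1 n2 m2 : nat)
  (ha : a != 0) (hb : b != 0)
  (hn1 : (0 < n1)%N) (hm1 : (0 < m1)%N) (hn2 : (0 < n2)%N) (hm2 : (0 < m2)%N)
  (hphi : exists z : R[i], `|z| < 1 /\ symbol a b n1 m1 n2 m2 z != 0) :
  let T := dualToeplitz (symbol a b n1 m1 n2 m2) in
  (hyponormal (orthD L2h) T <-> normal_op (orthD L2h) T) /\
  (hyponormal (orthD L2h) T <->
     [\/ [/\ n1 = m1, m1 = n2 & n2 = m2],
         [/\ n1 = m1, n2 = m2, n1 <> n2 & eq_arg_mod_pi a b]
       | [/\ n1 = m2, m1 = n2, n1 <> m1 & `|a| = `|b|]]).
Proof.
move=> T; have bphi := symbol_bounded a b n1 m1 n2 m2.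
(* All that [hphi] contributes: the two terms do not cancel when their monomials coincide. *)
have ab0 : n1 = n2 -> m1 = m2 -> a + b != 0.
  move=> e1 e2; have [z [_]] := hphi; rewrite symbolE e1 e2 -mulrDl.
  by apply: contra => /eqP ->; rewrite mul0r.
have norm_eq : `|a| = `|b| <-> Normc.normc a = Normc.normc b.
  by rewrite !normc_normE; split=> [/(congr1 (@complex.Re R))|->].
have nor_hyp : normal_op (orthD L2h) T -> hyponormal (orthD L2h) T.
  by apply: normal_hyponormal => u [Lu _]; exact: dualToeplitz_orth.
set C := (X in _ /\ (_ <-> X)).
have hyp_C : hyponormal (orthD L2h) T -> C.
  move=> hyp; have [nm|nm] := eqVneq (n1 + m2)%N (n2 + m1)%N.
    have [c1|[e1 e2 n12 i0]] := hyponormal_cond_eq hn1 hm1 hn2 hm2 hyp ha hb nm ab0.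
      exact: Or31.
    by apply: Or32; split=> //; exact/eq_arg_mod_piP.
  have [e1 e2 n12 n0] := hyponormal_cond_neq hn1 hm1 hn2 hm2 hyp ha hb nm.
  by apply: Or33; split=> //; exact/norm_eq.
have C_nor : C -> normal_op (orthD L2h) T.
  move=> hC; have [|l hl] := @symbol_proportional _ _ _ n1 m1 n2 m2 ha hb ab0.
    case: hC => [c1|[e1 e2 n12 /(eq_arg_mod_piP ha hb) i0]|[e1 e2 n12 /norm_eq n0]].
    - exact: Or31.
    - exact: Or32.
    - exact: Or33.
  exact: normal_of_proportional hl.
by split; [split=> [/hyp_C/C_nor|/nor_hyp]|split=> [/hyp_C|/C_nor/nor_hyp]].
Qed.
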